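(* In the setting described in the context (unknown parameter $\vartheta=b\in\Theta=(\alpha_b,\beta_b)$), let $v\in(0,1]$, $t=[vT]$ and $\vartheta_0\in\Theta$. Then for any estimator $\bar m_{t,T}$ of $m(\vartheta,t)$ based on the observations $X^t=(X_0,\dots,X_t)$, $$\lim_{\nu\to0}\ \liminf_{T\to\infty}\ \sup_{|\vartheta-\vartheta_0|\le\nu}t\,\mathbf{E}_\vartheta\left|\bar m_{t,T}-m(\vartheta,t)\right|^2\ \ge\ S_b^\star(\vartheta_0)^2,\qquad S_b^\star(\vartheta_0)^2=\frac{\dot B^*(\vartheta_0,\vartheta_0)^2}{\mathrm{I}_b(\vartheta_0)\left(1-A(\vartheta_0)^2\right)}.$$
   Context: Model: $X_t=fY_{t-1}+\sigma w_t$, $Y_t=aY_{t-1}+\vartheta v_t$, $t\ge1$; $X^T=(X_0,\dots,X_T)$ is observed, $Y$ is hidden; $w_t,v_t$, $t\ge 1$, are independent standard Gaussian variables, independent of the centered Gaussian initial values $(X_0,Y_0)$, which have known variances $d_x^2$, $d_y^2$ and may be correlated, $\rho_{xy}=\mathbf{E}X_0Y_0$. The constants $f\ne0$, $a^2\in[0,1)$, $\sigma^2>0$ are known; the unknown parameter is $\vartheta=b\in\Theta=(\alpha_b,\beta_b)$, a bounded interval with $\alpha_b>0$. $\mathbf{P}_\vartheta,\mathbf{E}_\vartheta$ denote probability and expectation under the value $\vartheta$. $[x]$ is the integer part of $x$. Notation: $$\gamma_*(\vartheta)=\frac{f^2\vartheta^2-\sigma^2(1-a^2)}{2f^2}+\frac12\left[\left(\frac{\sigma^2(1-a^2)}{f^2}-\vartheta^2\right)^2+\frac{4\vartheta^2\sigma^2}{f^2}\right]^{1/2},\quad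 P(\vartheta)=\sigma^2+f^2\gamma_*(\vartheta),\quad A(\vartheta)=\frac{a\sigma^2}{P(\vartheta)};$$ a dot denotes the derivative with respect to $\vartheta$; $$\dot B^*(\vartheta,\vartheta)=\frac{af\sigma^2\dot\gamma_*(\vartheta)}{P(\vartheta)^{3/2}},\qquad \mathrm{I}_b(\vartheta)=\frac{\dot P(\vartheta)^2\left[P(\vartheta)^2+a^2\sigma^4\right]}{2P(\vartheta)^2\left[P(\vartheta)^2-a^2\sigma^4\right]}.$$ Filter: $m(\vartheta,t)=\mathbf{E}_\vartheta(Y_t|X_0,\dots,X_t)$. It is supposed that $\mathbf{E}_\vartheta(Y_0-\mathbf{E}_\vartheta(Y_0|X_0))^2=\gamma_*(\vartheta)$ (a condition on the correlation between $X_0$ and $Y_0$ and on $d_x^2,d_y^2$), so that $m(\vartheta,t)=m_t(\vartheta)$, where $$m_t(\vartheta)=a\,m_{t-1}(\vartheta)+\frac{af\gamma_*(\vartheta)}{P(\vartheta)}\left[X_t-f m_{t-1}(\vartheta)\right],\quad t\ge1,$$ with the corresponding initial value $m_0(\vartheta)=\mathbf{E}_\vartheta(Y_0|X_0)$. Convention on initial values: the differences between $m_t(\vartheta)$ and its derivatives in $\vartheta$ and their stationary versions are treated as asymptotically negligible. *)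

(* Defs.v *)
From HB Require Import structures.
From mathcomp Require Import all_boot all_order all_algebra.
From mathcomp Require Import all_classical all_reals all_analysis.

Set Implicit Arguments.
Unset Strict Implicit.
Unset Printing Implicit Defensive.

Import Order.TTheory GRing.Theory Num.Theory.
Import numFieldNormedType.Exports.

Local Open Scope classical_set_scope.
Local Open Scope ring_scope.

Section Coefficients.
Context {R : realType}.
Variables (f a sigma : R).

Definition gamma_star (th : R) : R :=
  (f ^+ 2 * th ^+ 2 - sigma ^+ 2 * (1 - a ^+ 2)) / (2 * f ^+ 2)
  + 2^-1 * Num.sqrt ((sigma ^+ 2 * (1 - a ^+ 2) / f ^+ 2 - th ^+ 2) ^+ 2
                     + 4 * th ^+ 2 * sigma ^+ 2 / f ^+ 2).

Definition P_coef (th : R) : R := sigma ^+ 2 + f ^+ 2 * gamma_star th.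

Definition A_coef (th : R) : R := a * sigma ^+ 2 / P_coef th.

Definition dotB_star (th : R) : R :=
  a * f * sigma ^+ 2 * (derive1 gamma_star th) / (P_coef th `^ (3 / 2)).

Definition I_b (th : R) : R :=
  (derive1 P_coef th) ^+ 2 * (P_coef th ^+ 2 + a ^+ 2 * sigma ^+ 4)
  / (2 * P_coef th ^+ 2 * (P_coef th ^+ 2 - a ^+ 2 * sigma ^+ 4)).

Definition S_b_star_sq (th : R) : R :=
  dotB_star th ^+ 2 / (I_b th * (1 - A_coef th ^+ 2)).

End Coefficients.

Section Probability.
Context {R : realType} {d : measure_display} {T : measurableType d}.
Variable P : probability T R.

(* normal_prob 0 0 is the uniform law on [0, 1], hence the separate treatment
   of the degenerate Gaussian law. *)
Definition centered_normal (s : R) (A : set R) : \bar R :=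
  if s == 0 then dirac (0 : R) A else normal_prob 0 s A.

Definition has_law (Z : T -> R) (mu : set R -> \bar R) : Prop :=
  forall A : set R, measurable A -> P (Z @^-1` A) = mu A.

Definition centered_gaussian_pair (Z1 Z2 : T -> R) : Prop :=
  forall u1 u2 : R, exists s : R,
    has_law (fun x => u1 * Z1 x + u2 * Z2 x) (centered_normal s).

(* Mutual independence: the product rule on every finite subfamily. *)
Definition mutually_independent (I : eqType) (F : I -> set_system T) : Prop :=
  forall (s : seq I) (E : I -> set T), uniq s ->
    (forall i, i \in s -> F i (E i)) ->
    P (\bigcap_(i in [set` s]) E i) = (\prod_(i <- s) P (E i))%E.

(* M is a version of the conditional expectation of Z given the
   sub-sigma-algebra G. *)
Definition is_cond_exp (G : set_system T) (Z M : T -> R) : Prop :=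
  [/\ forall B : set R, measurable B -> G (M @^-1` B),
      P.-integrable setT (EFin \o M)
    & forall A, G A ->
        (\int[P]_(x in A) (M x)%:E = \int[P]_(x in A) (Z x)%:E)%E].

End Probability.

Section Model.
Context {R : realType} {d : measure_display} {T : measurableType d}.

Definition obs (X : nat -> T -> R) (t : nat) (x : T) : t.+1.-tuple R :=
  [tuple X i x | i < t.+1].

(* The initial pair (X_0, Y_0) and the noises w_t, v_t, t >= 1, index the
   family of independent sigma-algebras. *)
Definition model_sigma_algebras (X Y w v : nat -> T -> R)
    (i : unit + (nat + nat)) : set_system T :=
  match i with
  | inl _ => g_sigma_algebra_preimage (fun x => (X 0%N x, Y 0%N x))
  | inr (inl t) => g_sigma_algebra_preimage (w t.+1)
  | inr (inr t) => g_sigma_algebra_preimage (v t.+1)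
  end.

(* The values w 0 and v 0 are never used. *)
Definition hidden_ar_model (f a sigma dx dy rho th : R) (P : probability T R)
    (X Y w v : nat -> {mfun T >-> R}) : Prop :=
  [/\ forall t x, X t.+1 x = f * Y t x + sigma * w t.+1 x,
      forall t x, Y t.+1 x = a * Y t x + th * v t.+1 x,
      forall t, has_law P (w t.+1) (normal_prob 0 1)
             /\ has_law P (v t.+1) (normal_prob 0 1),
      mutually_independent P (model_sigma_algebras X Y w v)
    & [/\ centered_gaussian_pair P (X 0%N) (Y 0%N),
          'V_P[X 0%N] = (dx ^+ 2)%:E,
          'V_P[Y 0%N] = (dy ^+ 2)%:E
        & 'E_P[(fun x => X 0%N x * Y 0%N x)%R] = rho%:E]%E].

End Model.

(* Main.v *)
(* van Trees' inequality, used pathwise.  Since the initial error variance is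
   the stationary one, m(theta, t) is a linear filter of X^t with constant
   coefficients, and the innovations X_(t+1) - f m_t are sqrt(P) times
   standard Gaussian variables independent of the past.  Hence the law of X^t
   under theta has an explicit density relative to theta_0, with score S_t, and
   D_t = d m_t / d theta follows an explicit linear recursion.  For a prior r^2
   on [theta_0 - nu, theta_0 + nu] vanishing at both ends, integrating the
   derivative of (M - m_t) D_t r^2 (density) gives
     2 lambda int r^2 E D_t^2
       <= int r^2 E (M - m_t)^2 + lambda^2 int E (r D_t S_t + ...)^2.
   As t grows, E D_t^2 tends to the stationary variance V of D, and
   E (D_t S_t)^2 / t tends to V I, where I is the Fisher information per
   observation; lambda = 1 / (t I) yields V / I, the claimed constant.  The
   joint law of (X_0, Y_0), given only through its one-dimensional projections,
   is identified by the Cramer-Wold argument. *)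

Require Import Defs.
From HB Require Import structures.
From mathcomp Require Import all_boot all_order all_algebra.
From mathcomp Require Import all_classical all_reals all_analysis.
From mathcomp Require Import measurable_realfun.
From mathcomp Require Import ring lra.

Set Implicit Arguments.
Unset Strict Implicit.
Unset Printing Implicit Defensive.

Import Order.TTheory GRing.Theory Num.Theory.
Import numFieldNormedType.Exports.

Local Open Scope classical_set_scope.
Local Open Scope ring_scope.

(** * Gaussian integrals *)

(** Van Trees' inequality is integrated under the single law [P th0], the other parameters entering
    through a likelihood ratio. The path is then fixed while the parameter moves: only recursions
    along a fixed sequence are differentiated, no derivative is taken under an expectation, and
    Tonelli exchanges the integrals. The ratio has no factor for X_0, whose variance d_x^2 is the
    same for every parameter. The sharp constant needs E (D S)^2 to behave like E D^2 E S^2,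
    although D and S are built from the same innovations. It does because D forgets its past
    geometrically while S accumulates: the one-step recursion contracts E (D S)^2 by A^2 and feeds
    in b E S^2, where b / (1 - A^2) = V. Uniformity near theta_0 comes from bounds on a few
    coefficients, perturbed by an eta that is chosen before t grows. Differentiability of m_0 = c
    X_0 in the parameter has to be derived: c^2 d_x^2 = d_y^2 - gamma with gamma strictly increasing
    forces c to be nonzero, and continuity of rho fixes its sign locally. *)

Section density.
Context {R : realType} d (T : measurableType d).
Variables (mu nu : {measure set T -> \bar R}) (p : T -> R).
Hypotheses (mp : measurable_fun setT p) (p0 : forall x, 0 <= p x).
Hypothesis nuE : forall A, measurable A -> nu A = (\int[mu]_(x in A) (p x)%:E)%E.
Import HBNNSimple.

Let density_indic A : measurable A ->
  (\int[nu]_x (\1_A x)%:E = \int[mu]_x ((\1_A x)%:E * (p x)%:E))%E.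
Proof.
move=> mA; rewrite integral_indic//= setIT nuE// integral_mkcond.
apply: eq_integral => x _; rewrite patchE indicE.
by case: ifPn => _; rewrite ?mul1e ?mul0e.
Qed.

Let density_nnsfun (f : {nnsfun T >-> R}) :
  (\int[nu]_x (f x)%:E = \int[mu]_x ((f x)%:E * (p x)%:E))%E.
Proof.
under [LHS]eq_integral do rewrite fimfunE -fsumEFin//.
rewrite [LHS]ge0_integral_fsum//; last 2 first.
  - by move=> r; exact/measurable_EFinP/measurableT_comp.
  - by move=> n x _; rewrite EFinM nnfun_muleindic_ge0.
under [RHS]eq_integral.
  move=> x xD; rewrite fimfunE -fsumEFin// muleC ge0_mule_fsumr; last first.
    by move=> r; rewrite EFinM nnfun_muleindic_ge0.
  over.
rewrite [RHS]ge0_integral_fsum//; last 2 first.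
  - move=> r; apply: emeasurable_funM; first exact/measurable_EFinP.
    exact/measurable_EFinP/measurableT_comp.
  - move=> n x _; rewrite mule_ge0//; first by rewrite lee_fin.
    by rewrite EFinM nnfun_muleindic_ge0.
apply: eq_fsbigr => r _.
have [r0|r0] := leP 0 r; last first.
  rewrite preimage_nnfun0//.
  by rewrite !integral0_eq// => x _; rewrite indicE in_set0 ?mulr0 ?mule0.
under eq_integral do rewrite EFinM.
rewrite ge0_integralZl//; last exact/measurable_EFinP/measurable_indic.
rewrite density_indic// -ge0_integralZl//.
- by apply: eq_integral => x _; rewrite EFinM muleA muleC.
- apply: emeasurable_funM; last exact/measurable_EFinP.
  exact/measurable_EFinP/measurable_indic.
- by move=> x _; rewrite mule_ge0 ?lee_fin.
Qed.

Lemma ge0_integral_density (f : T -> \bar R) :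
  measurable_fun setT f -> (forall x, 0 <= f x)%E ->
  (\int[nu]_x f x = \int[mu]_x (f x * (p x)%:E))%E.
Proof.
move=> mf f0.
pose f_ := nnsfun_approx measurableT mf.
transitivity (lim (\int[nu]_x (f_ n x)%:E @[n --> \oo])%E).
  rewrite -monotone_convergence//=.
  - apply: eq_integral => ? /[!inE] xD; apply/esym/cvg_lim => //=.
    exact: cvg_nnsfun_approx.
  - by move=> n; exact/measurable_EFinP/measurable_funTS.
  - by move=> n ? _; rewrite lee_fin.
  - by move=> ? _ ? ? mn; rewrite lee_fin; exact/lefP/nd_nnsfun_approx.
transitivity (lim (\int[mu]_x ((f_ n x)%:E * (p x)%:E) @[n --> \oo])%E).
  by apply: congr_lim; apply/funext => n /=; exact: density_nnsfun.
rewrite -monotone_convergence//=.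
- apply: eq_integral => x /[!inE] xD; apply/cvg_lim => //.
  by apply: cvgeZr => //; exact: cvg_nnsfun_approx.
- move=> n; apply: emeasurable_funM; last exact/measurable_EFinP.
  exact/measurable_EFinP/measurable_funTS.
- by move=> n ? _; rewrite mule_ge0 ?lee_fin.
- move=> x _ ? ? ?; rewrite lee_wpmul2r ?lee_fin//.
  exact/lefP/nd_nnsfun_approx.
Qed.

End density.

Section image_measure.
Context d1 d2 (T1 : measurableType d1) (T2 : measurableType d2) {R : realType}.
Variables (mu : {measure set T1 -> \bar R}) (f : T1 -> T2).
Hypothesis mf : measurable_fun setT f.

(** The measurability proof is an argument so that the measure structure declared below can be
    inferred from the term alone. *)
Definition image_measure of measurable_fun setT f := pushforward mu f.

Let image0 : image_measure mf set0 = 0%E.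
Proof. exact: measure0. Qed.

Let image_ge0 A : (0 <= image_measure mf A)%E.
Proof. exact: measure_ge0. Qed.

Let image_sigma_additive : semi_sigma_additive (image_measure mf).
Proof. exact: measure_semi_sigma_additive. Qed.

HB.instance Definition _ := isMeasure.Build _ _ _ (image_measure mf)
  image0 image_ge0 image_sigma_additive.

Lemma ge0_integral_image (g : T2 -> \bar R) :
  measurable_fun setT g -> (forall y, 0 <= g y)%E ->
  (\int[image_measure mf]_y g y = \int[mu]_x g (f x))%E.
Proof. by move=> mg g0; rewrite ge0_integral_pushforward. Qed.

End image_measure.

(** * Lebesgue measure under affine maps, shears and rotations *)

Section lebesgue_affine.
Context {R : realType}.
Local Notation leb := (@lebesgue_measure R).

Let aff (k c : R) : R -> R := fun x => k * x + c.

Let measurable_aff k c : measurable_fun setT (aff k c : measurableTypeR R -> measurableTypeR R).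
Proof. by apply: measurable_funD => //; apply: measurable_funM. Qed.

(** The image of Lebesgue measure under x -> k x + c, scaled by k, gives half-open intervals their
    length, which characterises Lebesgue measure. *)
Lemma ge0_integral_affine (k c : R) (f : R -> \bar R) : 0 < k ->
  measurable_fun setT f -> (forall x, 0 <= f x)%E ->
  (\int[leb]_x f x = k%:E * \int[leb]_x f (k * x + c)%R)%E.
Proof.
move=> k0 mf f0.
pose kn : {nonneg R} := NngNum (ltW k0).
pose nu := mscale kn (image_measure leb (measurable_aff k c)).
have nuE A : measurable A -> leb A = nu A.
  apply: lebesgue_measure_unique => _ [[u v]] _ <- /=.
  rewrite /nu/= /mscale/= /image_measure /pushforward/=.
  have -> : aff k c @^-1` `]u, v] = `](u - c) / k, (v - c) / k]%classic.
    apply/seteqP; split => x /=; rewrite !in_itv/= /aff => /andP[h1 h2].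
      by rewrite ltr_pdivrMr// ler_pdivlMr// mulrC ltrBlDr lerBrDr h1 h2.
    by move: h1 h2; rewrite ltr_pdivrMr// ler_pdivlMr// mulrC ltrBlDr lerBrDr => -> ->.
  rewrite !lebesgue_measure_itv/= !lte_fin ltr_pM2r ?invr_gt0// ltrD2r.
  case: ifP => // _; last by rewrite mule0.
  rewrite -!EFinD -EFinM; congr EFin.
  by field; rewrite gt_eqF.
transitivity (\int[nu]_x f x)%E.
  by apply: eq_measure_integral => A mA _; exact: nuE.
rewrite /nu ge0_integral_mscale//=; congr (_ * _)%E.
by rewrite ge0_integral_image.
Qed.

End lebesgue_affine.

Section shears.
Context {R : realType}.
Local Notation leb := (@lebesgue_measure R).
Implicit Types H : R * R -> \bar R.

Lemma shear_snd H k : measurable_fun setT H -> (forall z, 0 <= H z)%E ->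
  (\int[leb]_x \int[leb]_y H (x, (y + k * x)%R) = \int[leb]_x \int[leb]_y H (x, y))%E.
Proof.
move=> mH H0; apply: eq_integral => x _.
rewrite [RHS](@ge0_integral_affine _ 1 (k * x))//.
  by rewrite mul1e; apply: eq_integral => y _; rewrite mul1r.
exact: measurableT_comp.
Qed.

(** The translated coordinate is the outer one, so Tonelli is applied before and after the
    translation. *)
Lemma shear_fst H k : measurable_fun setT H -> (forall z, 0 <= H z)%E ->
  (\int[leb]_x \int[leb]_y H ((x + k * y)%R, y) = \int[leb]_x \int[leb]_y H (x, y))%E.
Proof.
move=> mH H0.
rewrite (@fubini_tonelli _ _ _ _ _ leb leb (fun z => H ((z.1 + k * z.2)%R, z.2)))//; last first.
  apply: measurableT_comp => //; apply: measurable_fun_pair => //.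
  by apply: measurable_funD => //; apply: measurable_funM.
rewrite [RHS](@fubini_tonelli _ _ _ _ _ leb leb H)//.
apply: eq_integral => y _.
rewrite [RHS](@ge0_integral_affine _ 1 (k * y))//.
  by rewrite mul1e; apply: eq_integral => x _; rewrite mul1r.
exact: measurableT_comp.
Qed.

(* A rotation of angle different from pi is a product of three shears. *)
Lemma lebesgue_rotation H (c s : R) : c ^+ 2 + s ^+ 2 = 1 -> c != -1 ->
  measurable_fun setT H -> (forall z, 0 <= H z)%E ->
  (\int[leb]_x \int[leb]_y H ((c * x + s * y)%R, (- s * x + c * y)%R) =
   \int[leb]_x \int[leb]_y H (x, y))%E.
Proof.
move=> cs c1 mH H0.
have c10 : 1 + c != 0 by rewrite addrC addr_eq0.
(* The tangent of the half angle: the outer shears have coefficient t and the middle one -s. It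
   requires 1 + c to be nonzero, hence the exclusion of the angle pi. *)
pose t := s / (1 + c).
have Ec : 1 - t * s = c.
  have -> : 1 - t * s = (1 + c - s ^+ 2) / (1 + c) by rewrite /t; field.
  have -> : s ^+ 2 = 1 - c ^+ 2 by rewrite -cs; ring.
  by field.
have Es : t * (1 + c) = s by rewrite /t divfK.
clearbody t.
pose H1 (z : R * R) := H ((z.1 + t * z.2)%R, z.2).
pose H2 (z : R * R) := H1 (z.1, (z.2 + - s * z.1)%R).
have mH1 : measurable_fun setT H1.
  apply: measurableT_comp => //; apply: measurable_fun_pair => //.
  by apply: measurable_funD => //; apply: measurable_funM.
have mH2 : measurable_fun setT H2.
  apply: measurableT_comp => //; apply: measurable_fun_pair => //.
  by apply: measurable_funD => //; apply: measurable_funM.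
apply: etrans (@shear_fst H t mH H0).
apply: etrans (@shear_snd H1 (- s) mH1 (fun z => H0 _)).
apply: etrans (@shear_fst H2 t mH2 (fun z => H0 _)).
apply: eq_integral => x _; apply: eq_integral => y _.
rewrite /H2 /H1/=; congr (H (_, _)).
  by transitivity ((1 - t * s) * x + t * (1 + (1 - t * s)) * y); [rewrite Ec Es|ring].
by transitivity (- s * x + (1 - t * s) * y); [rewrite Ec|ring].
Qed.

End shears.

(* Locking keeps conversion from unfolding the measure. *)
HB.lock Definition std_normal (R : realType) : probability (measurableTypeR R) R :=
  normal_prob 0 1.

(** * The standard normal law and its rotation invariance *)

Section standard_normal.
Context {R : realType}.
Local Notation leb := (@lebesgue_measure R).
Local Notation G := (std_normal R).

Lemma normal_fun_affine (m s z : R) : s != 0 ->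
  normal_fun m s (m + s * z) = normal_fun 0 1 z.
Proof.
move=> s0; rewrite /normal_fun; congr expR.
by field.
Qed.

Lemma normal_prob_density (m s : R) (f : R -> \bar R) :
  measurable_fun setT f -> (forall x, 0 <= f x)%E ->
  (\int[normal_prob m s]_x f x = \int[leb]_x (f x * (normal_pdf m s x)%:E))%E.
Proof.
move=> mf f0; apply: ge0_integral_density.
- exact: measurable_normal_pdf.
- by move=> x; exact: normal_pdf_ge0.
- by move=> A mA; rewrite /normal_prob.
- exact: mf.
- exact: f0.
Qed.

Lemma std_normal_density (f : R -> \bar R) :
  measurable_fun setT f -> (forall x, 0 <= f x)%E ->
  (\int[G]_x f x = \int[leb]_x (f x * (normal_pdf 0 1 x)%:E))%E.
Proof. by rewrite unlock; exact: normal_prob_density. Qed.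

Lemma ge0_integral_normal_pdf (m s : R) (f : R -> \bar R) : 0 < s ->
  measurable_fun setT f -> (forall x, 0 <= f x)%E ->
  (\int[leb]_x (f x * (normal_pdf m s x)%:E) = \int[G]_z f (m + s * z)%R)%E.
Proof.
move=> s0 mf f0.
have mf' : measurable_fun setT (fun z => f (m + s * z)).
  apply: measurableT_comp => //.
  by apply: measurable_funD => //; apply: measurable_funM.
rewrite (@std_normal_density _ mf'); last by [].
rewrite (@ge0_integral_affine _ s m); first last.
- by move=> x; rewrite mule_ge0 ?lee_fin ?normal_pdf_ge0.
- by apply: emeasurable_funM => //; apply/measurable_EFinP; exact: measurable_normal_pdf.
- exact: s0.
rewrite -ge0_integralZl; first last.
- by rewrite lee_fin ltW.
- by move=> x _; rewrite mule_ge0 ?lee_fin ?normal_pdf_ge0.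
- apply: emeasurable_funM.
    by under eq_fun do rewrite addrC.
  apply/measurable_EFinP; apply: measurableT_comp; first exact: measurable_normal_pdf.
  by apply: measurable_funD => //; apply: measurable_funM.
- exact: measurableT.
apply: eq_integral => z _.
rewrite muleCA [s * z + m]addrC; congr (_ * _)%E.
rewrite -EFinM !normal_pdfE ?oner_neq0 ?gt_eqF//; congr EFin.
rewrite normal_fun_affine ?gt_eqF// mulrA; congr (_ * _).
rewrite /normal_peak.
rewrite expr1n -mulrnAr sqrtrM ?sqr_ge0// sqrtr_sqr gtr0_norm//.
by rewrite invfM mulrA divff ?gt_eqF// !mul1r.
Qed.

Lemma ge0_integral_normal (m s : R) (f : R -> \bar R) : 0 < s ->
  measurable_fun setT f -> (forall x, 0 <= f x)%E ->
  (\int[normal_prob m s]_x f x = \int[G]_z f (m + s * z)%R)%E.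
Proof.
move=> s0 mf f0; rewrite -ge0_integral_normal_pdf//.
exact: (@normal_prob_density m s).
Qed.

Lemma normal_pdf01M (x y : R) : normal_pdf 0 1 x * normal_pdf 0 1 y =
  normal_peak 1 ^+ 2 * expR (- (x ^+ 2 + y ^+ 2) / 2).
Proof.
rewrite !normal_pdfE ?oner_neq0// mulrACA -expr2; congr (_ * _).
rewrite /normal_fun -expRD; congr expR.
by rewrite !subr0 expr1n -mulr_natr mul1r -mulrDl opprD.
Qed.

Lemma integral_normal2 (F : R * R -> \bar R) :
  measurable_fun setT F -> (forall z, 0 <= F z)%E ->
  (\int[G]_x \int[G]_y F (x, y) = \int[leb]_x \int[leb]_y
     (F (x, y) * (normal_peak 1 ^+ 2 * expR (- (x ^+ 2 + y ^+ 2) / 2))%:E))%E.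
Proof.
move=> mF F0.
have mp := @measurable_normal_pdf R 0 1.
have p0 := @normal_pdf_ge0 R 0 1.
rewrite (@std_normal_density); last 2 first.
- exact: (@measurable_fun_fubini_tonelli_F _ _ _ _ _ G F).
- by move=> x; exact: integral_ge0.
apply: eq_integral => x _.
rewrite (@std_normal_density)//; last exact: measurableT_comp.
rewrite muleC -ge0_integralZl//; last 3 first.
- by apply: emeasurable_funM; [exact: measurableT_comp|exact/measurable_EFinP].
- by move=> y _; rewrite mule_ge0 ?lee_fin.
- by rewrite lee_fin.
apply: eq_integral => y _; rewrite -normal_pdf01M muleCA EFinM.
by [].
Qed.

(** The density of a pair of independent normals depends on x^2 + y^2 only, so it can be absorbed
    into the integrand of [lebesgue_rotation]. The moments, the characteristic function and the
    Kalman step below all rest on this invariance. *)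
Lemma normal_rotation (F : R * R -> \bar R) (c s : R) :
  c ^+ 2 + s ^+ 2 = 1 -> c != -1 ->
  measurable_fun setT F -> (forall z, 0 <= F z)%E ->
  (\int[G]_x \int[G]_y F ((c * x + s * y)%R, (- s * x + c * y)%R) =
   \int[G]_x \int[G]_y F (x, y))%E.
Proof.
move=> cs c1 mF F0.
have mrot : measurable_fun setT (fun z : R * R => (c * z.1 + s * z.2, - s * z.1 + c * z.2)).
  by apply: measurable_fun_pair; apply: measurable_funD => //; apply: measurable_funM.
apply: etrans (@integral_normal2 (fun z => F (c * z.1 + s * z.2, - s * z.1 + c * z.2)) _ _) _.
- exact: measurableT_comp.
- by move=> z; exact: F0.
apply: etrans (esym (@integral_normal2 F mF F0)).
pose H z := (F z * (normal_peak 1 ^+ 2 * expR (- (z.1 ^+ 2 + z.2 ^+ 2) / 2))%:E)%E.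
have mH : measurable_fun setT H.
  apply: emeasurable_funM => //; apply/measurable_EFinP/measurable_funM => //.
  apply: measurableT_comp => //; apply: measurable_funM => //.
  apply: measurableT_comp => //.
  by apply: measurable_funD; apply: measurable_funX.
have nrm (x y : R) : (c * x + s * y) ^+ 2 + (- s * x + c * y) ^+ 2 = x ^+ 2 + y ^+ 2.
  transitivity ((c ^+ 2 + s ^+ 2) * (x ^+ 2 + y ^+ 2)); first by ring.
  by rewrite cs mul1r.
have H0 z : (0 <= H z)%E.
  by rewrite mule_ge0// lee_fin mulr_ge0 ?sqr_ge0 ?expR_ge0.
apply: etrans (@lebesgue_rotation _ H c s cs c1 mH H0).
apply: eq_integral => x _; apply: eq_integral => y _.
by rewrite /H /= nrm.
Qed.

End standard_normal.

Section measurable_fun_comp.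
Context d (T : measurableType d) {R : realType}.
Implicit Types (D : set T) (f : T -> R).

Lemma measurable_fun_expR D f : measurable_fun D f -> measurable_fun D (fun x => expR (f x)).
Proof. by move=> mf; apply: measurableT_comp => //; exact: measurable_expR. Qed.

Lemma measurable_fun_cos D f : measurable_fun D f -> measurable_fun D (fun x => cos (f x)).
Proof.
move=> mf; apply: measurableT_comp => //.
by apply: continuous_measurable_fun; exact: continuous_cos.
Qed.

Lemma measurable_fun_sin D f : measurable_fun D f -> measurable_fun D (fun x => sin (f x)).
Proof.
move=> mf; apply: measurableT_comp => //.
by apply: continuous_measurable_fun; exact: continuous_sin.
Qed.

End measurable_fun_comp.

Lemma measurable_fun_pow d (T : measurableType d) (R : realType) (D : set T)
    (f : T -> R) n : measurable_fun D f -> measurable_fun D (fun x => f x ^+ n).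
Proof. by move=> mf; exact: measurable_funX. Qed.

Lemma measurable_fun_fst d d1 d2 (T : measurableType d) (T1 : measurableType d1)
    (T2 : measurableType d2) (D : set T) (f : T -> T1 * T2) :
  measurable_fun D f -> measurable_fun D (fun x => (f x).1).
Proof. by move=> mf; exact: measurableT_comp. Qed.

Lemma measurable_fun_snd d d1 d2 (T : measurableType d) (T1 : measurableType d1)
    (T2 : measurableType d2) (D : set T) (f : T -> T1 * T2) :
  measurable_fun D f -> measurable_fun D (fun x => (f x).2).
Proof. by move=> mf; exact: measurableT_comp. Qed.

(* Syntactic dispatch: unification up to conversion diverges on such goals. *)
Ltac measurability := repeat (simpl; first [ eassumption |
  lazymatch goal with
  | |- measurable_fun _ (fun x => EFin _) => apply/measurable_EFinP
  | |- measurable_fun _ (fun _ => ?c) => exact: measurable_cst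
  | |- measurable_fun _ (fun x => x) => exact: measurable_id
  | |- measurable_fun _ fst => exact: measurable_funTS measurable_fst
  | |- measurable_fun _ snd => exact: measurable_funTS measurable_snd
  | |- measurable_fun _ (fun x => fst _) => apply: measurable_fun_fst
  | |- measurable_fun _ (fun x => snd _) => apply: measurable_fun_snd
  | |- measurable_fun _ (fun x => GRing.add _ _) => apply: measurable_funD
  | |- measurable_fun _ (fun x => GRing.mul _ _) => apply: measurable_funM
  | |- measurable_fun _ (fun x => GRing.opp _) => apply: measurable_funN
  | |- measurable_fun _ (fun x => GRing.exp _ _) => apply: measurable_fun_pow
  | |- measurable_fun _ (fun x => expR _) => apply: measurable_fun_expR
  | |- measurable_fun _ (fun x => cos _) => apply: measurable_fun_cos
  | |- measurable_fun _ (fun x => sin _) => apply: measurable_fun_sin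
  | |- measurable_fun _ cos => apply: (@measurable_fun_cos _ _ _ _ id)
  | |- measurable_fun _ sin => apply: (@measurable_fun_sin _ _ _ _ id)
  | |- measurable_fun _ id => exact: measurable_id
  | |- measurable_fun _ (fun x => (_, _)) => apply: measurable_fun_pair
  | |- measurable_fun _ (fun x => mule _ _) => apply: emeasurable_funM
  | |- measurable_fun _ (fun x => adde _ _) => apply: emeasurable_funD
  | mf : measurable_fun setT ?f |- measurable_fun _ (fun x => ?f _) =>
      apply: (measurableT_comp mf)
  end ]).

(** * Moments of the standard normal law *)

Section normal_moments.
Context {R : realType}.
Local Notation leb := (@lebesgue_measure R).
Local Notation G := (std_normal R).

Lemma normal_rotation1 (g : R -> \bar R) (c s : R) :
  c ^+ 2 + s ^+ 2 = 1 -> c != -1 ->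
  measurable_fun setT g -> (forall z, 0 <= g z)%E ->
  (\int[G]_x \int[G]_y g (c * x + s * y)%R = \int[G]_x g x)%E.
Proof.
move=> cs c1 mg g0.
apply: etrans (@normal_rotation _ (fun z => g z.1) c s cs c1 _ _) _ => /=.
- exact: measurableT_comp.
- by move=> z; exact: g0.
apply: eq_integral => x _.
by rewrite integral_cst// -[RHS]mule1; congr (_ * _)%E; exact: probability_setT.
Qed.

(** The angle pi is excluded, so the quarter turn is used and its second coordinate, -x, is read
    off. *)
Lemma normal_sym (g : R -> \bar R) :
  measurable_fun setT g -> (forall z, 0 <= g z)%E ->
  (\int[G]_x g (- x)%R = \int[G]_x g x)%E.
Proof.
move=> mg g0.
have := @normal_rotation _ (fun z => g z.2) 0 1.
rewrite expr0n expr1n add0r eq_sym oppr_eq0 oner_eq0 => /(_ erefl isT).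
have m2 : measurable_fun setT (fun z : R * R => g z.2) by exact: measurableT_comp.
move=> /(_ m2 (fun z => g0 _)) /= h.
transitivity (\int[G]_x \int[G]_y g (- 1 * x + 0 * y)%R)%E.
  apply: eq_integral => x _.
  under eq_integral do rewrite mul0r addr0 mulN1r.
  by rewrite integral_cst// -[LHS]mule1; congr (_ * _)%E; exact/esym/probability_setT.
rewrite h integral_cst//.
by rewrite -[RHS]mule1; congr (_ * _)%E; exact: probability_setT.
Qed.

Lemma integral_std_normal_cst (k : R) : (\int[G]_z k%:E = k%:E)%E.
Proof.
by rewrite integral_cst// -[RHS]mule1; congr (_ * _)%E; exact: probability_setT.
Qed.

Lemma normal_expR (u : R) :
  (\int[G]_z (expR (u * z))%:E = (expR (u ^+ 2 / 2))%:E)%E.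
Proof.
rewrite std_normal_density; last 2 first.
- by measurability.
- by move=> x; rewrite lee_fin expR_ge0.
have E (z : R) : expR (u * z) * normal_pdf 0 1 z = expR (u ^+ 2 / 2) * normal_pdf u 1 z.
  rewrite !normal_pdfE ?oner_neq0// [LHS]mulrCA [RHS]mulrCA; congr (_ * _).
  rewrite /normal_fun -!expRD; congr expR.
  by field.
under eq_integral do rewrite -EFinM E EFinM.
rewrite ge0_integralZl; first by rewrite integral_normal_pdf mule1.
- exact: measurableT.
- by apply/measurable_EFinP; exact: measurable_normal_pdf.
- by move=> x _; rewrite lee_fin normal_pdf_ge0.
- by rewrite lee_fin expR_ge0.
Qed.

Lemma integrable_normal_expR (u : R) : G.-integrable setT (fun z => (expR (u * z))%:E).
Proof.
apply/integrableP; split; first by measurability.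
under eq_integral do rewrite /= ger0_norm ?expR_ge0//.
by rewrite normal_expR ltry.
Qed.

(** Since |z|^n / n! is bounded by exp |z|, the power is dominated by n! (exp z + exp (-z)). *)
Lemma integrable_normalX n : G.-integrable setT (fun z => (z ^+ n)%:E).
Proof.
have iE := integrableD measurableT (integrable_normal_expR 1) (integrable_normal_expR (-1)).
have iF := integrableZl measurableT n`!%:R iE.
apply: le_integrable iF => //; first by measurability.
move=> z _ /=; rewrite lee_fin mul1r mulN1r [leRHS]ger0_norm; last first.
  by rewrite mulr_ge0// addr_ge0// expR_ge0.
have le_exp (y : R) : 0 <= y -> y ^+ n <= n`!%:R * expR y.
  move=> y0; case: n => [|n].
    by rewrite expr0 fact0 mul1r -expR0 ler_expR.
  rewrite mulrC -ler_pdivrMr ?ltr0n ?fact_gt0//.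
  by apply: le_trans (expR_ge1Dxn n y0); rewrite lerDr.
rewrite normrX; apply: le_trans (le_exp _ (normr_ge0 z)) _.
rewrite ler_wpM2l//; have [z0|z0] := leP 0 z.
  by rewrite ger0_norm// lerDl expR_ge0.
by rewrite ltr0_norm// lerDr expR_ge0.
Qed.

Definition normal_moment n : R := (\int[G]_z z ^+ n)%R.

Lemma normal_momentE n : (\int[G]_z (z ^+ n)%:E = (normal_moment n)%:E)%E.
Proof.
rewrite /normal_moment /Rintegral fineK//.
exact: (integrable_fin_num measurableT (integrable_normalX n)).
Qed.

Lemma integral_normal_poly n (a : nat -> R) :
  G.-integrable setT (fun z => (\sum_(i < n) a i * z ^+ i)%:E) /\
  (\int[G]_z (\sum_(i < n) a i * z ^+ i)%:E =
   (\sum_(i < n) a i * normal_moment i)%:E)%E.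
Proof.
elim: n => [|n [iS IH]].
  under eq_fun do rewrite big_ord0.
  by rewrite big_ord0 integral0; split => //; exact: integrable0.
have iZ := integrableZl measurableT (a n) (integrable_normalX n).
split.
  under eq_fun do rewrite big_ord_recr/= EFinD EFinM.
  exact: integrableD.
under eq_integral do rewrite big_ord_recr/= EFinD EFinM.
rewrite big_ord_recr/= [LHS]integralD// IH EFinD; congr (_ + _)%E.
by rewrite integralZl ?normal_momentE ?EFinM//; exact: integrable_normalX.
Qed.

Lemma normal_moment0 : normal_moment 0 = 1.
Proof.
apply: EFin_inj; rewrite -normal_momentE; under eq_integral do rewrite expr0.
exact: integral_std_normal_cst.
Qed.

Lemma normal_moment_odd n : odd n -> normal_moment n = 0.
Proof.
move=> no.
(* [normal_sym] applies to nonnegative functions, so z^n is completed by the even terms 1 + z^(2n),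
   which the reflection leaves unchanged. *)
have q0 (z : R) : 0 <= 1 + z ^+ n + z ^+ (n + n).
  have -> : 1 + z ^+ n + z ^+ (n + n) = (z ^+ n + 2^-1) ^+ 2 + 3 / 4.
    by rewrite exprD; field.
  by rewrite addr_ge0 ?sqr_ge0.
have I1 := finite_measure_integrable_cst G (1 : R) measurableT.
have IE (k : R) : (\int[G]_z (1 + k * z ^+ n + z ^+ (n + n))%:E
    = (1 + k * normal_moment n + normal_moment (n + n))%:E)%E.
  under eq_integral do rewrite !EFinD EFinM.
  have Ik := integrableZl measurableT k (integrable_normalX n).
  rewrite integralD//; last 2 first.
  - exact: integrableD.
  - exact: integrable_normalX.
  rewrite integralD// integral_std_normal_cst integralZl//; last exact: integrable_normalX.
  by rewrite !normal_momentE.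
have : (\int[G]_z (1 + 1 * z ^+ n + z ^+ (n + n))%:E
      = \int[G]_z (1 + (-1) * z ^+ n + z ^+ (n + n))%:E)%E.
  have := @normal_sym (fun z => (1 + z ^+ n + z ^+ (n + n))%:E).
  have mq : measurable_fun setT (fun z : R => (1 + z ^+ n + z ^+ (n + n))%:E) by measurability.
  move=> /(_ mq (fun z => q0 z)) h.
  under eq_integral do rewrite mul1r.
  rewrite -h; apply: eq_integral => z _; congr EFin.
  have e1 : (- z) ^+ n = -1 * z ^+ n by rewrite exprNn -signr_odd no expr1.
  by rewrite !exprD e1; ring.
rewrite !IE => -[/eqP]; rewrite -subr_eq0 => /eqP; set m := normal_moment n => h.
by lra.
Qed.

(** The integrand times the density at z is the density at k z, so this is the substitution z -> k z
    in the total mass. *)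
Lemma integral_normal_sq_scale (k : R) : 0 < k ->
  (\int[G]_z (expR (- ((k ^+ 2 - 1) * z ^+ 2 / 2)))%:E = k^-1%:E)%E.
Proof.
move=> k0.
have := @ge0_integral_affine _ k 0 (fun x => (normal_pdf 0 1 x)%:E) k0.
have mp : measurable_fun setT (fun x : R => (normal_pdf 0 1 x)%:E).
  by apply/measurable_EFinP; exact: measurable_normal_pdf.
have p0 (x : R) : (0 <= (normal_pdf 0 1 x)%:E)%E by rewrite lee_fin normal_pdf_ge0.
move=> /(_ mp p0); rewrite integral_normal_pdf => h.
rewrite std_normal_density; last 2 first.
- by measurability.
- by move=> x; rewrite lee_fin expR_ge0.
have E (z : R) : expR (- ((k ^+ 2 - 1) * z ^+ 2 / 2)) * normal_pdf 0 1 z = normal_pdf 0 1 (k * z + 0).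
  rewrite !normal_pdfE ?oner_neq0// mulrCA; congr (_ * _).
  by rewrite /normal_fun -expRD; congr expR; field.
under eq_integral do rewrite -EFinM E.
set I := (\int[leb]_x _)%E in h *.
have : (k^-1%:E * 1%E = k^-1%:E * (k%:E * I))%E by rewrite -h.
by rewrite mule1 muleA -EFinM mulVf ?gt_eqF// mul1e => <-.
Qed.

(* Convexity of exp compares 1/k with 1 - (k^2 - 1) M_2 / 2 for every k > 0,
   an equality at k = 1. *)
Lemma normal_moment2 : normal_moment 2 = 1.
Proof.
set m := normal_moment 2.
have key (k : R) : 0 < k -> 1 - (k ^+ 2 - 1) * m / 2 <= k^-1.
  move=> k0; rewrite -lee_fin -integral_normal_sq_scale//.
  have -> : (1 - (k ^+ 2 - 1) * m / 2)%:E =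
      (\int[G]_z (1 + (- (k ^+ 2 - 1) / 2) * z ^+ 2)%:E)%E.
    under eq_integral do rewrite EFinD EFinM.
    rewrite integralD//; last 2 first.
    - exact: (finite_measure_integrable_cst G (1 : R) measurableT).
    - by apply: integrableZl => //; exact: integrable_normalX.
    rewrite integral_std_normal_cst integralZl//; last exact: integrable_normalX.
    by rewrite normal_momentE -/m -EFinM -EFinD; congr EFin; field.
  apply: le_integral => //.
  - under eq_fun do rewrite EFinD EFinM.
    apply: integrableD => //.
    + exact: (finite_measure_integrable_cst G (1 : R) measurableT).
    + by apply: integrableZl => //; exact: integrable_normalX.
  - apply/integrableP; split; first by measurability.
    under eq_integral do rewrite /= ger0_norm ?expR_ge0//.
    by rewrite integral_normal_sq_scale// ltry.
  - move=> z _; rewrite lee_fin; apply: le_trans (expR_ge1Dx _).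
    by rewrite lerD2l le_eqVlt; apply/orP; left; apply/eqP; field.
have m0 : 0 <= m by apply: Rintegral_ge0 => z _; exact: sqr_ge0.
have key' (k : R) : 0 < k -> k - k * (k ^+ 2 - 1) * m / 2 <= 1.
  move=> k0; have := key k k0; rewrite -(ler_pM2l k0) divff ?gt_eqF//.
  by apply: le_trans; rewrite le_eqVlt; apply/orP; left; apply/eqP; field.
apply/eqP; rewrite eq_le; apply/andP; split; rewrite leNgt; apply/negP => h.
(* At k = 1 - e, [key'] gives (1 - e) (1 - e/2) m <= 1, whereas the left side exceeds m - 3 e m / 2
   = 1 + (m - 1) / 4. The other case argues likewise at k = 1 + e. *)
- pose e := (m - 1) / (2 * m).
  have m_gt0 : 0 < m by lra.
  have e0 : 0 < e by rewrite divr_gt0; lra.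
  have em : 2 * e * m = m - 1 by rewrite /e; field; lra.
  have e1 : e < 1 by rewrite ltr_pdivrMr; lra.
  have := key' (1 - e) ltac:(lra).
  have -> : 1 - e - (1 - e) * ((1 - e) ^+ 2 - 1) * m / 2 =
    1 + e * (- 1 + (1 - e) * (1 - e / 2) * m) by field.
  have : 1 < (1 - e) * (1 - e / 2) * m by nra.
  by nra.
- pose e := (1 - m) / 4.
  have e0 : 0 < e by rewrite divr_gt0; lra.
  have em : m = 1 - 4 * e by rewrite /e; field.
  have e1 : e <= 4^-1 by lra.
  have := key' (1 + e) ltac:(lra).
  have -> : 1 + e - (1 + e) * ((1 + e) ^+ 2 - 1) * m / 2 =
    1 + e * (1 - (1 + e) * (1 + e / 2) * m) by field.
  have : (1 + e) * (1 + e / 2) * m < 1 by rewrite em; nra.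
  by nra.
Qed.

Let normal_poly6 (a0 a1 a2 a3 a4 a5 a6 : R) :
  (\int[G]_z (a0 + a1 * z + a2 * z ^+ 2 + a3 * z ^+ 3 + a4 * z ^+ 4
              + a5 * z ^+ 5 + a6 * z ^+ 6)%:E =
   (a0 + a2 + normal_moment 4 * a4 + normal_moment 6 * a6)%:E)%E.
Proof.
pose a i := nth 0 [:: a0; a1; a2; a3; a4; a5; a6] i.
have [_] := integral_normal_poly 7 a.
under eq_integral do rewrite !big_ord_recl big_ord0 /a/=.
rewrite !big_ord_recl big_ord0 /a/= => h.
transitivity (\int[G]_z (a0 * z ^+ 0 + (a1 * z ^+ 1 + (a2 * z ^+ 2 +
  (a3 * z ^+ 3 + (a4 * z ^+ 4 + (a5 * z ^+ 5 + (a6 * z ^+ 6 + 0)))))))%:E)%E.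
  by apply: eq_integral => z _; congr EFin; ring.
rewrite [LHS]h; congr EFin.
rewrite -[bump 0 0]/1%N -[bump 0 1]/2%N -[bump 0 2]/3%N -[bump 0 3]/4%N.
rewrite -[bump 0 4]/5%N -[bump 0 5]/6%N.
rewrite normal_moment0 normal_moment2 (@normal_moment_odd 1)//.
by rewrite (@normal_moment_odd 3)// (@normal_moment_odd 5)//; ring.
Qed.

Let inv_sqrt2 : {r : R | r ^+ 2 = 2^-1 & 0 < r}.
Proof.
exists (Num.sqrt 2)^-1; first by rewrite exprVn sqr_sqrtr.
by rewrite invr_gt0 sqrtr_gt0.
Qed.

Let normal_average (g : R -> \bar R) r : r ^+ 2 = 2^-1 -> 0 < r ->
  measurable_fun setT g -> (forall z, 0 <= g z)%E ->
  (\int[G]_x \int[G]_y g (r * x + r * y)%R = \int[G]_x g x)%E.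
Proof.
move=> r2 r0 mg g0; apply: normal_rotation1 => //; first by rewrite r2; field.
by apply/eqP => r1; lra.
Qed.

(** Because (x + y) / sqrt 2 is again standard normal, m = (2 m + 6) / 4. *)
Lemma normal_moment4 : normal_moment 4 = 3.
Proof.
have [r r2 r0] := inv_sqrt2.
have r4 : r ^+ 4 = 4^-1 by rewrite (_ : 4 = 2 * 2)%N// exprM r2; field.
have mg : measurable_fun setT (fun z : R => (z ^+ 4)%:E) by measurability.
have := normal_average r2 r0 mg => /(_ _); rewrite normal_momentE => h.
have /h : forall z : R, (0 <= (z ^+ 4)%:E)%E.
  by move=> z; rewrite lee_fin (_ : 4 = 2 * 2)%N// exprM sqr_ge0.
set m := normal_moment 4.
have inner (x : R) : (\int[G]_y ((r * x + r * y) ^+ 4)%:E =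
    (4^-1 * m + 0 * x + (6 / 4) * x ^+ 2 + 0 * x ^+ 3 + 4^-1 * x ^+ 4
    + 0 * x ^+ 5 + 0 * x ^+ 6)%:E)%E.
  have := normal_poly6 (x ^+ 4 / 4) (x ^+ 3) (6 / 4 * x ^+ 2) x 4^-1 0 0.
  rewrite -/m => h'; transitivity (x ^+ 4 / 4 + 6 / 4 * x ^+ 2 + m / 4 + normal_moment 6 * 0)%:E.
    rewrite -h'; apply: eq_integral => y _; congr EFin.
    by transitivity (r ^+ 4 * (x + y) ^+ 4); [ring|rewrite r4; field].
  by congr EFin; field.
under eq_integral do rewrite inner.
rewrite normal_poly6 -/m => -[]; lra.
Qed.

(** The same averaging gives m = (2 m + 30 * 3) / 8. *)
Lemma normal_moment6 : normal_moment 6 = 15.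
Proof.
have [r r2 r0] := inv_sqrt2.
have r6 : r ^+ 6 = 8^-1 by rewrite (_ : 6 = 2 * 3)%N// exprM r2; field.
have mg : measurable_fun setT (fun z : R => (z ^+ 6)%:E) by measurability.
have := normal_average r2 r0 mg => /(_ _); rewrite normal_momentE => h.
have /h : forall z : R, (0 <= (z ^+ 6)%:E)%E.
  by move=> z; rewrite lee_fin (_ : 6 = 3 * 2)%N// exprM sqr_ge0.
set m := normal_moment 6.
have inner (x : R) : (\int[G]_y ((r * x + r * y) ^+ 6)%:E =
    (m / 8 + 0 * x + (45 / 8) * x ^+ 2 + 0 * x ^+ 3 + 15 / 8 * x ^+ 4
    + 0 * x ^+ 5 + 8^-1 * x ^+ 6)%:E)%E.
  have := normal_poly6 (x ^+ 6 / 8) (6 / 8 * x ^+ 5) (15 / 8 * x ^+ 4) (20 / 8 * x ^+ 3)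
    (15 / 8 * x ^+ 2) (6 / 8 * x) 8^-1.
  rewrite -/m normal_moment4 => h'.
  transitivity (x ^+ 6 / 8 + 15 / 8 * x ^+ 4 + 3 * (15 / 8 * x ^+ 2) + m * 8^-1)%:E.
    rewrite -h'; apply: eq_integral => y _; congr EFin.
    by transitivity (r ^+ 6 * (x + y) ^+ 6); [ring|rewrite r6; field].
  by congr EFin; field.
under eq_integral do rewrite inner.
rewrite normal_poly6 normal_moment4 -/m => -[]; lra.
Qed.

(** Degree six is what E (D S)^2 requires: after one step D S is a cubic in the innovation. *)
Lemma integral_normal_poly6 (a0 a1 a2 a3 a4 a5 a6 : R) :
  (\int[G]_z (a0 + a1 * z + a2 * z ^+ 2 + a3 * z ^+ 3 + a4 * z ^+ 4
              + a5 * z ^+ 5 + a6 * z ^+ 6)%:E =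
   (a0 + a2 + 3 * a4 + 15 * a6)%:E)%E.
Proof. by rewrite normal_poly6 normal_moment4 normal_moment6. Qed.

End normal_moments.

(** * The law of a centered Gaussian pair *)

Section cos_bounds.
Context {R : realType}.

Lemma le0_derive_ge0 (f df : R -> R) :
  (forall x : R, is_derive x (1 : R) f (df x)) -> (forall x, 0 <= x -> 0 <= df x) ->
  forall x, 0 <= x -> f 0 <= f x.
Proof.
move=> fd df0 x; rewrite le_eqVlt => /predU1P[<-//|x0].
have [|z zI] := @MVT _ f df 0 x x0 (fun z _ => fd z).
  apply: continuous_subspaceT => z.
  by apply: differentiable_continuous; apply/derivable1_diffP; case: (fd z).
move=> E; rewrite -subr_ge0 E mulr_ge0 ?subr_ge0 ?(ltW x0)//.
by apply: df0; move: zI; rewrite in_itv/= => /andP[/ltW].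
Qed.

(** Four successive integrations from 0, starting with cos <= 1, bound sin and cos alternately;
    evenness covers negative arguments. *)
Lemma cos_taylor (v : R) : 1 - v ^+ 2 / 2 <= cos v <= 1 - v ^+ 2 / 2 + v ^+ 4 / 24.
Proof.
wlog v0 : v / 0 <= v => [h|].
  have [v0|v0] := leP 0 v; first exact: h.
  have := h (- v); rewrite cosN sqrrN (_ : 4 = 2 * 2)%N// !exprM sqrrN.
  by apply; rewrite oppr_ge0 ltW.
have sin_le (x : R) : 0 <= x -> 0 <= x - sin x.
  have := @le0_derive_ge0 (fun x => x - sin x) (fun x => 1 - cos x).
  rewrite sin0 subrr; apply => y.
  by rewrite subr_ge0 cos_le1.
have cos_ge (x : R) : 0 <= x -> 0 <= cos x + x ^+ 2 / 2 - 1.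
  have := @le0_derive_ge0 (fun x => cos x + x ^+ 2 / 2 - 1) (fun x => x - sin x).
  rewrite cos0 expr0n mul0r addr0 subrr; apply => // y.
  by apply: is_derive_eq; rewrite /GRing.scale/=; field.
have sin_ge (x : R) : 0 <= x -> 0 <= sin x - x + x ^+ 3 / 6.
  have := @le0_derive_ge0 (fun x => sin x - x + x ^+ 3 / 6) (fun x => cos x + x ^+ 2 / 2 - 1).
  rewrite sin0 expr0n mul0r subrr addr0; apply => // y.
  by apply: is_derive_eq; rewrite /GRing.scale/=; field.
have cos_le (x : R) : 0 <= x -> 0 <= 1 - x ^+ 2 / 2 + x ^+ 4 / 24 - cos x.
  have := @le0_derive_ge0 (fun x => 1 - x ^+ 2 / 2 + x ^+ 4 / 24 - cos x)
    (fun x => sin x - x + x ^+ 3 / 6).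
  rewrite cos0 !expr0n !mul0r subr0 addr0 subrr; apply => // y.
  by apply: is_derive_eq; rewrite /GRing.scale/=; field.
by have := cos_ge v v0; have := cos_le v v0; lra.
Qed.

End cos_bounds.

(** * The characteristic function of the standard normal law *)

Section normal_cos.
Context {R : realType}.
Local Notation G := (std_normal R).

Lemma integrable_bounded_prob d (T : measurableType d) (P : probability T R)
    (f : T -> R) (M : R) : measurable_fun setT f -> (forall x, `|f x| <= M) ->
  P.-integrable setT (EFin \o f).
Proof.
move=> mf fM; apply: measurable_bounded_integrable => //.
- by apply: le_lt_trans (probability_le1 P measurableT) _; rewrite ltry.
- exists M; split; first exact: num_real.
  by move=> y My x _; apply: le_trans (fM x) (ltW My).
Qed.

Lemma norm_cos_le1 (x : R) : `|cos x| <= 1.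
Proof. by rewrite ler_norml cos_geN1 cos_le1. Qed.

Lemma norm_sin_le1 (x : R) : `|sin x| <= 1.
Proof. by rewrite ler_norml sin_geN1 sin_le1. Qed.

(** The characteristic function, kept real: by [normal_sin] its imaginary part vanishes. *)
Definition normal_cf (u : R) : R := (\int[G]_z cos (u * z))%R.

Lemma integrable_normal_cos u k : G.-integrable setT (EFin \o (fun z => cos (u * z + k))).
Proof.
by apply: (@integrable_bounded_prob _ _ _ _ 1) => [|x]; [measurability|exact: norm_cos_le1].
Qed.

Lemma integrable_normal_sin u k : G.-integrable setT (EFin \o (fun z => sin (u * z + k))).
Proof.
by apply: (@integrable_bounded_prob _ _ _ _ 1) => [|x]; [measurability|exact: norm_sin_le1].
Qed.

Lemma normal_cos u : (\int[G]_z (cos (u * z))%:E = (normal_cf u)%:E)%E.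
Proof.
rewrite /normal_cf /Rintegral fineK//; apply: integrable_fin_num => //.
by have := integrable_normal_cos u 0; under eq_fun do rewrite addr0.
Qed.

Lemma normal_sin u : (\int[G]_z (sin (u * z))%:E = 0)%E.
Proof.
have iS : G.-integrable setT (EFin \o (fun z => sin (u * z))).
  by have := integrable_normal_sin u 0; under eq_fun do rewrite addr0.
have I1 := finite_measure_integrable_cst G (1 : R) measurableT.
have m1 : measurable_fun setT (fun z : R => (1 + sin (u * z))%:E) by measurability.
have p1 (z : R) : (0 <= (1 + sin (u * z))%:E)%E.
  by rewrite lee_fin; have := sin_geN1 (u * z); lra.
have := normal_sym m1 p1.
under eq_integral do rewrite mulrN sinN EFinD EFinN.
under [RHS]eq_integral do rewrite EFinD.
rewrite integralD//; last exact: integrableN.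
rewrite [RHS]integralD// integral_std_normal_cst integralN; last first.
  exact: integrable_add_def iS.
have /fineK <- := integrable_fin_num measurableT iS.
rewrite -EFinN -!EFinD => -[] h; congr EFin; set s := fine _ in h *; lra.
Qed.

Lemma normal_cosD u k : (\int[G]_z (cos (u * z + k))%:E = (normal_cf u * cos k)%:E)%E.
Proof.
have iC : G.-integrable setT (EFin \o (fun z => cos (u * z))).
  by have := integrable_normal_cos u 0; under eq_fun do rewrite addr0.
have iS : G.-integrable setT (EFin \o (fun z => sin (u * z))).
  by have := integrable_normal_sin u 0; under eq_fun do rewrite addr0.
under eq_integral do rewrite cosD mulrC [X in _ - X]mulrC EFinB !EFinM.
have iC' := integrableZl measurableT (cos k) iC.
have iS' := integrableZl measurableT (sin k) iS.
rewrite integralB// !integralZl// normal_sin mule0 sube0.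
by rewrite normal_cos -EFinM mulrC.
Qed.

Lemma normal_cf_average u r : r ^+ 2 = 2^-1 -> 0 < r ->
  normal_cf u = normal_cf (u * r) ^+ 2.
Proof.
move=> r2 r0.
have I1 := finite_measure_integrable_cst G (1 : R) measurableT.
have m1 : measurable_fun setT (fun z : R => (1 + cos (u * z))%:E) by measurability.
have p1 (z : R) : (0 <= (1 + cos (u * z))%:E)%E.
  by rewrite lee_fin; have := cos_geN1 (u * z); lra.
have c1 : r != -1 by apply/eqP => ?; lra.
have rr : r ^+ 2 + r ^+ 2 = 1 by rewrite r2; field.
have := @normal_rotation1 _ _ r r rr c1 m1 p1.
have inner (x : R) : (\int[G]_y (1 + cos (u * (r * x + r * y)))%:E =
    (1 + normal_cf (u * r) * cos (u * r * x))%:E)%E.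
  under eq_integral => y _.
    rewrite (_ : u * (r * x + r * y) = u * r * y + u * r * x); last by ring.
    rewrite EFinD; over.
  rewrite integralD//; last exact: integrable_normal_cos.
  by rewrite integral_std_normal_cst normal_cosD.
under eq_integral do rewrite inner EFinD EFinM.
under [RHS]eq_integral do rewrite EFinD.
have iC v : G.-integrable setT (EFin \o (fun z => cos (v * z))).
  by have := integrable_normal_cos v 0; under eq_fun do rewrite addr0.
rewrite integralD//; last by apply: integrableZl => //; exact: iC.
rewrite integralZl//; last exact: iC.
rewrite [RHS]integralD//; last exact: iC.
rewrite integral_std_normal_cst !normal_cos -!EFinM -!EFinD => -[] h.
by rewrite expr2; lra.
Qed.

(** Fourth order is what the limit in [normal_cfE] needs: 2^n errors of size (u / sqrt 2^n)^4 add up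
    to u^4 / 2^n. *)
Lemma normal_cf_taylor v : `|normal_cf v - expR (- (v ^+ 2 / 2))| <= v ^+ 4.
Proof.
have E4 (z : R) : (v * z) ^+ 4 = v ^+ 4 * z ^+ 4 by rewrite exprMn.
have lo : 1 - v ^+ 2 / 2 <= normal_cf v.
  rewrite -lee_fin -normal_cos.
  have := @integral_normal_poly6 R 1 0 (- (v ^+ 2 / 2)) 0 0 0 0.
  rewrite !mulr0 !addr0 => <-.
  apply: le_integral => //.
  - have := (integral_normal_poly 3 (fun i => nth 0 [:: 1; 0; - (v ^+ 2 / 2)] i)).1.
    by apply: eq_integrable => // z _; rewrite !big_ord_recl big_ord0/=; congr EFin; ring.
  - by have := integrable_normal_cos v 0; under eq_fun do rewrite addr0.
  - move=> z _; rewrite lee_fin; have /andP[+ _] := cos_taylor (v * z).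
    by apply: le_trans; rewrite le_eqVlt; apply/orP; left; apply/eqP; field.
have hi : normal_cf v <= 1 - v ^+ 2 / 2 + v ^+ 4 / 8.
  rewrite -lee_fin -normal_cos.
  have := @integral_normal_poly6 R 1 0 (- (v ^+ 2 / 2)) 0 (v ^+ 4 / 24) 0 0.
  rewrite !mulr0 !addr0 (_ : 3 * (v ^+ 4 / 24) = v ^+ 4 / 8); last by field.
  move=> <-.
  apply: le_integral => //.
  - by have := integrable_normal_cos v 0; under eq_fun do rewrite addr0.
  - have := (integral_normal_poly 5 (fun i => nth 0 [:: 1; 0; - (v ^+ 2 / 2); 0; v ^+ 4 / 24] i)).1.
    by apply: eq_integrable => // z _; rewrite !big_ord_recl big_ord0/=; congr EFin; ring.
  - move=> z _; rewrite lee_fin; have /andP[_ +] := cos_taylor (v * z).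
    move=> /le_trans; apply.
    by rewrite le_eqVlt; apply/orP; left; apply/eqP; field.
set w := v ^+ 2 / 2 in lo hi *.
have w0 : 0 <= w by rewrite divr_ge0 ?sqr_ge0.
have vw : v ^+ 4 = 4 * w ^+ 2 by rewrite /w; field.
have elo : 1 - w <= expR (- w) by have := expR_ge1Dx (- w); lra.
(* From (1 - w + w^2) (1 + w) = 1 + w^3 >= 1 and 1 + w <= exp w. *)
have ehi : expR (- w) <= 1 - w + w ^+ 2.
  rewrite expRN -div1r ler_pdivrMr ?expR_gt0//.
  have h : 0 <= 1 - w + w ^+ 2 by nra.
  apply: le_trans (ler_wpM2l h (expR_ge1Dx w)); nra.
rewrite vw in hi *; rewrite ler_norml; apply/andP; split; nra.
Qed.

Lemma dist_expr (a b : R) n : `|a| <= 1 -> `|b| <= 1 -> `|a ^+ n - b ^+ n| <= n%:R * `|a - b|.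
Proof.
move=> a1 b1; elim: n => [|n IH]; first by rewrite !expr0 subrr normr0 mul0r.
rewrite !exprS (_ : a * a ^+ n - b * b ^+ n = a * (a ^+ n - b ^+ n) + (a - b) * b ^+ n); last by ring.
rewrite -[n.+1%:R]natr1 [leRHS]mulrDl mul1r (le_trans (ler_normD _ _))// lerD//.
  by rewrite normrM (le_trans _ IH)// ler_piMl.
by rewrite normrM ler_piMr// normrX exprn_ile1.
Qed.

(* The rotation invariance gives cf(u) = cf(u / sqrt 2^n)^(2^n), and cf agrees
   with the Gaussian up to order 4 at the origin. *)
Lemma normal_cfE u : normal_cf u = expR (- (u ^+ 2 / 2)).
Proof.
pose r : R := (Num.sqrt 2)^-1.
have r2 : r ^+ 2 = 2^-1 by rewrite exprVn sqr_sqrtr.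
have r0 : 0 < r by rewrite invr_gt0 sqrtr_gt0.
have cfn n : normal_cf u = normal_cf (u * r ^+ n) ^+ (2 ^ n).
  elim: n => [|n IH]; first by rewrite expr0 mulr1 expn0 expr1.
  rewrite IH (normal_cf_average (u * r ^+ n) r2 r0) -exprM -expnS.
  by rewrite -mulrA -exprSr.
have en n : expR (- (u ^+ 2 / 2)) = expR (- ((u * r ^+ n) ^+ 2 / 2)) ^+ (2 ^ n).
  rewrite -expRM_natl; congr expR.
  rewrite exprMn -exprM mulnC exprM r2 natrX exprVn.
  by field; rewrite expf_neq0.
have cf1 v : `|normal_cf v| <= 1.
  rewrite -lee_fin /normal_cf EFin_normr_Rintegral//; last first.
    by have := integrable_normal_cos v 0; under eq_fun do rewrite addr0.
  apply: le_trans (le_abse_integral _ _ _) _ => //; first by measurability.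
  rewrite -(@integral_std_normal_cst R 1); apply: ge0_le_integral => //.
  - apply: measurableT_comp => //; by measurability.
  - by move=> z _; rewrite lee_fin norm_cos_le1.
have e1 v : `|expR (- (v ^+ 2 / 2))| <= 1 :> R.
  by rewrite ger0_norm ?expR_ge0// -expR0 ler_expR oppr_le0 divr_ge0 ?sqr_ge0.
have bound n : `|normal_cf u - expR (- (u ^+ 2 / 2))| <= u ^+ 4 / 2 ^+ n.
  rewrite (cfn n) (en n); apply: le_trans (dist_expr _ (cf1 _) (e1 _)) _.
  apply: le_trans (ler_wpM2l (ler0n _ _) (normal_cf_taylor _)) _.
  rewrite natrX exprMn -exprM (_ : n * 4 = 2 * (n * 2))%N; last by rewrite mulnCA.
  rewrite exprM r2 exprM exprVn le_eqVlt; apply/orP; left; apply/eqP.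
  by field; rewrite expf_neq0.
apply/eqP; rewrite -subr_eq0 -normr_le0; apply/ler_addgt0Pr => e e0; rewrite add0r.
have [n hn] : exists n, u ^+ 4 / e < 2 ^+ n.
  exists (Num.truncn (u ^+ 4 / e)).+1.
  apply: lt_le_trans (truncnS_gt _) _.
  by rewrite -natrX ler_nat ltnW// ltn_expl.
apply: le_trans (bound n) _.
rewrite ler_pdivrMr ?exprn_gt0// mulrC -ler_pdivrMr//.
exact: ltW.
Qed.

End normal_cos.

Lemma integral_prob_cst d (T : measurableType d) (R : realType) (P : probability T R)
  (k : R) : (\int[P]_x k%:E = k%:E)%E.
Proof.
by rewrite integral_cst// -[RHS]mule1; congr (_ * _)%E; exact: probability_setT.
Qed.

(** * Measures determined by rays, rectangles and quadrants *)

Section uniqueness_of_measures.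
Context {R : realType}.

Lemma measure_unique_rays (m1 m2 : {measure set (measurableTypeR R) -> \bar R}) :
  (forall c, m1 `]-oo, c[%classic < +oo)%E ->
  (forall c, m1 `]-oo, c[%classic = m2 `]-oo, c[%classic) ->
  forall A, measurable A -> m1 A = m2 A.
Proof.
move=> moo mE A mA.
pose g (n : nat) : set R := `]-oo, n%:R[%classic.
have gen : (@measurable _ (measurableTypeR R)) = <<s @RGenInftyO.G R >>.
  exact: RGenInftyO.measurableE.
have GI : setI_closed (@RGenInftyO.G R).
  move=> _ _ [x ->] [y ->]; exists (Num.min x y).
  by apply/seteqP; split => z /=; rewrite !in_itv/= lt_min => /andP.
have Gg n : @RGenInftyO.G R (g n) by exists n%:R.
have gT : \bigcup_n g n = setT.
  apply/seteqP; split=> // x _; exists (Num.truncn x).+1 => //=.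
  by rewrite /g/= in_itv/= truncnS_gt.
apply: (@measure_unique _ R (measurableTypeR R) _ g gen GI Gg gT m1 m2 _ _ A mA).
- by move=> _ [x ->].
- by move=> n; exact: moo.
Qed.

Lemma measure_unique_rectangles d1 d2 (T1 : measurableType d1) (T2 : measurableType d2)
    (P Q : {measure set (T1 * T2)%type -> \bar R}) : (P setT < +oo)%E ->
  (forall A B, measurable A -> measurable B -> P (A `*` B) = Q (A `*` B)) ->
  forall X, measurable X -> P X = Q X.
Proof.
move=> Poo PQ X mX.
pose C : set (set (T1 * T2)) :=
  [set C | exists A, measurable A /\ exists B, measurable B /\ C = A `*` B].
apply: (measure_unique C (fun n => setT)) => //.
- rewrite measurable_prod_measurableType //; congr (<<s _ >>).
  rewrite predeqE; split => [[A mA [B mB <-]]|[A [mA [B [mB ->]]]]].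
    by exists A; split => //; exists B.
  by exists A => //; exists B.
- move=> /= _ _ [X1 [mX1 [X2 [mX2 ->]]]] [Y1 [mY1 [Y2 [mY2 ->]]]].
  rewrite -setXI; exists (X1 `&` Y1); split; first exact: measurableI.
  by exists (X2 `&` Y2); split => //; exact: measurableI.
- by move=> _; exists setT; split => //; exists setT; rewrite setXTT.
- by apply/seteqP; split=> // x _; exists 0%N.
- by move=> _ [A [mA [B [mB ->]]]]; exact: PQ.
Qed.

Let quadrant (c e : R) : set (R * R) := `]-oo, c[%classic `*` `]-oo, e[%classic.

(** One factor is extended at a time: with the other factor frozen, each side is a finite measure on
    the line, determined by its values on rays. *)
Lemma measure_unique_quadrants (P Q : {measure set (R * R)%type -> \bar R}) : (P setT < +oo)%E ->
  (forall c e, P (quadrant c e) = Q (quadrant c e)) ->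
  forall X, measurable X -> P X = Q X.
Proof.
move=> Poo PQ.
have mfst : measurable_fun setT (fst : R * R -> measurableTypeR R) by exact: measurable_fst.
have msnd : measurable_fun setT (snd : R * R -> measurableTypeR R) by exact: measurable_snd.
have fin X : measurable X -> (P X < +oo)%E.
  by move=> mX; apply: le_lt_trans Poo; rewrite le_measure// inE.
have step1 A e : measurable A -> P (A `*` `]-oo, e[%classic) = Q (A `*` `]-oo, e[%classic).
  move=> mA.
  have mD : measurable ([set: R] `*` `]-oo, e[%classic : set (R * R)) by exact: measurableX.
  pose m (M : {measure set (R * R)%type -> \bar R}) := image_measure (mrestr M mD) mfst.
  have mE (M : {measure set (R * R)%type -> \bar R}) B : m M B = M (B `*` `]-oo, e[%classic).
    rewrite /m /image_measure /pushforward /mrestr; congr (M _).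
    by apply/seteqP; split => -[x y] /=; tauto.
  rewrite -!mE; apply: measure_unique_rays => // c.
    by suff: (m P `]-oo, c[%classic < +oo)%E by []; rewrite mE fin//; exact: measurableX.
  by suff: m P `]-oo, c[%classic = m Q `]-oo, c[%classic by []; rewrite !mE; exact: PQ.
apply: measure_unique_rectangles => // A B mA mB.
have mD : measurable (A `*` [set: R] : set (R * R)) by exact: measurableX.
pose m (M : {measure set (R * R)%type -> \bar R}) := image_measure (mrestr M mD) msnd.
have mE (M : {measure set (R * R)%type -> \bar R}) B' : m M B' = M (A `*` B').
  rewrite /m /image_measure /pushforward /mrestr; congr (M _).
  by apply/seteqP; split => -[x y] /=; tauto.
rewrite -!mE; apply: measure_unique_rays => // c.
  by suff: (m P `]-oo, c[%classic < +oo)%E by []; rewrite mE fin//; exact: measurableX.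
by suff: m P `]-oo, c[%classic = m Q `]-oo, c[%classic by []; rewrite !mE; exact: step1.
Qed.

End uniqueness_of_measures.

Definition std_normal2 (R : realType) :
    probability (measurableTypeR R * measurableTypeR R)%type R :=
  (std_normal R \x std_normal R)%E.

Lemma tonelli3 d d1 d2 (T : measurableType d) (T1 : measurableType d1)
    (T2 : measurableType d2) (R : realType)
    (m : {sigma_finite_measure set T -> \bar R})
    (m1 : {sigma_finite_measure set T1 -> \bar R})
    (m2 : {sigma_finite_measure set T2 -> \bar R}) (F : T * T1 * T2 -> \bar R) :
  measurable_fun setT F -> (forall z, 0 <= F z)%E ->
  (\int[m]_z \int[m1]_x \int[m2]_y F (z, x, y) =
   \int[m1]_x \int[m2]_y \int[m]_z F (z, x, y))%E.
Proof.
move=> mF F0.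
pose H zx := (\int[m2]_y F (zx, y))%E.
have mH : measurable_fun setT H.
  exact: (@measurable_fun_fubini_tonelli_F _ _ _ _ _ m2 F mF F0).
have H0 zx : (0 <= H zx)%E by exact: integral_ge0.
rewrite (@fubini_tonelli _ _ _ _ _ m m1 H mH H0); apply: eq_integral => x _.
rewrite (@fubini_tonelli _ _ _ _ _ m m2 (fun zy => F (zy.1, x, zy.2)))//.
by apply: measurableT_comp => //; apply: measurable_fun_pair => //; apply: measurable_fun_pair.
Qed.

(** * The Cramer-Wold argument by Gaussian smoothing *)

Section normal_mixtures.
Context {R : realType}.
Local Notation leb := (@lebesgue_measure R).
Local Notation G := (std_normal R).

(* Every Gaussian kernel is a mixture of ridge functions. *)
Lemma normal_cos_mixture (x y : R) :
  (\int[G]_g \int[G]_h (1 + cos (x * g + y * h))%:E =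
   (1 + expR (- ((x ^+ 2 + y ^+ 2) / 2)))%:E)%E.
Proof.
have I1 := finite_measure_integrable_cst G (1 : R) measurableT.
have inner (g : R) : (\int[G]_h (1 + cos (x * g + y * h))%:E =
    (1 + normal_cf y * cos (x * g))%:E)%E.
  under eq_integral => h _ do rewrite [x * g + _]addrC EFinD.
  rewrite integralD//; last exact: integrable_normal_cos.
  by rewrite integral_std_normal_cst normal_cosD.
under eq_integral do rewrite inner EFinD EFinM.
have iC : G.-integrable setT (EFin \o (fun z => cos (x * z))).
  by have := integrable_normal_cos x 0; under eq_fun do rewrite addr0.
rewrite integralD//; last exact: integrableZl.
rewrite integralZl//.
rewrite integral_std_normal_cst normal_cos -EFinM -EFinD; congr (1 + _)%:E.
by rewrite !normal_cfE -expRD; congr expR; field.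
Qed.

Lemma normal_pdf2E (x y s p q : R) : 0 < s ->
  normal_pdf x s p * normal_pdf y s q =
  normal_peak s ^+ 2 * expR (- (((s^-1 * (x - p)) ^+ 2 + (s^-1 * (y - q)) ^+ 2) / 2)).
Proof.
move=> s0; rewrite !normal_pdfE ?gt_eqF// mulrACA -expr2; congr (_ * _).
rewrite /normal_fun -expRD; congr expR.
by field; rewrite gt_eqF.
Qed.

(** The substitution p = x + s u, q = y + s v exhibits the smoothing as an integral against a
    Gaussian kernel, the object that sine and cosine integrals determine. *)
Lemma integral_smoothing (f g : R -> R) (x y s : R) : 0 < s ->
  measurable_fun setT f -> measurable_fun setT g ->
  (forall p, 0 <= f p) -> (forall p, 0 <= g p) ->
  (\int[G]_u \int[G]_v (f (x + s * u) * g (y + s * v))%:E =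
   \int[leb]_p \int[leb]_q ((f p * g q) * (normal_pdf x s p * normal_pdf y s q))%:E)%E.
Proof.
move=> s0 mf mg f0 g0.
have inner (p : R) : (\int[G]_v (f p * g (y + s * v))%:E =
    \int[leb]_q ((f p * g q)%:E * (normal_pdf y s q)%:E))%E.
  rewrite (@ge0_integral_normal_pdf _ y s (fun q => (f p * g q)%:E) s0)//.
    by measurability.
  by move=> q; rewrite lee_fin mulr_ge0.
under eq_integral do rewrite inner.
pose h p := (\int[leb]_q ((f p * g q)%:E * (normal_pdf y s q)%:E))%E.
have mpdf a : measurable_fun setT (normal_pdf a s : R -> R) by exact: measurable_normal_pdf.
pose H (w : R * R) := ((f w.1 * g w.2)%:E * (normal_pdf y s w.2)%:E)%E.
have mH : measurable_fun setT H.
  apply: emeasurable_funM; apply/measurable_EFinP.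
    by apply: measurable_funM; exact: measurableT_comp.
  exact: measurableT_comp.
have H0 w : (0 <= H w)%E by rewrite mule_ge0 ?lee_fin ?mulr_ge0 ?normal_pdf_ge0.
have mh : measurable_fun setT h.
  exact: (@measurable_fun_fubini_tonelli_F _ _ _ _ _ leb H mH H0).
have h0 p : (0 <= h p)%E by apply: integral_ge0 => q _; exact: (H0 (p, q)).
transitivity (\int[G]_u h (x + s * u)%R)%E; first by [].
rewrite -(@ge0_integral_normal_pdf _ x s h s0 mh h0).
apply: eq_integral => p _.
rewrite muleC -ge0_integralZl//.
- by apply: eq_integral => q _; rewrite -!EFinM; congr EFin; ring.
- by have my := mpdf y; measurability.
- by move=> q _; exact: (H0 (p, q)).
- by rewrite lee_fin normal_pdf_ge0.
Qed.

End normal_mixtures.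

Section cramer_wold.
Context {R : realType}.
Local Notation leb := (@lebesgue_measure R).
Local Notation G := (std_normal R).
Local Notation GG := (std_normal2 R).
Local Notation plane := (measurableTypeR R * measurableTypeR R)%type.

Section smoothing.
Variable P : probability (R * R)%type R.

Lemma integrable_plane_cos u v : P.-integrable setT (EFin \o (fun z => cos (u * z.1 + v * z.2))).
Proof.
by apply: (@integrable_bounded_prob _ _ _ _ _ 1) => [|x]; [measurability|exact: norm_cos_le1].
Qed.

Lemma integrable_plane_sin u v : P.-integrable setT (EFin \o (fun z => sin (u * z.1 + v * z.2))).
Proof.
by apply: (@integrable_bounded_prob _ _ _ _ _ 1) => [|x]; [measurability|exact: norm_sin_le1].
Qed.

Lemma integral_plane_cosB u v k :
  (\int[P]_z (1 + cos (u * z.1 + v * z.2 - k))%:E =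
   1 + ((cos k)%:E * \int[P]_z (cos (u * z.1 + v * z.2))%:E
        + (sin k)%:E * \int[P]_z (sin (u * z.1 + v * z.2))%:E))%E.
Proof.
have iC := integrable_plane_cos u v; have iS := integrable_plane_sin u v.
have I1 := finite_measure_integrable_cst P (1 : R) measurableT.
have iC' := integrableZl measurableT (cos k) iC.
have iS' := integrableZl measurableT (sin k) iS.
under eq_integral do rewrite cosB mulrC [X in (_ + (_ + X))%R]mulrC !EFinD !EFinM.
rewrite integralD//; last exact: integrableD.
by rewrite integralD// !integralZl// integral_prob_cst.
Qed.

(** The added 1 keeps 1 + cos nonnegative, so Tonelli applies; the inner integral over z then
    involves only the sine and cosine transforms of [P]. *)
Lemma integral_kernel_mixture (a p q : R) :
  (\int[P]_z (1 + expR (- (((a * (z.1 - p)) ^+ 2 + (a * (z.2 - q)) ^+ 2) / 2)))%:E =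
   \int[GG]_w \int[P]_z (1 + cos (a * w.1 * z.1 + a * w.2 * z.2
                                      - (a * w.1 * p + a * w.2 * q)))%:E)%E.
Proof.
pose F (y : (R * R) * plane) := (1 + cos (a * (y.1.1 - p) * y.2.1 + a * (y.1.2 - q) * y.2.2))%:E.
have mF : measurable_fun setT F.
  by rewrite /F; measurability.
have F0 y : (0 <= F y)%E by rewrite lee_fin -lerBlDl sub0r cos_geN1.
transitivity (\int[P]_z \int[GG]_w F (z, w))%E.
  apply: eq_integral => z _.
  rewrite -normal_cos_mixture.
  rewrite (@fubini_tonelli1 _ _ _ _ _ G G (fun w => F (z, w)))//.
  exact: measurableT_comp.
rewrite (@fubini_tonelli _ _ _ _ _ P GG F mF F0).
apply: eq_integral => w _; apply: eq_integral => z _; congr (1 + cos _)%:E.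
by rewrite /=; ring.
Qed.

End smoothing.

Variables P Q : probability (R * R)%type R.
Hypothesis PQcos : forall u v,
  (\int[P]_z (cos (u * z.1 + v * z.2))%:E = \int[Q]_z (cos (u * z.1 + v * z.2))%:E)%E.
Hypothesis PQsin : forall u v,
  (\int[P]_z (sin (u * z.1 + v * z.2))%:E = \int[Q]_z (sin (u * z.1 + v * z.2))%:E)%E.

Lemma eq_kernel (s p q : R) : 0 < s ->
  (\int[P]_z (normal_pdf z.1 s p * normal_pdf z.2 s q)%:E =
   \int[Q]_z (normal_pdf z.1 s p * normal_pdf z.2 s q)%:E)%E.
Proof.
move=> s0.
pose K (z : R * R) := expR (- (((s^-1 * (z.1 - p)) ^+ 2 + (s^-1 * (z.2 - q)) ^+ 2) / 2)).
have mK : measurable_fun setT K by rewrite /K; measurability.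
have K1 z : `|K z| <= 1.
  by rewrite ger0_norm ?expR_ge0// -expR0 ler_expR oppr_le0 divr_ge0// addr_ge0 ?sqr_ge0.
have iK (M : probability (R * R)%type R) : M.-integrable setT (EFin \o K).
  exact: (integrable_bounded_prob _ mK K1).
have I1 (M : probability (R * R)%type R) := finite_measure_integrable_cst M (1 : R) measurableT.
have E1 : (\int[P]_z (1 + K z)%:E = \int[Q]_z (1 + K z)%:E)%E.
  rewrite /K !integral_kernel_mixture; apply: eq_integral => w _.
  by rewrite !integral_plane_cosB PQcos PQsin.
have EK : (\int[P]_z (K z)%:E = \int[Q]_z (K z)%:E)%E.
  move: E1; under eq_integral do rewrite EFinD.
  under [RHS]eq_integral do rewrite EFinD.
  rewrite integralD//; [|exact: I1|exact: iK].
  rewrite [RHS]integralD//; [|exact: I1|exact: iK].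
  rewrite !integral_prob_cst.
  have /fineK <- := integrable_fin_num measurableT (iK P).
  have /fineK <- := integrable_fin_num measurableT (iK Q).
  by rewrite -!EFinD => -[] /addrI ->.
under eq_integral do rewrite normal_pdf2E// EFinM.
under [RHS]eq_integral do rewrite normal_pdf2E// EFinM.
by rewrite !integralZl ?EK//; exact: iK.
Qed.

Lemma eq_smoothing (f g : R -> R) (s : R) : 0 < s ->
  measurable_fun setT f -> measurable_fun setT g ->
  (forall p, 0 <= f p) -> (forall p, 0 <= g p) ->
  (\int[P]_z \int[GG]_w (f (z.1 + s * w.1) * g (z.2 + s * w.2))%:E =
   \int[Q]_z \int[GG]_w (f (z.1 + s * w.1) * g (z.2 + s * w.2))%:E)%E.
Proof.
move=> s0 mf mg f0 g0.
pose F (y : R * R * measurableTypeR R * measurableTypeR R) :=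
  ((f y.1.2 * g y.2) * (normal_pdf y.1.1.1 s y.1.2 * normal_pdf y.1.1.2 s y.2))%:E.
pose K (p q : R) (z : R * R) := normal_pdf z.1 s p * normal_pdf z.2 s q.
have K0 p q z : 0 <= K p q z by rewrite mulr_ge0// normal_pdf_ge0.
have mK p q : measurable_fun setT (K p q).
  have -> : K p q = fun z => normal_peak s ^+ 2 *
    expR (- (((s^-1 * (z.1 - p)) ^+ 2 + (s^-1 * (z.2 - q)) ^+ 2) / 2)).
    by apply/funext => z; exact: normal_pdf2E.
  by measurability.
have mF : measurable_fun setT F.
  have -> : F = fun y => (f y.1.2 * g y.2 * (normal_peak s ^+ 2 * expR (-
      (((s^-1 * (y.1.1.1 - y.1.2)) ^+ 2 + (s^-1 * (y.1.1.2 - y.2)) ^+ 2) / 2))))%:E.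
    by apply/funext => z; rewrite /F normal_pdf2E.
  by measurability.
have F0 y : (0 <= F y)%E by rewrite lee_fin !mulr_ge0// normal_pdf_ge0.
have E (M : probability (R * R)%type R) :
  (\int[M]_z \int[GG]_w (f (z.1 + s * w.1) * g (z.2 + s * w.2))%:E =
   \int[leb]_p \int[leb]_q ((f p * g q)%:E * \int[M]_z (K p q z)%:E))%E.
  transitivity (\int[M]_z \int[leb]_p \int[leb]_q F (z, p, q))%E.
    apply: eq_integral => z _.
    rewrite -(integral_smoothing _ _ s0 mf mg f0 g0).
    rewrite (@fubini_tonelli1 _ _ _ _ _ G G
      (fun w => (f (z.1 + s * w.1) * g (z.2 + s * w.2))%:E))//.
    - apply/measurable_EFinP; apply: measurable_funM; apply: measurableT_comp => //; measurability.
    - by move=> w; rewrite lee_fin mulr_ge0.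
  rewrite (@tonelli3 _ _ _ _ _ _ _ M leb leb F mF F0).
  apply: eq_integral => p _; apply: eq_integral => q _.
  rewrite -ge0_integralZl//.
  - exact/measurable_EFinP.
  - by move=> z _; rewrite lee_fin.
  - by rewrite lee_fin mulr_ge0.
rewrite !E; apply: eq_integral => p _; apply: eq_integral => q _.
by rewrite /K eq_kernel.
Qed.

End cramer_wold.

Section cramer_wold_uniqueness.
Context {R : realType}.
Local Notation G := (std_normal R).
Local Notation GG := (std_normal2 R).
Local Notation plane := (measurableTypeR R * measurableTypeR R)%type.

Let step (n : nat) : R := n.+1%:R^-1.

(** The threshold recedes by 1/(n+1) while the noise is scaled by 1/(n+1)^2. The smoothed indicator
    therefore converges to that of x < c at every point, the boundary x = c included. *)
Let cutoff (c : R) (n : nat) : R -> R := \1_(`]-oo, (c - step n)[%classic).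

Let cutoff_near c (x u : R) : \forall n \near \oo,
  cutoff c n (x + step n ^+ 2 * u) = \1_(`]-oo, c[%classic) x.
Proof.
have step_gt0 n : 0 < step n by rewrite invr_gt0.
have step_le1 n : step n <= 1 by rewrite invf_le1 ?ler1n.
have u1 : 0 < 1 + `|u| by rewrite ltr_pwDl.
have step_u n : step n ^+ 2 * u <= step n ^+ 2 * `|u|.
  by rewrite ler_wpM2l ?sqr_ge0 ?ler_norm.
have step_Nu n : - (step n ^+ 2 * `|u|) <= step n ^+ 2 * u.
  by rewrite -mulrN ler_wpM2l ?sqr_ge0// lerNl -normrN ler_norm.
have memE (a b : R) : (a \in `]-oo, b[%classic) = (a < b).
  by apply/idP/idP; rewrite inE/= in_itv.
have [xc|cx] := ltP x c.
- have e0 : 0 < (c - x) / (1 + `|u|) by rewrite divr_gt0 ?subr_gt0.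
  near=> n.
  have hn : step n < (c - x) / (1 + `|u|).
    near: n; exact: (near_infty_natSinv_lt (PosNum e0)).
  have key : x + step n ^+ 2 * u < c - step n.
    move: hn; rewrite ltr_pdivlMr// => hn.
    have h : step n ^+ 2 * `|u| <= step n * `|u|.
      by rewrite ler_wpM2r// expr2 ler_piMl// ltW.
    have h' := step_u n.
    clear -hn h h'; clearbody step; lra.
  by rewrite /cutoff !indicE !memE xc key.
- have e0 : 0 < (1 + `|u|)^-1 by rewrite invr_gt0.
  near=> n.
  have hn : step n < (1 + `|u|)^-1.
    near: n; exact: (near_infty_natSinv_lt (PosNum e0)).
  have key : (x + step n ^+ 2 * u < c - step n) = false.
    apply/negbTE; rewrite -leNgt.
    have h : step n * `|u| < 1.
      move: hn; rewrite -div1r ltr_pdivlMr// mulrDr mulr1.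
      by apply: le_lt_trans; rewrite lerDr ltW.
    have h2 : step n ^+ 2 * `|u| <= step n * 1.
      by rewrite expr2 -mulrA ler_wpM2l ?(ltW (step_gt0 n))// ltW.
    have h' := step_Nu n.
    clear -h2 h' cx; clearbody step; lra.
  by rewrite /cutoff !indicE !memE key ltNge cx.
Unshelve. all: by end_near. Qed.

Let measurable_cutoff c n : measurable_fun setT (cutoff c n).
Proof. exact: measurable_indic. Qed.

Let cutoff_ge0 c n x : 0 <= cutoff c n x.
Proof. by rewrite /cutoff indicE. Qed.

Let cutoff_le1 c n x : cutoff c n x <= 1.
Proof. by rewrite /cutoff indicE lern1; case: (_ \in _). Qed.

Let smoothing_cvg (P : probability (R * R)%type R) c e :
  (\int[P]_z \int[GG]_w (cutoff c n (z.1 + step n ^+ 2 * w.1) *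
                         cutoff e n (z.2 + step n ^+ 2 * w.2))%:E)%E @[n --> \oo] -->
  P (`]-oo, c[%classic `*` `]-oo, e[%classic).
Proof.
pose F n (y : (R * R) * plane) := (cutoff c n (y.1.1 + step n ^+ 2 * y.2.1) *
                         cutoff e n (y.1.2 + step n ^+ 2 * y.2.2))%:E.
have mF n : measurable_fun setT (F n).
  have mc := measurable_cutoff c n; have me := measurable_cutoff e n.
  by rewrite /F; measurability.
have F0 n y : (0 <= F n y)%E by rewrite lee_fin mulr_ge0.
pose Q : set (R * R) := `]-oo, c[%classic `*` `]-oo, e[%classic.
have mQ : measurable Q by exact: measurableX.
pose f (y : (R * R) * plane) := (\1_Q y.1)%:E : \bar R.
have mf : measurable_fun setT f.
  by apply/measurable_EFinP; apply: measurableT_comp => //.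
have f0 y : (0 <= f y)%E by rewrite lee_fin.
rewrite [X in X @ _ --> _](_ : _ = fun n => \int[P \x GG]_y F n y)%E; last first.
  apply/funext => n.
  by rewrite (@fubini_tonelli1 _ _ _ _ _ P GG (F n) (mF n) (F0 n)).
have -> : P Q = (\int[P \x GG]_y f y)%E.
  rewrite (@fubini_tonelli1 _ _ _ _ _ P GG f mf f0) /fubini_F /f/=.
  under eq_integral do rewrite integral_prob_cst.
  by rewrite integral_indic// setIT.
apply: (@dominated_cvg _ _ _ _ setT measurableT F f (cst 1%E)) => //.
- move=> y _; apply: cvg_near_cst.
  near=> n.
  rewrite /F /f; congr EFin.
  rewrite (_ : cutoff c n _ = \1_(`]-oo, c[%classic) y.1.1); last by near: n; exact: cutoff_near.
  rewrite (_ : cutoff e n _ = \1_(`]-oo, e[%classic) y.1.2); last by near: n; exact: cutoff_near.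
  by rewrite !indicE -natrM mulnb in_setX.
- pose PG : probability (R * R * plane)%type R := (P \x GG)%E.
  exact: (finite_measure_integrable_cst PG (1 : R) measurableT).
- move=> n y _; rewrite /F gee0_abs ?lee_fin ?mulr_ge0//.
  by rewrite mulr_ile1.
Unshelve. all: by end_near. Qed.

Lemma plane_cf_unique (P Q : probability (R * R)%type R) :
  (forall u v, (\int[P]_z (cos (u * z.1 + v * z.2))%:E =
                \int[Q]_z (cos (u * z.1 + v * z.2))%:E)%E) ->
  (forall u v, (\int[P]_z (sin (u * z.1 + v * z.2))%:E =
                \int[Q]_z (sin (u * z.1 + v * z.2))%:E)%E) ->
  forall A, measurable A -> P A = Q A.
Proof.
move=> PQcos PQsin.
apply: measure_unique_quadrants => [|c e].
  by rewrite ltey_eq fin_num_measure.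
have E n : (\int[P]_z \int[GG]_w (cutoff c n (z.1 + step n ^+ 2 * w.1) *
                         cutoff e n (z.2 + step n ^+ 2 * w.2))%:E =
            \int[Q]_z \int[GG]_w (cutoff c n (z.1 + step n ^+ 2 * w.1) *
                         cutoff e n (z.2 + step n ^+ 2 * w.2))%:E)%E.
  by apply: (eq_smoothing PQcos PQsin) => //; rewrite exprn_gt0// invr_gt0.
apply: etrans (esym (cvg_lim _ (@smoothing_cvg P c e))) _ => //.
apply: etrans (cvg_lim _ (@smoothing_cvg Q c e)) => //.
by apply: congr_lim; apply/funext => n; exact: E.
Qed.

End cramer_wold_uniqueness.

Section gaussian_pair.
Context {R : realType}.
Local Notation G := (std_normal R).
Local Notation GG := (std_normal2 R).
Local Notation plane := (measurableTypeR R * measurableTypeR R)%type.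

(** Laws are transported on nonnegative functions, so sine and cosine are handled as 1 + sin and 1 +
    cos; this removes the 1 afterwards. *)
Lemma integral_1D d (T : measurableType d) (P : probability T R) (g : T -> R) (k : R) :
  P.-integrable setT (EFin \o g) ->
  (\int[P]_x (1 + g x)%:E = (1 + k)%:E)%E -> (\int[P]_x (g x)%:E = k%:E)%E.
Proof.
move=> ig; have I1 := finite_measure_integrable_cst P (1 : R) measurableT.
under eq_integral do rewrite EFinD.
rewrite integralD// integral_prob_cst.
by have /fineK <- := integrable_fin_num measurableT ig; rewrite -EFinD => -[] /addrI ->.
Qed.

Lemma normal_1sin_mixture (x y : R) :
  (\int[G]_g \int[G]_h (1 + sin (x * g + y * h))%:E = 1%:E)%E.
Proof.
have I1 := finite_measure_integrable_cst G (1 : R) measurableT.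
have inner (g : R) : (\int[G]_h (1 + sin (x * g + y * h))%:E =
    (1 + normal_cf y * sin (x * g))%:E)%E.
  under eq_integral => h _.
    rewrite -cosBpihalf (_ : x * g + y * h - pi / 2 = y * h + (x * g - pi / 2)); last by ring.
    rewrite EFinD; over.
  rewrite integralD//; last exact: integrable_normal_cos.
  by rewrite integral_std_normal_cst normal_cosD cosBpihalf.
under eq_integral do rewrite inner EFinD EFinM.
have iS : G.-integrable setT (EFin \o (fun z => sin (x * z))).
  by have := integrable_normal_sin x 0; under eq_fun do rewrite addr0.
rewrite integralD//; last exact: integrableZl.
by rewrite integralZl// integral_std_normal_cst normal_sin mule0 adde0.
Qed.

(** The ridge hypothesis fixes every sine and cosine integral of (X, Y), and independent normals of
    deviations s1, s2 have the same ones. Applied to X_0 and Y_0 - c X_0, it turns uncorrelatedness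
    into independence. *)
Lemma gaussian_pair_law d (T : measurableType d) (P : probability T R) (X Y : T -> R)
    (s1 s2 : R) : measurable_fun setT X -> measurable_fun setT Y ->
  (forall u v, exists2 s, s ^+ 2 = (u * s1) ^+ 2 + (v * s2) ^+ 2 &
     forall f : R -> \bar R, measurable_fun setT f -> (forall x, 0 <= f x)%E ->
     (\int[P]_x f (u * X x + v * Y x)%R = \int[G]_z f (s * z)%R)%E) ->
  forall F : R * R -> \bar R, measurable_fun setT F -> (forall x, 0 <= F x)%E ->
  (\int[P]_x F (X x, Y x) = \int[G]_x \int[G]_y F ((s1 * x)%R, (s2 * y)%R))%E.
Proof.
move=> mX mY ridge F mF F0.
have mZ : measurable_fun setT (fun x => (X x, Y x)) by exact: measurable_fun_pair.
have mS : measurable_fun setT (fun w : plane => (s1 * w.1, s2 * w.2) : R * R) by measurability.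
pose Z : {mfun T >-> (R * R)%type} := HB.pack (fun x => (X x, Y x)) (isMeasurableFun.Build _ _ _ _ _ mZ).
pose S : {mfun plane >-> (R * R)%type} :=
  HB.pack (fun w : plane => (s1 * w.1, s2 * w.2) : R * R) (isMeasurableFun.Build _ _ _ _ _ mS).
pose P' : probability (R * R)%type R := distribution P Z.
pose Q' : probability (R * R)%type R := distribution GG S.
have c1 (x : R) : (0 <= (1 + cos x)%:E)%E by rewrite lee_fin -lerBlDl sub0r cos_geN1.
have s1' (x : R) : (0 <= (1 + sin x)%:E)%E by rewrite lee_fin -lerBlDl sub0r sin_geN1.
have m1c : measurable_fun setT (fun z : R => (1 + cos z)%:E) by measurability.
have m1s : measurable_fun setT (fun z : R => (1 + sin z)%:E) by measurability.
have mc u v : measurable_fun setT (fun z : R * R => (1 + cos (u * z.1 + v * z.2))%:E) by measurability.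
have ms u v : measurable_fun setT (fun z : R * R => (1 + sin (u * z.1 + v * z.2))%:E) by measurability.
have PE (f : R * R -> \bar R) : measurable_fun setT f -> (forall x, 0 <= f x)%E ->
    (\int[P']_z f z = \int[P]_x f (X x, Y x))%E.
  by move=> mf f0; rewrite /P' ge0_integral_distribution.
have QE (f : R * R -> \bar R) : measurable_fun setT f -> (forall x, 0 <= f x)%E ->
    (\int[Q']_z f z = \int[G]_x \int[G]_y f ((s1 * x)%R, (s2 * y)%R))%E.
  move=> mf f0; rewrite /Q' ge0_integral_distribution//.
  have mfS : measurable_fun setT (f \o S) by exact: measurableT_comp.
  exact: (@fubini_tonelli1 _ _ _ _ _ G G (f \o S) mfS (fun w => f0 _)).
have PQ : forall A, measurable A -> P' A = Q' A.
  apply: plane_cf_unique => u v.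
  - transitivity (expR (- (((u * s1) ^+ 2 + (v * s2) ^+ 2) / 2)))%:E.
      apply: integral_1D; first exact: integrable_plane_cos.
      rewrite PE//; have [s sE] := ridge u v.
      move=> /(_ _ m1c c1) ->.
      under eq_integral do rewrite EFinD.
      have I1 := finite_measure_integrable_cst G (1 : R) measurableT.
      have Is : G.-integrable setT (EFin \o (fun z => cos (s * z))).
        by have := integrable_normal_cos s 0; under eq_fun do rewrite addr0.
      rewrite integralD//.
      by rewrite integral_std_normal_cst normal_cos normal_cfE sE.
    apply/esym; apply: integral_1D; first exact: integrable_plane_cos.
    rewrite QE// -normal_cos_mixture.
    by apply: eq_integral => x _; apply: eq_integral => y _; rewrite /= !mulrA.
  - transitivity (0%:E : \bar R).
      apply: integral_1D; first exact: integrable_plane_sin.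
      rewrite PE//; have [s sE] := ridge u v.
      move=> /(_ _ m1s s1') ->.
      under eq_integral do rewrite EFinD.
      have I1 := finite_measure_integrable_cst G (1 : R) measurableT.
      have Is : G.-integrable setT (EFin \o (fun z => sin (s * z))).
        by have := integrable_normal_sin s 0; under eq_fun do rewrite addr0.
      rewrite integralD//.
      by rewrite integral_std_normal_cst normal_sin.
    apply/esym; apply: integral_1D; first exact: integrable_plane_sin.
    rewrite QE// addr0 -(normal_1sin_mixture (u * s1) (v * s2)).
    by apply: eq_integral => x _; apply: eq_integral => y _; rewrite /= !mulrA.
rewrite -PE// -QE//.
by apply: eq_measure_integral => A mA _; exact: PQ.
Qed.

End gaussian_pair.

(** * The stationary Kalman filter *)

Section independence.
Context {R : realType} d (T : measurableType d) (P : probability T R).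
Context (I : eqType) (F : I -> set_system T).

Definition events (l : seq I) (E : I -> set T) : set T := \bigcap_(i in [set` l]) E i.

Lemma events_cons i l E : events (i :: l) E = E i `&` events l E.
Proof.
rewrite /events (_ : [set` i :: l] = i |` [set` l]) ?bigcap_setU1//.
apply/seteqP; split => j /=; rewrite inE.
  by case/predU1P => [->|]; [left|right].
by case=> [->|->]; rewrite ?eqxx ?orbT.
Qed.

Lemma events_nil E : events [::] E = setT.
Proof. by rewrite /events set_nil bigcap_set0. Qed.

Lemma eq_events l E E' : {in l, E =1 E'} -> events l E = events l E'.
Proof. by move=> EE'; apply: eq_bigcapr => i /EE'. Qed.

(* U is independent of the family (F i), i in J, which is itself mutually
   independent. *)
Definition indep_from dS (S : measurableType dS) (U : T -> S) (J : pred I) : Prop :=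
  forall (l : seq I) (E : I -> set T) (C : set S),
    uniq l -> {in l, forall i, J i} -> {in l, forall i, F i (E i)} -> measurable C ->
    P (U @^-1` C `&` events l E) = (P (U @^-1` C) * \prod_(i <- l) P (E i))%E.

Hypothesis measurableF : forall i A, F i A -> measurable A.

Lemma measurable_events l E : {in l, forall i, F i (E i)} -> measurable (events l E).
Proof.
elim: l => [|i l IH] FE; first by rewrite events_nil.
rewrite events_cons; apply: measurableI.
  by apply: (measurableF (FE i _)); rewrite mem_head.
by apply: IH => j jl; apply: FE; rewrite in_cons jl orbT.
Qed.

Lemma indep_from_sub dS (S : measurableType dS) (U : T -> S) (J J' : pred I) :
  (forall i, J' i -> J i) -> indep_from U J -> indep_from U J'.
Proof. by move=> sJ UJ l E C ul lJ; apply: UJ => // i /lJ /sJ. Qed.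

Lemma indep_from_comp dS (S : measurableType dS) dS' (S' : measurableType dS')
    (U : T -> S) (g : S -> S') (J : pred I) : measurable_fun setT g ->
  indep_from U J -> indep_from (g \o U) J.
Proof.
move=> mg UJ l E C ul lJ lF mC; rewrite comp_preimage UJ//.
by rewrite -[X in measurable X]setTI; exact: mg.
Qed.

Lemma prod_prob_fin l E : {in l, forall i, F i (E i)} ->
  exists k : {nonneg R}, (\prod_(i <- l) P (E i) = k%:num%:E)%E.
Proof.
elim: l => [|i l IH] FE; first by exists 1%:nng; rewrite big_nil.
have [|k kE] := IH; first by move=> j jl; apply: FE; rewrite in_cons jl orbT.
have mE : measurable (E i) by apply: (measurableF (FE i _)); rewrite mem_head.
have p0 : 0 <= fine (P (E i)) by exact: fine_ge0.
exists (NngNum (mulr_ge0 p0 (ge0 k))).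
by rewrite big_cons kE/= EFinM fineK// fin_num_measure.
Qed.

(* Both sides are finite measures of the event D that agree on rectangles. *)
Lemma indep_from_pair dS (S : measurableType dS) (U : T -> S) (xi : T -> R) (J : pred I) i0 :
  measurable_fun setT U -> measurable_fun setT xi ->
  (forall B, measurable B -> F i0 (xi @^-1` B)) -> J i0 ->
  indep_from U J -> indep_from (fun x => (U x, xi x)) (predD1 J i0).
Proof.
move=> mU mxi Fxi Ji0 UJ l E D ul lJ lF mD.
have mUxi : measurable_fun setT (fun x => (U x, xi x)) by exact: measurable_fun_pair.
have mE := measurable_events lF.
have [k kE] := prod_prob_fin lF.
rewrite kE muleC.
pose m1 := image_measure (mrestr P mE) mUxi.
pose m2 := mscale k (image_measure P mUxi).
suff : m1 D = m2 D by [].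
have i0l : i0 \notin l by apply/negP => /lJ; rewrite /= eqxx.
apply: measure_unique_rectangles => //.
  have : (P (setT `&` events l E) <= P setT)%E by rewrite le_measure ?inE//; exact: measurableI.
  move=> /le_lt_trans; apply.
  by apply: le_lt_trans (probability_le1 P measurableT) _; rewrite ltry.
move=> A B mA mB.
(* On a rectangle the constraint on [xi] becomes the event of index [i0], and the independence of
   [U] applies to the longer list [i0 :: l]. *)
pose E' j := if j == i0 then xi @^-1` B else E j.
have E'l : {in l, E' =1 E}.
  by move=> j jl; rewrite /E'; case: eqP => // ji0; rewrite -ji0 jl in i0l.
have pre : (fun x => (U x, xi x)) @^-1` (A `*` B) = U @^-1` A `&` xi @^-1` B by [].
have E'i0 : E' i0 = xi @^-1` B by rewrite /E' eqxx.
have H1 : P (U @^-1` A `&` xi @^-1` B `&` events l E) =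
    (P (U @^-1` A) * (P (xi @^-1` B) * k%:num%:E))%E.
  have := UJ (i0 :: l) E' A.
  rewrite events_cons E'i0 (eq_events E'l) big_cons E'i0 -setIA => -> //.
  - by congr (_ * (_ * _))%E; rewrite -kE; apply: eq_big_seq => j jl; rewrite E'l.
  - by rewrite /= i0l.
  - by move=> j; rewrite in_cons => /predU1P[->//|/lJ /andP[]].
  - move=> j; rewrite in_cons => /predU1P[->|jl]; first by rewrite E'i0; exact: Fxi.
    by rewrite E'l//; exact: lF.
have H2 : P (U @^-1` A `&` xi @^-1` B) = (P (U @^-1` A) * P (xi @^-1` B))%E.
  have := UJ [:: i0] E' A.
  rewrite events_cons events_nil setIT E'i0 big_seq1 E'i0 => -> //.
  - by move=> j; rewrite inE => /eqP ->.
  - by move=> j; rewrite inE => /eqP ->; rewrite E'i0; exact: Fxi.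
transitivity (P (U @^-1` A `&` xi @^-1` B `&` events l E)); first by [].
transitivity (k%:num%:E * P (U @^-1` A `&` xi @^-1` B))%E; last by [].
by rewrite H1 H2 [RHS]muleC muleA.
Qed.

(** Independence identifies the joint law of [U] and [xi] with a product measure, by its values on
    rectangles; Tonelli then integrates the noise out. *)
Lemma integral_indep dS (S : measurableType dS) (U : T -> S) (xi : T -> R) (J : pred I) i0
    (g : S * R -> \bar R) :
  measurable_fun setT U -> measurable_fun setT xi ->
  (forall B, measurable B -> F i0 (xi @^-1` B)) -> J i0 ->
  (forall B, measurable B -> P (xi @^-1` B) = std_normal R B) ->
  indep_from U J -> measurable_fun setT g -> (forall z, 0 <= g z)%E ->
  (\int[P]_x g (U x, xi x) = \int[P]_x \int[std_normal R]_z g (U x, z))%E.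
Proof.
move=> mU mxi Fxi Ji0 lawxi UJ mg g0.
pose G := std_normal R.
have mUxi : measurable_fun setT (fun x => (U x, xi x) : S * measurableTypeR R).
  exact: measurable_fun_pair.
pose U' : {mfun T >-> S} := HB.pack U (isMeasurableFun.Build _ _ _ _ _ mU).
pose PU : probability S R := distribution P U'.
have PUE (A : set S) (B : set (measurableTypeR R)) : measurable A -> measurable B ->
    image_measure P mUxi (A `*` B) = (PU A * G B)%E.
  move=> mA mB; have := UJ [:: i0] (fun=> xi @^-1` B) A.
  rewrite events_cons events_nil setIT big_seq1 lawxi// => h.
  transitivity (P (U @^-1` A `&` xi @^-1` B)); first by [].
  rewrite h//.
  - by move=> j; rewrite inE => /eqP ->.
  - by move=> j; rewrite inE => /eqP ->; exact: Fxi.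
have lawE : forall X, measurable X -> (PU \x G)%E X = image_measure P mUxi X.
  exact: product_measure_unique.
transitivity (\int[image_measure P mUxi]_y g y)%E.
  by rewrite ge0_integral_image.
transitivity (\int[PU \x G]_y g y)%E.
  by apply: eq_measure_integral => X mX _; exact/esym/lawE.
rewrite (@fubini_tonelli1 _ _ _ _ _ PU G g mg g0).
rewrite ge0_integral_distribution//; last by move=> y; exact: integral_ge0.
exact: (@measurable_fun_fubini_tonelli_F _ _ _ _ _ G g mg g0).
Qed.

End independence.

(** * Observation histories and linear filters *)

Section histories.
Context {R : realType}.

Definition extend n (o : n.-tuple R) (x : R) : n.+1.-tuple R := [tuple of rcons o x].

Lemma nth_extend_lt n (o : n.-tuple R) x i : (i < n)%N -> nth 0 (extend o x) i = nth 0 o i.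
Proof. by move=> ilt; rewrite /= nth_rcons size_tuple ilt. Qed.

Lemma nth_extend_eq n (o : n.-tuple R) x : nth 0 (extend o x) n = x.
Proof. by rewrite /= nth_rcons size_tuple ltnn eqxx. Qed.

Lemma measurable_nth_tuple n i : measurable_fun setT (fun o : n.-tuple R => nth 0 o i).
Proof.
have [ilt|ige] := ltnP i n.
  rewrite (_ : (fun o : n.-tuple R => nth 0 o i) = fun o => tnth o (Ordinal ilt)).
    exact: measurable_tnth.
  by apply/funext => o; rewrite (tnth_nth 0).
rewrite (_ : (fun o : n.-tuple R => nth 0 o i) = fun=> 0); first exact: measurable_cst.
by apply/funext => o; rewrite nth_default// size_tuple.
Qed.

Lemma measurable_extend n d (T : measurableType d) (o : T -> n.-tuple R) (x : T -> R) :
  measurable_fun setT o -> measurable_fun setT x ->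
  measurable_fun setT (fun t => extend (o t) (x t)).
Proof.
move=> mo mx; apply/measurable_fun_tnthP => i.
rewrite (_ : _ \o _ = fun t => nth 0 (extend (o t) (x t)) i); last first.
  by apply/funext => t /=; rewrite (tnth_nth 0).
have [ilt|ige] := ltnP i n.
  rewrite (_ : (fun t => _) = (fun o : n.-tuple R => nth 0 o i) \o o).
    by apply: measurableT_comp => //; exact: measurable_nth_tuple.
  by apply/funext => t; rewrite nth_extend_lt.
rewrite (_ : (fun t => _) = x)//; apply/funext => t.
by rewrite (_ : nat_of_ord i = n) ?nth_extend_eq//; apply/eqP; rewrite eqn_leq ige -ltnS ltn_ord.
Qed.

Lemma nth_obs d (Om : measurableType d) (X : nat -> Om -> R) t x i :
  (i <= t)%N -> nth 0 (obs X t x) i = X i x.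
Proof.
move=> it; have ilt : (i < t.+1)%N by [].
by rewrite -(tnth_nth 0 _ (Ordinal ilt)) tnth_mktuple.
Qed.

Lemma obsS d (Om : measurableType d) (X : nat -> Om -> R) t x : obs X t.+1 x = extend (obs X t x) (X t.+1 x).
Proof.
apply: eq_from_tnth => i; rewrite !(tnth_nth 0).
have := ltn_ord i; rewrite ltnS leq_eqVlt => /predU1P[->|ilt].
  by rewrite nth_extend_eq nth_obs.
by rewrite nth_extend_lt// !nth_obs// ltnW.
Qed.

Lemma measurable_obs d (T : measurableType d) (X : nat -> T -> R) t :
  (forall i, measurable_fun setT (X i)) -> measurable_fun setT (obs X t).
Proof.
move=> mX; apply/measurable_fun_tnthP => i.
by rewrite (_ : _ \o _ = X i)//; apply/funext => x /=; rewrite tnth_mktuple.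
Qed.

(** The Kalman recursion a m + B (X_t - f m) with the terms in m collected, so A = a - f B, started
    at c X_0. *)
Fixpoint linear_filter (c A B : R) (t : nat) (x : nat -> R) : R :=
  if t is s.+1 then A * linear_filter c A B s x + B * x t else c * x 0%N.

Lemma eq_linear_filter c A B t (x y : nat -> R) : (forall i, (i <= t)%N -> x i = y i) ->
  linear_filter c A B t x = linear_filter c A B t y.
Proof.
elim: t => [|t IH] xy /=; first by rewrite xy.
by rewrite IH ?xy// => i it; rewrite xy// leqW.
Qed.

Lemma measurable_linear_filter c A B n t :
  measurable_fun setT (fun o : n.-tuple R => linear_filter c A B t (nth 0 o)).
Proof.
elim: t => [|t IH] /=.
  by apply: measurable_funM => //; exact: measurable_nth_tuple.
apply: measurable_funD; first exact: measurable_funM.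
by apply: measurable_funM => //; exact: measurable_nth_tuple.
Qed.

End histories.

(** * One step of the stationary Kalman filter *)

Section kalman.
Context {R : realType} d (T : measurableType d) (P : probability T R).
Variables (X Y w v : nat -> T -> R).
Variables (a f sigma th gam c : R).
Hypotheses (mX : forall t, measurable_fun setT (X t)) (mY : forall t, measurable_fun setT (Y t)).
Hypotheses (mw : forall t, measurable_fun setT (w t)) (mv : forall t, measurable_fun setT (v t)).
Hypothesis XE : forall t x, X t.+1 x = f * Y t x + sigma * w t.+1 x.
Hypothesis YE : forall t x, Y t.+1 x = a * Y t x + th * v t.+1 x.

Local Notation PP := (sigma ^+ 2 + f ^+ 2 * gam).
Local Notation AA := (a * sigma ^+ 2 / PP).
Local Notation BB := (a * f * gam / PP).
Hypotheses (sigma0 : sigma != 0) (th0 : th != 0) (gam0 : 0 < gam).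
Hypothesis riccati : gam = th ^+ 2 + a ^+ 2 * sigma ^+ 2 * gam / PP.

Local Notation G := (std_normal R).

Lemma innovation_var_gt0 : 0 < PP.
Proof.
by rewrite ltr_pwDl// ?exprn_even_gt0// mulr_ge0 ?sqr_ge0// ltW.
Qed.
Let PP0 := innovation_var_gt0.

Lemma filter_gainE : AA + f * BB = a.
Proof. by field; rewrite gt_eqF. Qed.

Lemma rotation_neqN1 (x y : R) : x ^+ 2 + y ^+ 2 = 1 -> y != 0 -> x != -1.
Proof.
move=> xy y0; have : 0 < y ^+ 2 by rewrite exprn_even_gt0.
by move=> y2; apply/eqP => x1; move: xy; rewrite x1; nra.
Qed.

(* The innovation f e + sigma w and the new error are obtained from the
   independent standard normals (e, w, v) by two successive rotations. *)
Lemma kalman_rotation (F : R * R -> \bar R) :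
  measurable_fun setT F -> (forall z, 0 <= F z)%E ->
  (\int[G]_e \int[G]_w \int[G]_v
     F ((f * (Num.sqrt gam * e) + sigma * w)%R,
        (AA * (Num.sqrt gam * e) - BB * (sigma * w) + th * v)%R) =
   \int[G]_y \int[G]_z F ((Num.sqrt PP * y)%R, (Num.sqrt gam * z)%R))%E.
Proof.
move=> mF F0.
set q := Num.sqrt PP; set g := Num.sqrt gam.
have q0 : 0 < q by rewrite sqrtr_gt0.
have g0 : 0 < g by rewrite sqrtr_gt0.
have q2 : q ^+ 2 = PP by rewrite sqr_sqrtr// ltW.
have g2 : g ^+ 2 = gam by rewrite sqr_sqrtr// ltW.
have q2' : sigma ^+ 2 = q ^+ 2 - f ^+ 2 * g ^+ 2 by rewrite q2 g2; ring.
(* The innovation is q (c1 e + s1 w), and the part of the new error due to e and w is k times the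
   orthogonal combination - s1 e + c1 w. *)
pose c1 := f * g / q; pose s1 := sigma / q; pose k := - (a * sigma * g / q).
have cs1 : c1 ^+ 2 + s1 ^+ 2 = 1.
  rewrite /c1 /s1 !exprMn exprVn q2'; field; exact: lt0r_neq0.
have c1N : c1 != -1.
  by apply: rotation_neqN1 cs1 _; rewrite mulf_neq0// invr_eq0 gt_eqF.
pose H (z : R * R) := (\int[G]_v F (q * z.1, k * z.2 + th * v)%R)%E.
have mH3 : measurable_fun setT (fun y : (R * R) * R => F (q * y.1.1, k * y.1.2 + th * y.2)).
  by measurability.
have mH : measurable_fun setT H.
  exact: (@measurable_fun_fubini_tonelli_F _ _ _ _ _ G _ mH3 (fun y => F0 _)).
have H0 z : (0 <= H z)%E by exact: integral_ge0.
transitivity (\int[G]_e \int[G]_w H ((c1 * e + s1 * w)%R, (- s1 * e + c1 * w)%R))%E.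
  apply: eq_integral => e _; apply: eq_integral => u _; apply: eq_integral => y _.
  congr (F (_, _)) => /=.
    by rewrite /c1 /s1; field; exact: lt0r_neq0.
  congr (_ + _); rewrite /k /c1 /s1 -q2 -g2.
  by field; exact: lt0r_neq0.
rewrite normal_rotation//.
apply: eq_integral => y _.
(* The second rotation mixes that orthogonal combination with v. That c2^2 + s2^2 = 1 is exactly the
   Riccati equation: the error variance is stationary. *)
pose c2 := k / g; pose s2 := th / g.
have cs2 : c2 ^+ 2 + s2 ^+ 2 = 1.
  have -> : c2 ^+ 2 + s2 ^+ 2 = (th ^+ 2 + a ^+ 2 * sigma ^+ 2 * g ^+ 2 / q ^+ 2) / g ^+ 2.
    by rewrite /c2 /s2 /k; field; rewrite !lt0r_neq0.
  by rewrite g2 q2 -riccati divff// gt_eqF.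
have c2N : c2 != -1.
  by apply: rotation_neqN1 cs2 _; rewrite mulf_neq0// invr_eq0 gt_eqF.
rewrite /H -(@normal_rotation1 _ (fun z => F (q * y, g * z)%R) c2 s2 cs2 c2N)//.
- apply: eq_integral => z _; apply: eq_integral => u _.
  by congr (F (_, _)) => /=; rewrite /c2 /s2; field; exact: lt0r_neq0.
- by measurability.
Qed.

End kalman.

(** * Joint law of the observations and the filter error *)

Section kalman_law.
Context {R : realType} d (T : measurableType d) (P : probability T R).
Variables (X Y w v : nat -> T -> R).
Variables (a f sigma th gam c : R).
Hypotheses (mX : forall t, measurable_fun setT (X t)) (mY : forall t, measurable_fun setT (Y t)).
Hypotheses (mw : forall t, measurable_fun setT (w t)) (mv : forall t, measurable_fun setT (v t)).
Hypothesis XE : forall t x, X t.+1 x = f * Y t x + sigma * w t.+1 x.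
Hypothesis YE : forall t x, Y t.+1 x = a * Y t x + th * v t.+1 x.

Local Notation PP := (sigma ^+ 2 + f ^+ 2 * gam).
Local Notation AA := (a * sigma ^+ 2 / PP).
Local Notation BB := (a * f * gam / PP).
Hypotheses (sigma0 : sigma != 0) (th0 : th != 0) (gam0 : 0 < gam).
Hypothesis riccati : gam = th ^+ 2 + a ^+ 2 * sigma ^+ 2 * gam / PP.

Let PP0 := innovation_var_gt0 f sigma0 gam0.
Local Notation G := (std_normal R).

Variable Fam : unit + (nat + nat) -> set_system T.
Hypothesis measurableF : forall i A, Fam i A -> measurable A.
Hypothesis Fw : forall t B, measurable B -> Fam (inr (inl t)) (w t.+1 @^-1` B).
Hypothesis Fv : forall t B, measurable B -> Fam (inr (inr t)) (v t.+1 @^-1` B).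
Hypothesis laww : forall t B, measurable B -> P (w t.+1 @^-1` B) = G B.
Hypothesis lawv : forall t B, measurable B -> P (v t.+1 @^-1` B) = G B.

(** Index t stands for the noise at time t + 1, so t >= s selects the noises not yet used at time s;
    the initial pair is never among them. *)
Definition future (s : nat) : pred (unit + (nat + nat)) := fun i =>
  match i with inl _ => false | inr (inl t) => (s <= t)%N | inr (inr t) => (s <= t)%N end.

Hypothesis init_indep : indep_from P Fam (fun x => (X 0%N x, Y 0%N x)) (future 0).
Hypothesis init_law : forall F : R * R -> \bar R, measurable_fun setT F ->
  (forall z, 0 <= F z)%E ->
  (\int[P]_x F (X 0%N x, (Y 0%N x - c * X 0%N x)%R) =
   \int[P]_x \int[G]_z F (X 0%N x, (Num.sqrt gam * z)%R))%E.

Definition filter t x := linear_filter c AA BB t (X^~ x).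

Definition filter_err t x := Y t x - filter t x.

Let filterE t x : filter t x = linear_filter c AA BB t (nth 0 (obs X t x)).
Proof. by apply: eq_linear_filter => i it; rewrite nth_obs. Qed.

Let measurable_obsX t : measurable_fun setT (obs X t).
Proof. exact: measurable_obs. Qed.

Lemma measurable_filter t : measurable_fun setT (filter t).
Proof.
have -> : filter t = (fun o : t.+1.-tuple R => linear_filter c AA BB t (nth 0 o)) \o obs X t.
  by apply/funext => x; rewrite filterE.
apply: measurableT_comp; [exact: measurable_linear_filter|exact: measurable_obsX].
Qed.

Let measurable_err t : measurable_fun setT (filter_err t).
Proof. by apply: measurable_funB => //; exact: measurable_filter. Qed.

Lemma obs_innovation t x : X t.+1 x = f * filter t x + (f * filter_err t x + sigma * w t.+1 x).
Proof. by rewrite XE /filter_err; ring. Qed.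

Lemma filter_errS t x : filter_err t.+1 x =
  AA * filter_err t x - BB * (sigma * w t.+1 x) + th * v t.+1 x.
Proof.
rewrite {1}/filter_err /filter /= -/(filter t x) XE YE.
have -> : Y t x = filter t x + filter_err t x by rewrite /filter_err; ring.
have Ea := filter_gainE a f sigma0 gam0.
set A := AA in Ea *; set B := BB in Ea *.
by rewrite -Ea; ring.
Qed.

Let lf t (o : t.+1.-tuple R) := linear_filter c AA BB t (nth 0 o).

Let update t (y : (t.+1.-tuple R * R) * R * R) : t.+2.-tuple R * R :=
  let: (o, e, u, z) := y in
  (extend o (f * lf o + (f * e + sigma * u)), AA * e - BB * (sigma * u) + th * z).

Let measurable_update t : measurable_fun setT (@update t).
Proof.
rewrite (_ : @update t = fun y =>
  (extend y.1.1.1 (f * lf y.1.1.1 + (f * y.1.1.2 + sigma * y.1.2)),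
   AA * y.1.1.2 - BB * (sigma * y.1.2) + th * y.2)); last first.
  by apply/funext; case=> -[] [].
have mlf : measurable_fun setT (@lf t) by exact: measurable_linear_filter.
apply: measurable_fun_pair; last by measurability.
by apply: measurable_extend; measurability.
Qed.

Let update_obs t x :
  (obs X t.+1 x, filter_err t.+1 x) =
  update ((obs X t x, filter_err t x), w t.+1 x, v t.+1 x).
Proof.
rewrite /update obsS obs_innovation filter_errS; congr (extend _ (_ * _ + _), _).
exact: filterE.
Qed.

Let measurable_state t : measurable_fun setT (fun x => (obs X t x, filter_err t x)).
Proof. by apply: measurable_fun_pair; [exact: measurable_obsX|exact: measurable_err]. Qed.

Let measurable_state_noise t :
  measurable_fun setT (fun x => ((obs X t x, filter_err t x), w t.+1 x)).
Proof. by apply: measurable_fun_pair; [exact: measurable_state|exact: mw]. Qed.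

(** The state at t + 1 is a function of the state at t and of the two noises of index t, which two
    uses of [indep_from_pair] withdraw from the future. *)
Let indep_obs t : indep_from P Fam (fun x => (obs X t x, filter_err t x)) (future t).
Proof.
elim: t => [|t IH].
  have -> : (fun x => (obs X 0 x, filter_err 0 x)) =
    (fun z : R * R => (extend [tuple] z.1, z.2 - c * z.1)) \o (fun x => (X 0%N x, Y 0%N x)).
    apply/funext => x /=; congr (_, _).
    by apply: eq_from_tnth => i; rewrite (ord1 i) tnth_mktuple.
  apply: indep_from_comp => //.
  apply: measurable_fun_pair; last by measurability.
  by apply: measurable_extend; measurability.
have -> : (fun x => (obs X t.+1 x, filter_err t.+1 x)) = @update t \o
    (fun x => ((obs X t x, filter_err t x), w t.+1 x, v t.+1 x)).
  by apply/funext => x; rewrite update_obs.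
apply: indep_from_comp; first exact: measurable_update.
have mU := @measurable_state t; have mUw := @measurable_state_noise t.
have IHw := indep_from_pair measurableF mU (mw t.+1) (Fw t) (leqnn t) IH.
have IHv := indep_from_pair measurableF mUw (mv t.+1) (Fv t) (leqnn t) IHw.
apply: indep_from_sub IHv => i ts.
have nl : i != inr (inl t) by apply/eqP => E; move: ts; rewrite E /= ltnn.
have nr : i != inr (inr t) by apply/eqP => E; move: ts; rewrite E /= ltnn.
rewrite /= nl nr/=.
by move: ts; case: i {nl nr} => // -[] s /= /ltnW.
Qed.

(** One identity for two facts: the filter error is centered normal of variance [gam], and it is
    independent of the observations. *)
Let Jlaw t := forall F : t.+1.-tuple R * R -> \bar R, measurable_fun setT F ->
  (forall z, 0 <= F z)%E ->
  (\int[P]_x F (obs X t x, filter_err t x) =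
   \int[P]_x \int[G]_z F (obs X t x, (Num.sqrt gam * z)%R))%E.

(** Integrating out v, then w, and replacing the old error by a normal variable through [Jlaw]
    leaves exactly the triple integral of [kalman_rotation]. *)
Let joint_step t : Jlaw t ->
  forall F : t.+2.-tuple R * R -> \bar R, measurable_fun setT F -> (forall z, 0 <= F z)%E ->
  (\int[P]_x F (obs X t.+1 x, filter_err t.+1 x) =
   \int[P]_x \int[G]_y \int[G]_z
     F (extend (obs X t x) (f * filter t x + Num.sqrt PP * y)%R, (Num.sqrt gam * z)%R))%E.
Proof.
move=> J F mF F0.
pose Phi := F \o @update t.
have mPhi : measurable_fun setT Phi by apply: measurableT_comp => //; exact: measurable_update.
have Phi0 y : (0 <= Phi y)%E by exact: F0.
have mU := @measurable_state t; have mUw := @measurable_state_noise t.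
have IHw := indep_from_pair measurableF mU (mw t.+1) (Fw t) (leqnn t) (@indep_obs t).
transitivity (\int[P]_x Phi ((obs X t x, filter_err t x), w t.+1 x, v t.+1 x))%E.
  by apply: eq_integral => x _; rewrite update_obs.
rewrite (integral_indep mUw (mv t.+1) (Fv t)
  (_ : predD1 (future t) (inr (inl t)) (inr (inr t))) (lawv t) IHw mPhi Phi0); last first.
  by rewrite /= leqnn.
pose Phi2 y := (\int[G]_z Phi (y, z))%E.
have mPhi2 : measurable_fun setT Phi2.
  exact: (@measurable_fun_fubini_tonelli_F _ _ _ _ _ G Phi mPhi Phi0).
have Phi20 y : (0 <= Phi2 y)%E by exact: integral_ge0.
apply: etrans (integral_indep mU (mw t.+1) (Fw t) (leqnn t : future t (inr (inl t)))
  (laww t) (@indep_obs t) mPhi2 Phi20) _.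
pose Phi3 y := (\int[G]_z Phi2 (y, z))%E.
have mPhi3 : measurable_fun setT Phi3.
  exact: (@measurable_fun_fubini_tonelli_F _ _ _ _ _ G Phi2 mPhi2 Phi20).
have Phi30 y : (0 <= Phi3 y)%E by exact: integral_ge0.
rewrite (J Phi3 mPhi3 Phi30).
apply: eq_integral => x _; rewrite /Phi3 /Phi2 /Phi /=.
pose H (z : R * R) := F (extend (obs X t x) (f * lf (obs X t x) + z.1), z.2).
have mH : measurable_fun setT H.
  apply: measurableT_comp => //; apply: measurable_fun_pair; last by measurability.
  by apply: measurable_extend; measurability.
have -> : filter t x = lf (obs X t x) by exact: filterE.
apply: etrans (kalman_rotation sigma0 th0 gam0 riccati mH (fun z => F0 _)).
by [].
Qed.

Lemma obs_law t : Jlaw t ->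
  forall F : t.+2.-tuple R -> \bar R, measurable_fun setT F -> (forall z, 0 <= F z)%E ->
  (\int[P]_x F (obs X t.+1 x) =
   \int[P]_x \int[G]_y F (extend (obs X t x) (f * filter t x + Num.sqrt PP * y)%R))%E.
Proof.
move=> J F mF F0.
have := joint_step J (F := F \o fst).
have mF1 : measurable_fun setT (F \o (fst : t.+2.-tuple R * R -> _)) by exact: measurableT_comp.
move=> /(_ mF1 (fun z => F0 _)) /= ->.
apply: eq_integral => x _; apply: eq_integral => y _.
rewrite integral_cst// -[RHS]mule1; congr (_ * _)%E; exact: probability_setT.
Qed.

Lemma kalman_law t : Jlaw t.
Proof.
elim: t => [|t IH] F mF F0.
  have := init_law (F := fun z => F (extend [tuple] z.1, z.2)).
  have mF' : measurable_fun setT (fun z : R * R => F (extend [tuple] z.1, z.2)).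
    apply: measurableT_comp => //; apply: measurable_fun_pair; last by measurability.
    by apply: measurable_extend; measurability.
  move=> /(_ mF' (fun z => F0 _)) /=.
  have obs0 x : obs X 0 x = extend [tuple] (X 0%N x).
    by apply: eq_from_tnth => i; rewrite (ord1 i) tnth_mktuple.
  move=> h; under eq_integral do rewrite obs0 /filter_err /filter/=.
  rewrite h; apply: eq_integral => x _; apply: eq_integral => z _.
  by rewrite obs0.
rewrite (joint_step IH mF F0).
pose F' o := (\int[G]_z F (o, (Num.sqrt gam * z)%R))%E.
have mF2 : measurable_fun setT (fun y : t.+2.-tuple R * R => F (y.1, Num.sqrt gam * y.2)).
  by apply: measurableT_comp => //; measurability.
have mF' : measurable_fun setT F'.
  exact: (@measurable_fun_fubini_tonelli_F _ _ _ _ _ G _ mF2 (fun z => F0 _)).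
have F'0 o : (0 <= F' o)%E by exact: integral_ge0.
by rewrite -(obs_law IH mF' F'0).
Qed.

End kalman_law.

(** * Conditional expectation given an independent centered error *)

Section conditional_expectation.
Context {R : realType} d (T : measurableType d) (P : probability T R).
Local Notation G := (std_normal R).

Lemma integrable_normal_id : G.-integrable setT (fun z => z%:E).
Proof. by have := @integrable_normalX R 1; under eq_fun do rewrite expr1. Qed.

Variables (dS : measure_display) (S : measurableType dS) (Z : T -> S) (e : T -> R) (s : R).
Hypotheses (mZ : measurable_fun setT Z) (me : measurable_fun setT e).
Hypothesis Zelaw : forall F : S * R -> \bar R, measurable_fun setT F ->
  (forall z, 0 <= F z)%E ->
  (\int[P]_x F (Z x, e x) = \int[P]_x \int[G]_z F (Z x, (s * z)%R))%E.

Let integrable_abs_normal : (\int[G]_z `|s * z|%:E < +oo)%E.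
Proof.
have /integrableP[_] := integrableZl measurableT s integrable_normal_id.
by under eq_integral do rewrite /=.
Qed.

Lemma integrable_indep_error : P.-integrable setT (EFin \o e).
Proof.
apply/integrableP; split; first exact/measurable_EFinP.
have := Zelaw (F := fun z => `|z.2|%:E).
have mF : measurable_fun setT (fun z : S * R => `|z.2|%:E).
  by apply/measurable_EFinP; apply: measurableT_comp.
move=> /(_ mF (fun z => normr_ge0 _)) /= ->.
rewrite integral_cst// lte_mul_pinfty//; first exact: integral_ge0.
  by rewrite ge0_fin_numE//; exact: integral_ge0.
by apply: le_lt_trans (probability_le1 P measurableT) _; rewrite ltry.
Qed.

(** [Zelaw] covers nonnegative functions, so |e| + e and |e| - e are compared: by symmetry of the
    normal law they have the same integral over each event of [Z]. *)
Lemma integral_indep_error C : measurable C ->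
  (\int[P]_(x in Z @^-1` C) (e x)%:E = 0)%E.
Proof.
move=> mC; set A := Z @^-1` C.
have mA : measurable A by rewrite -[A]setTI; exact: mZ.
have ie := integrable_indep_error.
have ieA : P.-integrable A (EFin \o e) by apply: integrableS ie.
have iaA : P.-integrable A (fun x => `|e x|%:E).
  by have := integrable_abse ieA; under eq_fun do rewrite /=.
have key (b : R) : `|b| = 1 -> (\int[P]_(x in A) (`|e x| + b * e x)%:E =
    \int[P]_x \int[G]_z (\1_C (Z x) * (`|s * z| + b * (s * z)))%:E)%E.
  move=> b1; have mF : measurable_fun setT (fun z : S * R => (\1_C z.1 * (`|z.2| + b * z.2))%:E).
    apply/measurable_EFinP; apply: measurable_funM; first exact: measurableT_comp.
    apply: measurable_funD; first exact: measurableT_comp.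
    exact: measurable_funM.
  have F0 (z : S * R) : (0 <= (\1_C z.1 * (`|z.2| + b * z.2))%:E)%E.
    rewrite lee_fin mulr_ge0// -lerBlDl sub0r lerNl -mulNr.
    by rewrite (le_trans (ler_norm _))// normrM normrN b1 mul1r.
  rewrite -(Zelaw mF F0) integral_mkcond; apply: eq_integral => x _.
  rewrite patchE indicE /A.
  rewrite (_ : (x \in Z @^-1` C) = (Z x \in C)); last by apply/idP/idP; rewrite !inE.
  by case: ifPn; rewrite ?mul1r ?mul0r.
have mg : measurable_fun setT (fun z : R => `|s * z|%:E).
  by apply/measurable_EFinP; apply: measurableT_comp => //; apply: measurable_funM.
have : (\int[P]_(x in A) (`|e x| + 1 * e x)%:E = \int[P]_(x in A) (`|e x| + (-1) * e x)%:E)%E.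
  rewrite (key _ (normr1 R)) (key _ (normrN1 R)); apply: eq_integral => x _.
  have mh : measurable_fun setT (fun z : R => (\1_C (Z x) * (`|s * z| + 1 * (s * z)))%:E).
    apply/measurable_EFinP; apply: measurable_funM; first exact: measurable_cst.
    apply: measurable_funD; first by apply: measurableT_comp => //; apply: measurable_funM.
    by apply: measurable_funM => //; apply: measurable_funM.
  rewrite -(normal_sym mh) ?[X in _ = X]/=; last first.
    move=> z; rewrite lee_fin mulr_ge0// mul1r -lerBlDl sub0r lerNl.
    by rewrite (le_trans (ler_norm _))// normrN.
  by apply: eq_integral => z _; rewrite !mulrN normrN mul1r mulN1r.
under eq_integral do rewrite mul1r EFinD.
under [RHS]eq_integral do rewrite mulN1r EFinD EFinN.
rewrite integralD// integralD//; last exact: integrableN.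
rewrite integralN; last exact: integrable_add_def.
have /fineK <- := integrable_fin_num mA ieA.
have /fineK <- := integrable_fin_num mA iaA.
rewrite -EFinN -!EFinD => -[] h; congr EFin.
set u := fine _ in h; set k := fine _ in h *; lra.
Qed.

Variables (h : S -> R) (Y M : T -> R).
Hypotheses (mh : measurable_fun setT h) (ih : P.-integrable setT (EFin \o (h \o Z))).
Hypothesis YE : forall x, Y x = h (Z x) + e x.

(** The difference [M - h (Z)] is measurable for the sigma-algebra of [Z] and integrates to 0 over
    each of its events, in particular over those where it is nonnegative and where it is negative.
    Any version [m] of the filter is thereby identified. *)
Lemma cond_exp_ae : is_cond_exp P (g_sigma_algebra_preimage Z) Y M ->
  {ae P, forall x, M x = h (Z x)}.
Proof.
case=> GM iM EM.
pose N x := M x - h (Z x).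
have GmM : measurable_fun setT (M : g_sigma_algebra_preimageType Z -> R).
  by move=> _ B mB; rewrite setTI; exact: GM.
have GmZ : measurable_fun setT (Z : g_sigma_algebra_preimageType Z -> S).
  by move=> _ B mB; exists B.
have GmN : measurable_fun setT (N : g_sigma_algebra_preimageType Z -> R).
  by apply: measurable_funB => //; exact: measurableT_comp.
have Gsub A : g_sigma_algebra_preimage Z A -> measurable A.
  by case=> B mB <-; exact: mZ.
have ihA A : measurable A -> P.-integrable A (EFin \o (h \o Z)) by move=> mA; exact: integrableS ih.
have iMA A : measurable A -> P.-integrable A (EFin \o M) by move=> mA; exact: integrableS iM.
have EN A : g_sigma_algebra_preimage Z A -> (\int[P]_(x in A) (N x)%:E = 0)%E.
  move=> GA; have mA := Gsub _ GA.
  under eq_integral do rewrite EFinB.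
  rewrite integralB//; [|exact: iMA|exact: ihA].
  rewrite EM//; case: GA => B mB; rewrite setTI => AE.
  have ieA : P.-integrable A (EFin \o e) by apply: integrableS integrable_indep_error.
  under [X in (X - _)%E]eq_integral do rewrite YE EFinD.
  rewrite integralD//; last exact: ihA.
  have -> : (\int[P]_(x in A) (e x)%:E = 0)%E by rewrite -AE; exact: integral_indep_error.
  rewrite adde0 subee//; exact: (integrable_fin_num mA (ihA _ mA)).
have iN : P.-integrable setT (EFin \o N).
  by have := integrableB measurableT iM ih; apply: eq_integrable.
have mN : measurable_fun setT N by have /integrableP[/measurable_EFinP] := iN.
pose A := [set x | 0 <= N x].
have GA : g_sigma_algebra_preimage Z A.
  have := GmN measurableT `[0, +oo[%classic (measurable_itv _).
  by rewrite setTI /preimage/=; under eq_set do rewrite in_itv/= andbT.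
have GCA : g_sigma_algebra_preimage Z (~` A).
  by have : measurable (~` (A : set (g_sigma_algebra_preimageType Z))) by exact: measurableC.
have mA := Gsub _ GA.
have abs0 : (\int[P]_x `|(N x)%:E| = 0)%E.
  rewrite -(setUv A) ge0_integral_setU//=; last first.
  - by apply/disj_setPS; rewrite setICr.
  - by apply/measurable_EFinP; apply: measurableT_comp => //; rewrite setUv.
  - exact: measurableC.
  have -> : (\int[P]_(x in A) `|N x|%:E = 0)%E.
    rewrite -(EN _ GA); apply: eq_integral => x; rewrite inE => Ax.
    by rewrite ger0_norm.
  rewrite add0e.
  have ENC := EN _ GCA.
  transitivity (\int[P]_(x in ~` A) - (N x)%:E)%E.
    apply: eq_integral => x; rewrite inE => /negP; rewrite -ltNge => Nx.
    by rewrite ltr0_norm.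
  have mCA : measurable (~` A) by exact: measurableC.
  have iNC : P.-integrable (~` A) (EFin \o N) by apply: integrableS iN.
  by rewrite integralN ?ENC ?oppe0//; exact: integrable_add_def.
have /(ae_eq_integral_abs P measurableT) : measurable_fun setT (EFin \o N) by exact/measurable_EFinP.
move=> -[+ _] => /(_ abs0) aeN.
apply: filterS aeN => x /(_ Logic.I) [/eqP].
by rewrite subr_eq0 => /eqP.
Qed.

End conditional_expectation.

(** * The initial pair: regression and residual *)

Section centered_gaussian.
Context {R : realType} d (T : measurableType d) (P : probability T R).
Local Notation G := (std_normal R).

Lemma normal_pdf_abs (s x : R) : normal_pdf 0 `|s| x = normal_pdf 0 s x.
Proof.
by rewrite /normal_pdf normr_eq0 /normal_peak /normal_fun real_normK// num_real.
Qed.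

(** The parameter s may be negative or zero: the density depends on |s| only, and at 0 the Dirac
    mass is the image of the normal law under z -> 0 z. *)
Lemma centered_normal_law (Z : T -> R) s : measurable_fun setT Z ->
  has_law P Z (centered_normal s) ->
  forall f : R -> \bar R, measurable_fun setT f -> (forall x, 0 <= f x)%E ->
  (\int[P]_x f (Z x) = \int[G]_z f (`|s| * z)%R)%E.
Proof.
move=> mZ lawZ f mf f0.
have mZ' : measurable_fun setT (Z : T -> measurableTypeR R) by exact: mZ.
have mf' : measurable_fun setT (f : measurableTypeR R -> \bar R) by exact: mf.
rewrite -(ge0_integral_image P mZ' mf' f0).
have [s0|s0] := eqVneq s 0.
  transitivity (\int[dirac (0%R : measurableTypeR R)]_y f y)%E.
    apply: eq_measure_integral => A mA _.
    by have := lawZ A mA; rewrite /centered_normal s0 eqxx.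
  rewrite integral_dirac// diracT mul1e s0 normr0.
  under eq_integral do rewrite mul0r.
  rewrite integral_cst// -[LHS]mule1; congr (_ * _)%E.
  exact/esym/probability_setT.
have s1 : 0 < `|s| by rewrite normr_gt0.
transitivity (\int[normal_prob 0 `|s|]_y f y)%E.
  apply: eq_measure_integral => A mA _.
  transitivity (normal_prob 0 s A).
    by have := lawZ A mA; rewrite /centered_normal (negbTE s0).
  by apply: eq_integral => x _; rewrite normal_pdf_abs.
rewrite ge0_integral_normal//.
by under eq_integral do rewrite add0r.
Qed.

Variables (X Y : T -> R) (dx dy rho : R).
Hypotheses (mX : measurable_fun setT X) (mY : measurable_fun setT Y).
Hypothesis XY : centered_gaussian_pair P X Y.
Hypothesis VX : ('V_P[X] = (dx ^+ 2)%:E)%E.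
Hypothesis VY : ('V_P[Y] = (dy ^+ 2)%:E)%E.
Hypothesis EXY : ('E_P[(fun x => X x * Y x)%R] = rho%:E)%E.

Let ridge_sd (u v : R) : {s : R | 0 <= s & forall f : R -> \bar R, measurable_fun setT f ->
  (forall x, 0 <= f x)%E ->
  (\int[P]_x f (u * X x + v * Y x)%R = \int[G]_z f (s * z)%R)%E}.
Proof.
have [s lawS] := cid (XY u v); exists `|s| => // f mf f0.
rewrite -(centered_normal_law _ lawS mf f0)//.
by apply: measurable_funD; exact: measurable_funM.
Qed.

Lemma integral_normal_sq (s : R) : (\int[G]_z ((s * z) ^+ 2)%:E = (s ^+ 2)%:E)%E.
Proof.
have := @integral_normal_poly6 R 0 0 (s ^+ 2) 0 0 0 0.
rewrite !mulr0 !addr0 add0r => <-; apply: eq_integral => z _; congr EFin; ring.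
Qed.

Let ridge_sq u v : (\int[P]_x ((u * X x + v * Y x) ^+ 2)%:E = ((s2val (ridge_sd u v)) ^+ 2)%:E)%E.
Proof.
case: (ridge_sd u v) => s s0 /= lawS.
have mq : measurable_fun setT (fun z : R => (z ^+ 2)%:E) by measurability.
rewrite (lawS (fun z => (z ^+ 2)%:E) mq) ?integral_normal_sq//.
by move=> z; rewrite lee_fin sqr_ge0.
Qed.

Lemma integrable_sq_ridge u v : P.-integrable setT (fun x => ((u * X x + v * Y x) ^+ 2)%:E).
Proof.
apply/integrableP; split; first by measurability.
under eq_integral do rewrite /= ger0_norm ?sqr_ge0//.
by rewrite ridge_sq ltry.
Qed.

Lemma integral_ridge0 u v : P.-integrable setT (EFin \o (fun x => u * X x + v * Y x)) /\
  (\int[P]_x (u * X x + v * Y x)%:E = 0)%E.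
Proof.
have [s s0 lawS] := ridge_sd u v.
have mS : measurable_fun setT (fun x => u * X x + v * Y x).
  by apply: measurable_funD; exact: measurable_funM.
(* Conditioning on a one-point space turns [integral_indep_error] into the vanishing of the mean. *)
have law (F : unit * R -> \bar R) : measurable_fun setT F -> (forall z, 0 <= F z)%E ->
  (\int[P]_x F (tt, (u * X x + v * Y x)%R) = \int[P]_x \int[G]_z F (tt, (s * z)%R))%E.
  move=> mF F0; have mF' : measurable_fun setT (fun z => F (tt, z)) by exact: measurableT_comp.
  rewrite (lawS (fun z => F (tt, z)) mF' (fun z => F0 _)).
  rewrite integral_cst// -[LHS]mule1; congr (_ * _)%E; exact/esym/probability_setT.
have mtt : measurable_fun setT (fun _ : T => tt) by exact: measurable_cst.
split; first exact: (integrable_indep_error mS law).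
have := integral_indep_error mtt mS law measurableT.
by rewrite preimage_setT.
Qed.

Let EX0 : P.-integrable setT (EFin \o X) /\ (\int[P]_x (X x)%:E = 0)%E.
Proof.
have [i1 e1] := integral_ridge0 1 0; split.
  by apply: eq_integrable i1 => // x _; rewrite /= mul1r mul0r addr0.
by rewrite -e1; apply: eq_integral => x _; rewrite mul1r mul0r addr0.
Qed.

Let EY0 : P.-integrable setT (EFin \o Y) /\ (\int[P]_x (Y x)%:E = 0)%E.
Proof.
have [i1 e1] := integral_ridge0 0 1; split.
  by apply: eq_integrable i1 => // x _; rewrite /= mul1r mul0r add0r.
by rewrite -e1; apply: eq_integral => x _; rewrite mul1r mul0r add0r.
Qed.

Lemma integrable_initial_state : P.-integrable setT (EFin \o Y).
Proof. exact: EY0.1. Qed.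

Let EX2 : P.-integrable setT (fun x => (X x ^+ 2)%:E) /\ (\int[P]_x (X x ^+ 2)%:E = (dx ^+ 2)%:E)%E.
Proof.
split.
  by apply: eq_integrable (integrable_sq_ridge 1 0) => // x _; rewrite /= mul1r mul0r addr0.
rewrite -VX /variance unlock unlock (_ : (\int[P]_w (X w)%:E)%E = 0%E); last exact: EX0.2.
by apply: eq_integral => x _; rewrite -[in RHS]/((X x - 0) * (X x - 0))%:E subr0 expr2.
Qed.

Let EY2 : P.-integrable setT (fun x => (Y x ^+ 2)%:E) /\ (\int[P]_x (Y x ^+ 2)%:E = (dy ^+ 2)%:E)%E.
Proof.
split.
  by apply: eq_integrable (integrable_sq_ridge 0 1) => // x _; rewrite /= mul1r mul0r add0r.
rewrite -VY /variance unlock unlock (_ : (\int[P]_w (Y w)%:E)%E = 0%E); last exact: EY0.2.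
by apply: eq_integral => x _; rewrite -[in RHS]/((Y x - 0) * (Y x - 0))%:E subr0 expr2.
Qed.

Let EXYi : P.-integrable setT (fun x => (X x * Y x)%:E).
Proof.
have i1 := integrableD measurableT (integrable_sq_ridge 1 0) (integrable_sq_ridge 0 1).
apply: le_integrable i1 => //.
  by apply/measurable_EFinP; exact: measurable_funM.
move=> x _; rewrite /= lee_fin !mul1r !mul0r addr0 add0r [leRHS]ger0_norm ?addr_ge0 ?sqr_ge0//.
rewrite ler_norml; apply/andP; split; nra.
Qed.

Let ridge_var u v : (s2val (ridge_sd u v)) ^+ 2 = u ^+ 2 * dx ^+ 2 + 2 * u * v * rho + v ^+ 2 * dy ^+ 2.
Proof.
apply: EFin_inj; rewrite -ridge_sq.
have iX := integrableZl measurableT (u ^+ 2) EX2.1.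
have iY := integrableZl measurableT (v ^+ 2) EY2.1.
have iXY := integrableZl measurableT (2 * u * v) EXYi.
transitivity (\int[P]_x (((u ^+ 2)%:E * (X x ^+ 2)%:E + (2 * u * v)%:E * (X x * Y x)%:E)
    + (v ^+ 2)%:E * (Y x ^+ 2)%:E))%E.
  by apply: eq_integral => x _; rewrite -!EFinM -!EFinD; congr EFin; ring.
rewrite integralD//; last exact: integrableD.
rewrite integralD// !integralZl//; [|exact: EY2.1|exact: EX2.1].
rewrite EX2.2 EY2.2.
by have := EXY; rewrite unlock => ->; rewrite -!EFinM -!EFinD.
Qed.

Local Notation c := (rho / dx ^+ 2).

(* This includes dx = 0, where c = rho / 0 = 0. *)
Lemma regression_coefE : c * dx ^+ 2 = rho.
Proof.
have [dx0|dx0] := eqVneq dx 0; last by rewrite divfK// expf_neq0.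
rewrite dx0 expr0n mulr0; apply/esym/eqP; apply: contraT => rho0.
have h (u : R) : 0 <= 2 * u * rho + dy ^+ 2.
  have := sqr_ge0 (s2val (ridge_sd u 1)); by rewrite ridge_var dx0 expr0n mulr0 add0r mulr1 expr1n mul1r.
(* For dx = 0 the variance of u X + Y is affine in u; unless rho = 0 it takes the value -1 here. *)
have := h (- (dy ^+ 2 + 1) / (2 * rho)).
have -> : 2 * (- (dy ^+ 2 + 1) / (2 * rho)) * rho + dy ^+ 2 = -1 by field.
by rewrite lerNr oppr0 ler10.
Qed.

Lemma resid_var_ge0 : 0 <= dy ^+ 2 - c * rho.
Proof.
have := sqr_ge0 (s2val (ridge_sd (- c) 1)); rewrite ridge_var.
have := regression_coefE; set k := c; clearbody k => <- h.
by apply: le_trans h _; rewrite le_eqVlt; apply/orP; left; apply/eqP; ring.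
Qed.

(** A ridge of (X, Y - c X) is a ridge of (X, Y), and its variance has no cross term because c dx^2
    = rho; [gaussian_pair_law] then gives independence. *)
Lemma initial_law : forall F : R * R -> \bar R, measurable_fun setT F ->
  (forall z, 0 <= F z)%E ->
  (\int[P]_x F (X x, (Y x - c * X x)%R) =
   \int[G]_x \int[G]_z F ((dx * x)%R, (Num.sqrt (dy ^+ 2 - c * rho) * z)%R))%E.
Proof.
apply: gaussian_pair_law => //.
  by apply: measurable_funB => //; exact: measurable_funM.
move=> u v; case E : (ridge_sd (u - v * c) v) => [s s0 lawS]; exists s.
  have := ridge_var (u - v * c) v; rewrite E /= => ->.
  move: resid_var_ge0 => /sqr_sqrtr; rewrite !exprMn => ->.
  by have := regression_coefE; set k := c; clearbody k => <-; ring.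
move=> g mg g0; rewrite -(lawS g mg g0); apply: eq_integral => x _; congr g.
by ring.
Qed.

End centered_gaussian.

(** * The model under a fixed parameter *)

Section model_at_parameter.
Context {R : realType} d (T : measurableType d) (P : probability T R).
Variables (f a sigma dx dy rho th gam : R).
Variables (X Y w v : nat -> {mfun T >-> R}).
Hypothesis model : hidden_ar_model f a sigma dx dy rho th P X Y w v.
Local Notation G := (std_normal R).
Local Notation c := (rho / dx ^+ 2).

Let XE t x : X t.+1 x = f * Y t x + sigma * w t.+1 x. Proof. by case: model. Qed.
Let YE t x : Y t.+1 x = a * Y t x + th * v t.+1 x. Proof. by case: model. Qed.
Let laww t B : measurable B -> P (w t.+1 @^-1` B) = G B.
Proof. by case: model => _ _ /(_ t)[+ _] _ _ mB => ->//; rewrite unlock. Qed.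
Let lawv t B : measurable B -> P (v t.+1 @^-1` B) = G B.
Proof. by case: model => _ _ /(_ t)[_ +] _ _ mB => ->//; rewrite unlock. Qed.
Let mX t : measurable_fun setT (X t). Proof. exact: measurable_funPT. Qed.
Let mY t : measurable_fun setT (Y t). Proof. exact: measurable_funPT. Qed.
Let mw t : measurable_fun setT (w t). Proof. exact: measurable_funPT. Qed.
Let mv t : measurable_fun setT (v t). Proof. exact: measurable_funPT. Qed.
Let XY0 : centered_gaussian_pair P (X 0%N) (Y 0%N). Proof. by case: model => _ _ _ _ []. Qed.
Let VX0 : ('V_P[X 0%N] = (dx ^+ 2)%:E)%E. Proof. by case: model => _ _ _ _ []. Qed.
Let VY0 : ('V_P[Y 0%N] = (dy ^+ 2)%:E)%E. Proof. by case: model => _ _ _ _ []. Qed.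
Let EXY0 : ('E_P[(fun x => X 0%N x * Y 0%N x)%R] = rho%:E)%E. Proof. by case: model => _ _ _ _ []. Qed.

Local Notation Fam := (model_sigma_algebras X Y w v).

Let mXY0 : measurable_fun setT (fun x => (X 0%N x, Y 0%N x)).
Proof. exact: measurable_fun_pair. Qed.

Let measurableF i A : Fam i A -> measurable A.
Proof. by case: i => [u|[t|t]] /= [B mB <-]; [exact: mXY0|exact: mw|exact: mv]. Qed.

Let Fw t B : measurable B -> Fam (inr (inl t)) (w t.+1 @^-1` B).
Proof. by move=> mB; exists B => //; rewrite setTI. Qed.

Let Fv t B : measurable B -> Fam (inr (inr t)) (v t.+1 @^-1` B).
Proof. by move=> mB; exists B => //; rewrite setTI. Qed.

Let init_indep : indep_from P Fam (fun x => (X 0%N x, Y 0%N x)) (future 0).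
Proof.
move=> l E C ul lJ lF mC.
have i0l : inl tt \notin l by apply/negP => /lJ.
pose E' j := if j == inl tt then (fun x => (X 0%N x, Y 0%N x)) @^-1` C else E j.
have E'l : {in l, E' =1 E}.
  by move=> j jl; rewrite /E'; case: eqP => // ji0; rewrite -ji0 jl in i0l.
case: model => _ _ _ /(_ (inl tt :: l) E') + _.
rewrite -/(events _ _) events_cons (eq_events E'l) big_cons [E' _]/= => ->.
- by congr (_ * _)%E; apply: eq_big_seq => j jl; rewrite E'l.
- by rewrite /= i0l.
- move=> j; rewrite in_cons => /predU1P[->|jl].
    by exists C => //; rewrite setTI.
  by rewrite E'l//; exact: lF.
Qed.

Lemma model_initial_law (F : R * R -> \bar R) : measurable_fun setT F -> (forall z, 0 <= F z)%E ->
  (\int[P]_x F (X 0%N x, (Y 0%N x - c * X 0%N x)%R) =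
   \int[P]_x \int[G]_z F (X 0%N x, (Num.sqrt (dy ^+ 2 - c * rho) * z)%R))%E.
Proof.
move=> mF F0; set s := Num.sqrt _.
have mF3 : measurable_fun setT (fun y : (R * R) * R => F (y.1.1, s * y.2)).
  by apply: measurableT_comp => //; measurability.
pose H (y : R * R) := (\int[G]_z F (y.1, s * z)%R)%E.
have mH : measurable_fun setT H.
  exact: (@measurable_fun_fubini_tonelli_F _ _ _ _ _ G _ mF3 (fun y => F0 _)).
have H0 y : (0 <= H y)%E by exact: integral_ge0.
rewrite -[RHS]/(\int[P]_x H (X 0%N x, (Y 0%N x - c * X 0%N x)%R))%E.
rewrite (initial_law (mX 0) (mY 0) XY0 VX0 VY0 EXY0 mF F0).
rewrite (initial_law (mX 0) (mY 0) XY0 VX0 VY0 EXY0 mH H0).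
apply: eq_integral => x _; rewrite /H /= integral_cst// -[LHS]mule1; congr (_ * _)%E.
exact/esym/probability_setT.
Qed.

Lemma obs0_law (F : 1.-tuple R -> \bar R) : measurable_fun setT F -> (forall z, 0 <= F z)%E ->
  (\int[P]_x F (obs X 0 x) = \int[G]_z F [tuple (dx * z)%R])%E.
Proof.
move=> mF F0.
have mF2 : measurable_fun setT (fun y : R * R => F (extend [tuple] y.1)).
  by apply: measurableT_comp => //; apply: measurable_extend; measurability.
have := initial_law (mX 0) (mY 0) XY0 VX0 VY0 EXY0 mF2 (fun y => F0 _).
rewrite (_ : (\int[P]_x F (obs X 0 x) = \int[P]_x F (extend [tuple] (X 0%N x)))%E); last first.
  apply: eq_integral => x _; congr F; apply: eq_from_tnth => i.
  by rewrite (ord1 i) tnth_mktuple.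
move=> ->; apply: eq_integral => x _.
rewrite /= integral_cst// -[RHS]mule1; congr (F _ * _)%E; last exact/probability_setT.
by apply: val_inj.
Qed.

Variable m : nat -> T -> R.
Hypothesis hm : forall t, is_cond_exp P (g_sigma_algebra_preimage (obs X t)) (Y t) (m t).
Hypothesis hgamma : ('E_P[(fun x => (Y 0%N x - m 0%N x) ^+ 2)%R] = gam%:E)%E.

Let lf t (o : t.+1.-tuple R) := linear_filter c (a * sigma ^+ 2 / (sigma ^+ 2 + f ^+ 2 * gam))
  (a * f * gam / (sigma ^+ 2 + f ^+ 2 * gam)) t (nth 0 o).

Let filterE t x : filter X a f sigma gam c t x = lf (obs X t x).
Proof. by apply: eq_linear_filter => i it; rewrite nth_obs. Qed.

Let m0E : {ae P, forall x, m 0%N x = c * X 0%N x}.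
Proof.
have mobs : measurable_fun setT (obs X 0) by exact: measurable_obs.
have me : measurable_fun setT (fun x => Y 0%N x - c * X 0%N x).
  by apply: measurable_funB => //; exact: measurable_funM.
have law (F : 1.-tuple R * R -> \bar R) : measurable_fun setT F -> (forall z, 0 <= F z)%E ->
  (\int[P]_x F (obs X 0 x, (Y 0%N x - c * X 0%N x)%R) =
   \int[P]_x \int[G]_z F (obs X 0 x, (Num.sqrt (dy ^+ 2 - c * rho) * z)%R))%E.
  move=> mF F0.
  have obsE x : obs X 0 x = extend [tuple] (X 0%N x).
    by apply: eq_from_tnth => i; rewrite (ord1 i) tnth_mktuple.
  have mF2 : measurable_fun setT (fun y : R * R => F (extend [tuple] y.1, y.2)).
    apply: measurableT_comp => //; apply: measurable_fun_pair; last by measurability.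
    by apply: measurable_extend; measurability.
  have := model_initial_law mF2 (fun y => F0 _).
  move=> E; apply: etrans (etrans _ E) _.
    by apply: eq_integral => x _; rewrite obsE.
  apply: eq_integral => x _; apply: eq_integral => z _.
  by rewrite obsE.
pose h (o : 1.-tuple R) := c * nth 0 o 0.
have mh : measurable_fun setT h.
  by apply: measurable_funM => //; exact: measurable_nth_tuple.
have hE x : h (obs X 0 x) = c * X 0%N x by rewrite /h nth_obs.
have [iX _] := integral_ridge0 (mX 0) (mY 0) XY0 c 0.
have ih : P.-integrable setT (EFin \o (h \o obs X 0)).
  apply: eq_integrable iX => // x _ /=.
  by rewrite -hE /h mul0r addr0.
have YhE x : Y 0%N x = h (obs X 0 x) + (Y 0%N x - c * X 0%N x) by rewrite hE; ring.
have := cond_exp_ae mobs me law mh ih YhE (hm 0).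
by apply: filterS => x ->.
Qed.

(** Since m_0 is almost surely the linear regression c X_0, the assumed initial error variance is
    the residual variance. This algebraic relation starts the filter in its stationary regime and
    later makes c differentiable. *)
Lemma initial_error_var : gam = dy ^+ 2 - c * rho.
Proof.
apply: EFin_inj; rewrite -hgamma unlock.
have mm0 : measurable_fun setT (m 0%N).
  by case: (hm 0) => _ /integrableP[/measurable_EFinP].
have mq : measurable_fun setT (fun y : R * R => (y.2 ^+ 2)%:E) by measurability.
have me : measurable_fun setT (fun x => Y 0%N x - c * X 0%N x).
  by apply: measurable_funB => //; exact: measurable_funM.
transitivity (\int[P]_x (((Y 0%N x - c * X 0%N x) ^+ 2)%R)%:E)%E.
  apply: ae_eq_integral => //.
  - apply/measurable_EFinP; apply: measurable_fun_pow.
    exact: measurable_funB.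
  - by apply/measurable_EFinP; apply: measurable_fun_pow.
  - by apply: filterS m0E => x mE _; rewrite mE.
have := model_initial_law mq; rewrite /= => ->; last by move=> y; rewrite lee_fin sqr_ge0.
under eq_integral do rewrite integral_normal_sq.
rewrite integral_prob_cst sqr_sqrtr//.
exact: (resid_var_ge0 (mX 0) (mY 0) XY0 VX0 VY0 EXY0).
Qed.

Hypotheses (sigma0 : sigma != 0) (th0 : th != 0) (gam0 : 0 < gam).
Hypothesis riccati : gam = th ^+ 2 + a ^+ 2 * sigma ^+ 2 * gam / (sigma ^+ 2 + f ^+ 2 * gam).

Let init_law (F : R * R -> \bar R) : measurable_fun setT F -> (forall z, 0 <= F z)%E ->
  (\int[P]_x F (X 0%N x, (Y 0%N x - c * X 0%N x)%R) =
   \int[P]_x \int[G]_z F (X 0%N x, (Num.sqrt gam * z)%R))%E.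
Proof. by move=> mF F0; rewrite {1}initial_error_var; exact: model_initial_law. Qed.

Let law t := kalman_law mX mY mw mv XE YE sigma0 th0 gam0 riccati measurableF Fw Fv laww lawv
  init_indep init_law (t := t).

Lemma model_obs_law t (F : t.+2.-tuple R -> \bar R) :
  measurable_fun setT F -> (forall z, 0 <= F z)%E ->
  (\int[P]_x F (obs X t.+1 x) =
   \int[P]_x \int[G]_y F (extend (obs X t x)
     (f * lf (obs X t x) + Num.sqrt (sigma ^+ 2 + f ^+ 2 * gam) * y)%R))%E.
Proof.
move=> mF F0.
apply: etrans (obs_law mX mY mw mv XE YE sigma0 th0 gam0 riccati measurableF Fw Fv laww lawv
  init_indep (@law t) mF F0) _.
by apply: eq_integral => x _; apply: eq_integral => y _; rewrite filterE.
Qed.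

Let integrable_noise t : P.-integrable setT (EFin \o v t.+1).
Proof.
apply/integrableP; split; first exact/measurable_EFinP.
have mv' : measurable_fun setT (v t.+1 : T -> measurableTypeR R) by exact: mv.
have mabs : measurable_fun setT (fun x : measurableTypeR R => `|x|%:E).
  by have /integrableP[] := integrable_abse (@integrable_normal_id R).
have := ge0_integral_image P mv' mabs (fun x => normr_ge0 _).
rewrite /= => <-.
rewrite (_ : (\int[_]_y _)%E = (\int[G]_y `|y|%:E)%E).
  by have /integrableP[_] := @integrable_normal_id R.
apply: eq_measure_integral => B mB _; exact: lawv.
Qed.

Let integrable_state t : P.-integrable setT (EFin \o Y t).
Proof.
elim: t => [|t IH]; first exact: (integrable_initial_state (mX 0) (mY 0) XY0).
have iY := integrableZl measurableT a IH.
have iv := integrableZl measurableT th (integrable_noise t).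
apply: eq_integrable (integrableD measurableT iY iv) => // x _ /=.
by rewrite YE.
Qed.

Lemma cond_exp_filter t : {ae P, forall x, m t x = lf (obs X t x)}.
Proof.
have mobs : measurable_fun setT (obs X t) by exact: measurable_obs.
have mfil := measurable_filter a f sigma gam c mX t.
have me : measurable_fun setT (filter_err X Y a f sigma gam c t).
  by apply: measurable_funB => //; exact: mfil.
have ie := integrable_indep_error me (@law t).
have mlf : measurable_fun setT (@lf t) by exact: measurable_linear_filter.
have ih : P.-integrable setT (EFin \o (@lf t \o obs X t)).
  apply: eq_integrable (integrableB measurableT (integrable_state t) ie) => // x _ /=.
  by rewrite -EFinB -filterE /filter_err; congr EFin; ring.
have YhE x : Y t x = @lf t (obs X t x) + filter_err X Y a f sigma gam c t x.
  by rewrite -filterE /filter_err; ring.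
by have := cond_exp_ae mobs me (@law t) mlf ih YhE (hm t).
Qed.

End model_at_parameter.

(** * Moments of the filter, its sensitivity and the score *)

(* The suffixes 1 and 2 mark the first two derivatives in the parameter; cP is
   the variance of the innovations, cc the coefficient of X_0 in m_0. *)
Record coefs (R : Type) := Coefs {
  cA : R; cB : R; cB1 : R; cB2 : R; cc : R; cc1 : R; cc2 : R; cP : R; cP1 : R }.
Arguments cA {R} _.
Arguments cB {R} _.
Arguments cB1 {R} _.
Arguments cB2 {R} _.
Arguments cc {R} _.
Arguments cc1 {R} _.
Arguments cc2 {R} _.
Arguments cP {R} _.
Arguments cP1 {R} _.

Section filters.
Context {R : realType}.
Variables (f : R) (j : coefs R).

Fixpoint filter0 t (x : nat -> R) : R :=
  if t is s.+1 then cA j * filter0 s x + cB j * x t else cc j * x 0%N.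

Lemma filter0E t x : filter0 t x = linear_filter (cc j) (cA j) (cB j) t x.
Proof. by elim: t => //= t ->. Qed.

(* filter1 and filter2 are the first two parameter derivatives of filter0, and
   score is that of loglik, the log-likelihood up to a parameter-free term. *)
Fixpoint filter1 t (x : nat -> R) : R :=
  if t is s.+1 then cA j * filter1 s x + cB1 j * (x t - f * filter0 s x) else cc1 j * x 0%N.

Fixpoint filter2 t (x : nat -> R) : R :=
  if t is s.+1 then
    cA j * filter2 s x - 2 * f * cB1 j * filter1 s x + cB2 j * (x t - f * filter0 s x)
  else cc2 j * x 0%N.

Fixpoint loglik t (x : nat -> R) : R :=
  if t is s.+1 then loglik s x - ln (cP j) / 2 - (x t - f * filter0 s x) ^+ 2 / (2 * cP j)
  else 0.

Fixpoint score t (x : nat -> R) : R :=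
  if t is s.+1 then
    score s x + cP1 j / (2 * cP j) * ((x t - f * filter0 s x) ^+ 2 / cP j - 1)
    + f / cP j * filter1 s x * (x t - f * filter0 s x)
  else 0.

Section extensionality.
Variables (x y : nat -> R).

Lemma eq_filter0 t : (forall i, (i <= t)%N -> x i = y i) -> filter0 t x = filter0 t y.
Proof.
elim: t => [|t IH] xy /=; first by rewrite xy.
by rewrite IH ?xy// => i it; rewrite xy// leqW.
Qed.

Lemma eq_filter1 t : (forall i, (i <= t)%N -> x i = y i) -> filter1 t x = filter1 t y.
Proof.
elim: t => [|t IH] xy /=; first by rewrite xy.
have xy' i : (i <= t)%N -> x i = y i by move=> it; rewrite xy// leqW.
by rewrite IH// xy// (eq_filter0 xy').
Qed.

Lemma eq_filter2 t : (forall i, (i <= t)%N -> x i = y i) -> filter2 t x = filter2 t y.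
Proof.
elim: t => [|t IH] xy /=; first by rewrite xy.
have xy' i : (i <= t)%N -> x i = y i by move=> it; rewrite xy// leqW.
by rewrite IH// xy// (eq_filter0 xy') (eq_filter1 xy').
Qed.

Lemma eq_loglik t : (forall i, (i <= t)%N -> x i = y i) -> loglik t x = loglik t y.
Proof.
elim: t => [|t IH] xy //=.
have xy' i : (i <= t)%N -> x i = y i by move=> it; rewrite xy// leqW.
by rewrite IH// xy// (eq_filter0 xy').
Qed.

Lemma eq_score t : (forall i, (i <= t)%N -> x i = y i) -> score t x = score t y.
Proof.
elim: t => [|t IH] xy //=.
have xy' i : (i <= t)%N -> x i = y i by move=> it; rewrite xy// leqW.
by rewrite IH// xy// (eq_filter0 xy') (eq_filter1 xy').
Qed.

End extensionality.
End filters.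

(** * Joint measurability in the parameter and the path *)

Section joint_measurability.
Context {R : realType} d (T : measurableType d) (f : R) (j : T -> coefs R) (x : nat -> T -> R).
Hypotheses (mA : measurable_fun setT (fun y => cA (j y))) (mB : measurable_fun setT (fun y => cB (j y)))
  (mB1 : measurable_fun setT (fun y => cB1 (j y))) (mB2 : measurable_fun setT (fun y => cB2 (j y)))
  (mc : measurable_fun setT (fun y => cc (j y))) (mc1 : measurable_fun setT (fun y => cc1 (j y)))
  (mc2 : measurable_fun setT (fun y => cc2 (j y)))
  (mlnP : measurable_fun setT (fun y => ln (cP (j y))))
  (mPV : measurable_fun setT (fun y => (cP (j y))^-1))
  (mP1 : measurable_fun setT (fun y => cP1 (j y))).
Hypothesis mx : forall i, measurable_fun setT (x i).

(** The coefficients vary with the point of [T], so that these lemmas serve a fixed parameter as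
    well as the pair formed by the parameter and the outcome. *)
Lemma measurable_filter0 t : measurable_fun setT (fun y => filter0 (j y) t (x^~ y)).
Proof.
elim: t => [|t IH] /=; first exact: measurable_funM.
by apply: measurable_funD; exact: measurable_funM.
Qed.

Let measurable_innovation t : measurable_fun setT (fun y => x t.+1 y - f * filter0 (j y) t (x^~ y)).
Proof.
by apply: measurable_funB => //; apply: measurable_funM => //; exact: measurable_filter0.
Qed.

Lemma measurable_filter1 t : measurable_fun setT (fun y => filter1 f (j y) t (x^~ y)).
Proof.
elim: t => [|t IH] /=; first exact: measurable_funM.
by apply: measurable_funD; apply: measurable_funM => //; exact: measurable_innovation.
Qed.

Lemma measurable_filter2 t : measurable_fun setT (fun y => filter2 f (j y) t (x^~ y)).
Proof.
elim: t => [|t IH] /=; first exact: measurable_funM.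
apply: measurable_funD; last by apply: measurable_funM => //; exact: measurable_innovation.
apply: measurable_funB; first exact: measurable_funM.
by apply: measurable_funM; [exact: measurable_funM|exact: measurable_filter1].
Qed.

Lemma measurable_loglik t : measurable_fun setT (fun y => loglik f (j y) t (x^~ y)).
Proof.
elim: t => [|t IH] /=; first exact: measurable_cst.
apply: measurable_funB; first by apply: measurable_funB => //; exact: measurable_funM.
apply: measurable_funM; first by apply: measurable_fun_pow; exact: measurable_innovation.
under eq_fun do rewrite invfM.
exact: measurable_funM.
Qed.

Lemma measurable_score t : measurable_fun setT (fun y => score f (j y) t (x^~ y)).
Proof.
elim: t => [|t IH] /=; first exact: measurable_cst.
apply: measurable_funD; last first.
  apply: measurable_funM; last exact: measurable_innovation.
  by apply: measurable_funM; [exact: measurable_funM|exact: measurable_filter1].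
apply: measurable_funD => //; apply: measurable_funM.
  apply: measurable_funM => //.
  rewrite (_ : (fun y => _) = fun y => 2^-1 * (cP (j y))^-1); first exact: measurable_funM.
  by apply/funext => y; rewrite invfM.
apply: measurable_funB => //; apply: measurable_funM => //.
by apply: measurable_fun_pow; exact: measurable_innovation.
Qed.

End joint_measurability.

Ltac nonneg := repeat (first [ assumption | exact: ler01 | exact: ler0n | exact: sqr_ge0
  | by apply: exprn_even_ge0 | apply: ltW; assumption
  | apply: mulr_ge0 | apply: addr_ge0 | rewrite invr_ge0 | apply: exprn_ge0 ]).

Section affine_recursion.
Context {R : realType}.

(** The bound is preserved by x -> k x + g. Values are extended reals, so the induction itself
    establishes that the moments are finite. *)
Lemma affine_recursion_le (u : nat -> \bar R) (k g u0 : R) :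
  (forall t, 0 <= u t)%E -> 0 <= k < 1 -> 0 <= g -> 0 <= u0 ->
  (u 0%N <= u0%:E)%E -> (forall t, u t.+1 <= k%:E * u t + g%:E)%E ->
  forall t, (u t <= (u0 + g / (1 - k))%:E)%E.
Proof.
move=> uge /andP[k0 k1] g0 u00 uu0 us; have k1' : 0 < 1 - k by rewrite subr_gt0.
elim=> [|t IH].
  by apply: le_trans uu0 _; rewrite lee_fin lerDl divr_ge0// ltW.
apply: le_trans (us t) _.
apply: (@le_trans _ _ (k%:E * (u0 + g / (1 - k))%:E + g%:E))%E.
  by apply: leeD2r; apply: lee_wpmul2l => //; rewrite lee_fin.
rewrite -EFinM -EFinD lee_fin.
have -> : k * (u0 + g / (1 - k)) + g = k * u0 + g / (1 - k).
  by field; rewrite gt_eqF.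
by rewrite lerD2r ler_piMl// ltW.
Qed.

End affine_recursion.

Section nonneg_integral.
Context {R : realType} d (T : measurableType d) (P : probability T R).

Lemma integral_lin2 (k0 k1 k2 : R) (g1 g2 : T -> R) : 0 <= k0 -> 0 <= k1 -> 0 <= k2 ->
  measurable_fun setT g1 -> measurable_fun setT g2 ->
  (forall x, 0 <= g1 x) -> (forall x, 0 <= g2 x) ->
  (\int[P]_x (k0 + k1 * g1 x + k2 * g2 x)%:E =
   k0%:E + k1%:E * \int[P]_x (g1 x)%:E + k2%:E * \int[P]_x (g2 x)%:E)%E.
Proof.
move=> k00 k10 k20 mg1 mg2 g10 g20.
have m1 : measurable_fun setT (fun x => (k1 * g1 x)%:E).
  by apply/measurable_EFinP; exact: measurable_funM.
have m2 : measurable_fun setT (fun x => (k2 * g2 x)%:E).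
  by apply/measurable_EFinP; exact: measurable_funM.
have m01 : measurable_fun setT (fun x => (k0 + k1 * g1 x)%:E).
  by apply/measurable_EFinP; apply: measurable_funD => //; exact: measurable_funM.
under eq_integral do rewrite EFinD.
rewrite ge0_integralD//; last 2 first.
- by move=> x _; rewrite lee_fin addr_ge0// mulr_ge0.
- by move=> x _; rewrite lee_fin mulr_ge0.
under [X in (X + _)%E]eq_integral do rewrite EFinD.
rewrite ge0_integralD//; last by move=> x _; rewrite lee_fin mulr_ge0.
under [X in (_ + X + _)%E]eq_integral do rewrite EFinM.
under [X in (_ + _ + X)%E]eq_integral do rewrite EFinM.
rewrite ge0_integralZl//; last 2 first.
- exact/measurable_EFinP.
- by move=> x _; rewrite lee_fin.
rewrite ge0_integralZl//; last 2 first.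
- exact/measurable_EFinP.
- by move=> x _; rewrite lee_fin.
by rewrite integral_prob_cst.
Qed.

Lemma integral_lin3 (k0 k1 k2 k3 : R) (g1 g2 g3 : T -> R) :
  0 <= k0 -> 0 <= k1 -> 0 <= k2 -> 0 <= k3 ->
  measurable_fun setT g1 -> measurable_fun setT g2 -> measurable_fun setT g3 ->
  (forall x, 0 <= g1 x) -> (forall x, 0 <= g2 x) -> (forall x, 0 <= g3 x) ->
  (\int[P]_x (k0 + k1 * g1 x + k2 * g2 x + k3 * g3 x)%:E =
   k0%:E + k1%:E * \int[P]_x (g1 x)%:E + k2%:E * \int[P]_x (g2 x)%:E
   + k3%:E * \int[P]_x (g3 x)%:E)%E.
Proof.
move=> k00 k10 k20 k30 mg1 mg2 mg3 g10 g20 g30.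
rewrite -integral_lin2//.
under eq_integral do rewrite EFinD.
have mk (k : R) (g : T -> R) : measurable_fun setT g -> measurable_fun setT (fun x => k * g x).
  by move=> mg; exact: measurable_funM.
rewrite ge0_integralD//; last 4 first.
- by move=> x _; rewrite lee_fin !addr_ge0// mulr_ge0.
- by apply/measurable_EFinP; do !apply: measurable_funD => //; exact: mk.
- by move=> x _; rewrite lee_fin mulr_ge0.
- by apply/measurable_EFinP; exact: mk.
congr (_ + _)%E.
under eq_integral do rewrite EFinM.
rewrite ge0_integralZl//.
- exact/measurable_EFinP.
- by move=> x _; rewrite lee_fin.
Qed.

Lemma integral_lin1 (k0 k1 : R) (g1 : T -> R) : 0 <= k0 -> 0 <= k1 ->
  measurable_fun setT g1 -> (forall x, 0 <= g1 x) ->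
  (\int[P]_x (k0 + k1 * g1 x)%:E = k0%:E + k1%:E * \int[P]_x (g1 x)%:E)%E.
Proof.
move=> k00 k10 mg1 g10.
have := integral_lin2 k00 k10 (lexx 0) mg1 mg1 g10 g10.
rewrite mul0e adde0 => <-; apply: eq_integral => x _.
by rewrite mul0r addr0.
Qed.

Lemma le_integral_EFin (g h : T -> R) : measurable_fun setT g -> measurable_fun setT h ->
  (forall x, 0 <= g x) -> (forall x, g x <= h x) ->
  (\int[P]_x (g x)%:E <= \int[P]_x (h x)%:E)%E.
Proof.
move=> mg mh g0 gh; apply: ge0_le_integral => //.
- by move=> x _; rewrite lee_fin.
- exact/measurable_EFinP.
- exact/measurable_EFinP.
- by move=> x _; rewrite lee_fin.
Qed.

End nonneg_integral.

(** * Moment recursions driven by the innovations *)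

Section moments.
Context {R : realType} d (T : measurableType d) (P : probability T R).
Variables (X : nat -> T -> R) (f dx : R) (j : coefs R).
Hypothesis mX : forall t, measurable_fun setT (X t).
Local Notation G := (std_normal R).
Hypothesis P0 : 0 < cP j.
Hypothesis law0 : forall F : 1.-tuple R -> \bar R, measurable_fun setT F -> (forall z, 0 <= F z)%E ->
  (\int[P]_x F (obs X 0 x) = \int[G]_z F [tuple (dx * z)%R])%E.
Hypothesis lawS : forall t (F : t.+2.-tuple R -> \bar R),
  measurable_fun setT F -> (forall z, 0 <= F z)%E ->
  (\int[P]_x F (obs X t.+1 x) =
   \int[P]_x \int[G]_y F (extend (obs X t x)
     (f * filter0 j t (nth 0 (obs X t x)) + Num.sqrt (cP j) * y)%R))%E.

Local Notation q := (Num.sqrt (cP j)).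
Let q2 : q ^+ 2 = cP j. Proof. by rewrite sqr_sqrtr// ltW. Qed.
Let q0 : 0 < q. Proof. by rewrite sqrtr_gt0. Qed.

Local Notation M t x := (filter0 j t (X^~ x)).
Local Notation D t x := (filter1 f j t (X^~ x)).
Local Notation W t x := (filter2 f j t (X^~ x)).
Local Notation S t x := (score f j t (X^~ x)).

Definition innovation t x : R := X t.+1 x - f * M t x.

Let mD t : measurable_fun setT (fun x => D t x).
Proof. by apply: (@measurable_filter1 _ _ _ f (fun=> j) X). Qed.
Let mW t : measurable_fun setT (fun x => W t x).
Proof. by apply: (@measurable_filter2 _ _ _ f (fun=> j) X). Qed.
Let mS t : measurable_fun setT (fun x => S t x).
Proof. by apply: (@measurable_score _ _ _ f (fun=> j) X). Qed.

Let prefix n (o : n.+1.-tuple R) : n.-tuple R := [tuple nth 0 o i | i < n].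

Let prefix_extend n (o : n.-tuple R) y : prefix (extend o y) = o.
Proof.
apply: eq_from_tnth => i; rewrite tnth_mktuple (tnth_nth 0) nth_extend_lt//.
Qed.

Let measurable_prefix n : measurable_fun setT (@prefix n).
Proof.
apply/measurable_fun_tnthP => i.
rewrite (_ : _ \o _ = fun o : n.+1.-tuple R => nth 0 o i); first exact: measurable_nth_tuple.
by apply/funext => o /=; rewrite tnth_mktuple.
Qed.

Let measurable_filter0_tuple t n :
  measurable_fun setT (fun o : n.-tuple R => filter0 j t (nth 0 o)).
Proof.
apply: (@measurable_filter0 _ _ _ (fun=> j) (fun i (o : n.-tuple R) => nth 0 o i)) => //.
by move=> i; exact: measurable_nth_tuple.
Qed.

Lemma innovation_law t (F : t.+1.-tuple R * R -> \bar R) :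
  measurable_fun setT F -> (forall z, 0 <= F z)%E ->
  (\int[P]_x F (obs X t x, innovation t x) = \int[P]_x \int[G]_z F (obs X t x, (q * z)%R))%E.
Proof.
move=> mF F0.
pose F' (o : t.+2.-tuple R) := F (prefix o, nth 0 o t.+1 - f * filter0 j t (nth 0 (prefix o))).
have mF' : measurable_fun setT F'.
  apply: measurableT_comp => //; apply: measurable_fun_pair; first exact: measurable_prefix.
  apply: measurable_funB; first exact: measurable_nth_tuple.
  apply: measurable_funM => //.
  exact: (measurableT_comp (@measurable_filter0_tuple t t.+1) (@measurable_prefix t.+1)).
have := lawS mF' (fun o => F0 _); rewrite /F' => E.
transitivity (\int[P]_x F' (obs X t.+1 x))%E.
  apply: eq_integral => x _; rewrite /F' obsS prefix_extend -obsS nth_obs// /innovation.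
  congr (F (_, _ - _ * _)); apply: eq_filter0 => i it; by rewrite nth_obs.
rewrite E; apply: eq_integral => x _; apply: eq_integral => z _.
rewrite prefix_extend nth_extend_eq; congr (F (_, _)).
by rewrite addrC addKr.
Qed.

Let measurable_stats t : measurable_fun setT (fun o : t.+1.-tuple R =>
  (filter1 f j t (nth 0 o), filter2 f j t (nth 0 o), score f j t (nth 0 o))).
Proof.
have mn i : measurable_fun setT (fun o : t.+1.-tuple R => nth 0 o i).
  exact: measurable_nth_tuple.
apply: measurable_fun_pair; first apply: measurable_fun_pair.
- by apply: (@measurable_filter1 _ _ _ f (fun=> j) (fun i (o : t.+1.-tuple R) => nth 0 o i)).
- by apply: (@measurable_filter2 _ _ _ f (fun=> j) (fun i (o : t.+1.-tuple R) => nth 0 o i)).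
- by apply: (@measurable_score _ _ _ f (fun=> j) (fun i (o : t.+1.-tuple R) => nth 0 o i)).
Qed.

(** Given the past, the innovation is q z with z standard normal. For an integrand of degree at most
    six in z, its integration replaces the even powers by 1, 1, 3, 15 and the odd ones by 0. *)
Lemma innovation_poly t (g : R -> R -> R -> R -> R) (h : R -> R -> R -> R) :
  measurable_fun setT (fun y : R * R * R * R => g y.1.1.1 y.1.1.2 y.1.2 y.2) ->
  (forall u v s y, 0 <= g u v s y) ->
  (forall u v s, exists a0 a1 a2 a3 a4 a5 a6, (forall z, g u v s (q * z) =
     a0 + a1 * z + a2 * z ^+ 2 + a3 * z ^+ 3 + a4 * z ^+ 4 + a5 * z ^+ 5 + a6 * z ^+ 6) /\
     h u v s = a0 + a2 + 3 * a4 + 15 * a6) ->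
  (\int[P]_x (g (D t x) (W t x) (S t x) (innovation t x))%:E =
   \int[P]_x (h (D t x) (W t x) (S t x))%:E)%E.
Proof.
move=> mg g0 gh.
pose G' (y : R * R * R * R) := g y.1.1.1 y.1.1.2 y.1.2 y.2.
pose F (y : t.+1.-tuple R * R) := (G' ((filter1 f j t (nth 0 y.1), filter2 f j t (nth 0 y.1),
   score f j t (nth 0 y.1)), y.2))%:E.
have mF : measurable_fun setT F.
  apply/measurable_EFinP; apply: measurableT_comp => //; apply: measurable_fun_pair => //.
  exact: (measurableT_comp (@measurable_stats t) measurable_fst).
have F0 y : (0 <= F y)%E by rewrite lee_fin; exact: g0.
have xE x i : (i <= t)%N -> nth 0 (obs X t x) i = X i x by move=> it; rewrite nth_obs.
have FE x y : F (obs X t x, y) = (g (D t x) (W t x) (S t x) y)%:E.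
  by rewrite /F /G' /= (eq_filter1 f j (xE x)) (eq_filter2 f j (xE x)) (eq_score f j (xE x)).
transitivity (\int[P]_x F (obs X t x, innovation t x))%E.
  by apply: eq_integral => x _; rewrite FE.
rewrite (innovation_law mF F0); apply: eq_integral => x _.
have [a0 [a1 [a2 [a3 [a4 [a5 [a6 [gx hx]]]]]]]] := gh (D t x) (W t x) (S t x).
rewrite hx -(@integral_normal_poly6 _ a0 a1 a2 a3 a4 a5 a6); apply: eq_integral => z _.
by rewrite FE gx.
Qed.

Let D0_law (g : R -> R) : measurable_fun setT g -> (forall y, 0 <= g y) ->
  (\int[P]_x (g (X 0%N x))%:E = \int[G]_z (g (dx * z))%:E)%E.
Proof.
move=> mg g0; have mF : measurable_fun setT (fun o : 1.-tuple R => (g (nth 0 o 0))%:E).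
  by apply/measurable_EFinP; apply: measurableT_comp => //; exact: measurable_nth_tuple.
have := law0 mF (fun o => g0 _); rewrite /= => <-.
by apply: eq_integral => x _; rewrite nth_obs.
Qed.

(** The exact value of E D_t^2: the innovation is centered given the past, so the two contributions
    to the variance add. *)
Fixpoint sensitivity t : R :=
  if t is s.+1 then cA j ^+ 2 * sensitivity s + cB1 j ^+ 2 * cP j else cc1 j ^+ 2 * dx ^+ 2.

Lemma sensitivity_ge0 t : 0 <= sensitivity t.
Proof.
elim: t => [|t IH] /=; first by rewrite mulr_ge0 ?sqr_ge0.
by apply: addr_ge0; apply: mulr_ge0 => //; rewrite ?sqr_ge0 // ltW.
Qed.

Lemma moment_D2 t : (\int[P]_x (D t x ^+ 2)%:E = (sensitivity t)%:E)%E.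
Proof.
elim: t => [|t IH].
  rewrite (@D0_law (fun y => (cc1 j * y) ^+ 2)); [|by measurability|by move=> y; exact: sqr_ge0].
  under eq_integral do rewrite mulrA.
  by rewrite integral_normal_sq exprMn.
rewrite (@innovation_poly t (fun u _ _ y => (cA j * u + cB1 j * y) ^+ 2)
  (fun u _ _ => cA j ^+ 2 * u ^+ 2 + cB1 j ^+ 2 * cP j)).
- have b0 : 0 <= cB1 j ^+ 2 * cP j by apply: mulr_ge0; rewrite ?sqr_ge0 // ltW.
  under eq_integral do rewrite addrC.
  rewrite (@integral_lin1 _ _ _ P _ _ (fun x => D t x ^+ 2) b0 (sqr_ge0 _)).
  + by rewrite IH -EFinM -EFinD addrC.
  + by apply: measurable_fun_pow.
  + by move=> x; exact: sqr_ge0.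
- by measurability.
- by move=> *; exact: sqr_ge0.
- move=> u _ _; move: (q) q2 => Q <-.
  exists (cA j ^+ 2 * u ^+ 2), (2 * cA j * u * cB1 j * Q), (cB1 j ^+ 2 * Q ^+ 2), 0, 0, 0, 0.
  by split=> [z|]; ring.
Qed.

(** These constants will bound the coefficients uniformly over a neighbourhood of theta_0; the
    moment bounds below then depend on them and on t, and no longer on the parameter. *)
Variables (Ab bb Cb kb db gb eb wb : R).
Hypotheses (Ab01 : 0 <= Ab < 1) (AbE : cA j ^+ 2 <= Ab) (bbE : cB1 j ^+ 2 * cP j <= bb)
  (CbE : f ^+ 2 / cP j <= Cb) (kbE : (cP1 j / (2 * cP j)) ^+ 2 <= kb)
  (dbE : cc1 j ^+ 2 * dx ^+ 2 <= db) (gbE : 4 * f ^+ 2 * cB1 j ^+ 2 <= gb)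
  (ebE : cB2 j ^+ 2 * cP j <= eb) (wbE : cc2 j ^+ 2 * dx ^+ 2 <= wb).

Let Ab1 : 0 < 1 - Ab. Proof. by case/andP: Ab01 => _; rewrite subr_gt0. Qed.
Let A21 : cA j ^+ 2 < 1. Proof. by case/andP: Ab01 => _; exact: le_lt_trans. Qed.
Let bb0 : 0 <= bb.
Proof. by apply: le_trans bbE; nonneg. Qed.
Let Cb0 : 0 <= Cb.
Proof. by apply: le_trans CbE; nonneg. Qed.
Let kb0 : 0 <= kb. Proof. by apply: le_trans kbE; exact: sqr_ge0. Qed.
Let db0 : 0 <= db. Proof. by apply: le_trans dbE; rewrite mulr_ge0 ?sqr_ge0. Qed.
Let gb0 : 0 <= gb. Proof. by apply: le_trans gbE; nonneg. Qed.
Let eb0 : 0 <= eb.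
Proof. by apply: le_trans ebE; nonneg. Qed.
Let wb0 : 0 <= wb. Proof. by apply: le_trans wbE; rewrite mulr_ge0 ?sqr_ge0. Qed.

Lemma sensitivity_le t : sensitivity t <= Ab ^+ t * db + bb / (1 - Ab).
Proof.
have [Ab0 _] := andP Ab01.
elim: t => [|t IH] /=.
  by apply: le_trans dbE _; rewrite mul1r lerDl divr_ge0// ltW.
have -> : Ab ^+ t.+1 * db + bb / (1 - Ab) = Ab * (Ab ^+ t * db + bb / (1 - Ab)) + bb.
  by rewrite exprS; field; rewrite gt_eqF.
apply: lerD => //; apply: ler_pM => //; [exact: sqr_ge0|exact: sensitivity_ge0].
Qed.

Lemma sensitivity_ge (Al bl : R) t : 0 <= Al < 1 -> Al <= cA j ^+ 2 -> 0 <= bl ->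
  bl <= cB1 j ^+ 2 * cP j -> bl * (1 - Al ^+ t) / (1 - Al) <= sensitivity t.
Proof.
move=> /andP[Al0 Al1] AlE bl0 blE; have Al1' : 0 < 1 - Al by rewrite subr_gt0.
elim: t => [|t IH] /=.
  by rewrite subrr mulr0 mul0r mulr_ge0 ?sqr_ge0.
have -> : bl * (1 - Al ^+ t.+1) / (1 - Al) = Al * (bl * (1 - Al ^+ t) / (1 - Al)) + bl.
  by rewrite exprS; field; rewrite gt_eqF.
apply: lerD => //; apply: ler_pM => //.
have pw : 0 <= 1 - Al ^+ t by rewrite subr_ge0 exprn_ile1// ltW.
by nonneg.
Qed.

Let vb := db + bb / (1 - Ab).
Let vb0 : 0 <= vb. Proof. by rewrite addr_ge0// divr_ge0// ltW. Qed.

Let sensitivity_vb t : sensitivity t <= vb.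
Proof.
have [Ab0 Ab1''] := andP Ab01.
apply: le_trans (sensitivity_le t) _.
by rewrite lerD2r ler_piMl// exprn_ile1// ltW.
Qed.

(** The bound of [affine_recursion_le] for E D^4, which becomes A^4 E D^4 + 6 A^2 b E D^2 + 3 b^2
    after one step; A^4 and A^2 are relaxed to Ab and 1. *)
Definition D4_bound : R := 3 * db ^+ 2 + (6 * bb * vb + 3 * bb ^+ 2) / (1 - Ab).

Lemma moment_D4 t : (\int[P]_x (D t x ^+ 4)%:E <= D4_bound%:E)%E.
Proof.
have [Ab0 Ab1''] := andP Ab01.
apply: (affine_recursion_le (u := fun t => \int[P]_x (D t x ^+ 4)%:E)%E) => //.
- by move=> {}t; apply: integral_ge0 => x _; rewrite lee_fin exprn_even_ge0.
- by rewrite addr_ge0// ?mulr_ge0// sqr_ge0.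
- by rewrite mulr_ge0// sqr_ge0.
- rewrite (@D0_law (fun y => (cc1 j * y) ^+ 4)); [|by measurability|by move=> y; rewrite exprn_even_ge0].
  have := @integral_normal_poly6 R 0 0 0 0 ((cc1 j * dx) ^+ 4) 0 0.
  rewrite (_ : (\int[G]_z _)%E = (\int[G]_z ((cc1 j * (dx * z)) ^+ 4)%:E)%E); last first.
    by apply: eq_integral => z _; congr EFin; ring.
  move=> ->; rewrite lee_fin !mulr0 !addr0 !add0r.
  rewrite ler_pM2l// (_ : (cc1 j * dx) ^+ 4 = (cc1 j ^+ 2 * dx ^+ 2) ^+ 2); last by ring.
  by rewrite lerXn2r// nnegrE// mulr_ge0 ?sqr_ge0.
move=> {}t; set K := 6 * bb * vb + 3 * bb ^+ 2.
rewrite (@innovation_poly t (fun u _ _ y => (cA j * u + cB1 j * y) ^+ 4)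
  (fun u _ _ => cA j ^+ 4 * u ^+ 4 + 6 * (cA j ^+ 2 * u ^+ 2) * (cB1 j ^+ 2 * cP j)
     + 3 * (cB1 j ^+ 2 * cP j) ^+ 2)).
- apply: (@le_trans _ _ (\int[P]_x (3 * bb ^+ 2 + Ab * D t x ^+ 4 + 6 * bb * D t x ^+ 2)%:E)%E).
    apply: le_integral_EFin.
    + by measurability; exact: mD.
    + by measurability; exact: mD.
    + by move=> x; nonneg.
    + move=> x; have : 0 <= cB1 j ^+ 2 * cP j by nonneg.
      have -> : cA j ^+ 4 * D t x ^+ 4 = (cA j ^+ 2 * cA j ^+ 2) * (D t x ^+ 2 * D t x ^+ 2) by ring.
      have -> : D t x ^+ 4 = D t x ^+ 2 * D t x ^+ 2 by ring.
      have := sqr_ge0 (D t x); have := sqr_ge0 (cA j).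
      move: (D t x ^+ 2) (cA j ^+ 2) (cB1 j ^+ 2 * cP j) AbE A21 bbE => u a2 b ? ? ? ? ? ?.
      have : 0 <= u * u by nonneg.
      have : (6 * (a2 * u) * b) <= 6 * bb * u.
        rewrite (_ : 6 * (a2 * u) * b = 6 * u * (a2 * b)); last by ring.
        rewrite (_ : 6 * bb * u = 6 * u * (1 * bb)); last by ring.
        by apply: ler_wpM2l; [nonneg|apply: ler_pM => //; exact: ltW].
      have : a2 * a2 * (u * u) <= Ab * (u * u).
        apply: ler_wpM2r; first nonneg.
        by rewrite -[leRHS]mulr1; apply: ler_pM => //; exact: ltW.
      have : b ^+ 2 <= bb ^+ 2 by rewrite lerXn2r ?nnegrE.
      lra.
  rewrite integral_lin2.
  + rewrite moment_D2 [X in (X + _ <= _)%E]addeC -addeA; apply: leeD2l.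
    by rewrite -EFinM -EFinD lee_fin /K addrC lerD2r ler_wpM2l//; nonneg.
  + by nonneg.
  + by nonneg.
  + by nonneg.
  + by apply: measurable_fun_pow.
  + by apply: measurable_fun_pow.
  + by move=> x; nonneg.
  + by move=> x; nonneg.
- by measurability.
- by move=> *; rewrite exprn_even_ge0.
- move=> u _ _; move: (q) q2 => Q <-.
  exists (cA j ^+ 4 * u ^+ 4), (4 * cA j ^+ 3 * u ^+ 3 * (cB1 j * Q)),
    (6 * cA j ^+ 2 * u ^+ 2 * (cB1 j * Q) ^+ 2), (4 * cA j * u * (cB1 j * Q) ^+ 3),
    ((cB1 j * Q) ^+ 4), 0, 0.
  by split=> [z|]; ring.
Qed.

(** The second derivative W is driven by D. Young's inequality with weights 2 / (1 + Ab) and 2 / (1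
    - Ab) separates the two and still leaves a factor below 1 on W^2. *)
Let contraction : R := 2 / (1 + Ab) * Ab.

Let contraction01 : 0 <= contraction < 1.
Proof.
have [Ab0 Ab1''] := andP Ab01.
have p1 : 0 < 1 + Ab by rewrite ltr_pwDl.
apply/andP; split; first by rewrite /contraction; nonneg.
by rewrite /contraction mulrAC ltr_pdivrMr//; lra.
Qed.

Definition W2_bound : R := wb + (eb + 2 / (1 - Ab) * gb * vb) / (1 - contraction).

Let young (x y : R) : (x - y) ^+ 2 <= 2 / (1 + Ab) * x ^+ 2 + 2 / (1 - Ab) * y ^+ 2.
Proof.
have [Ab0 Ab1''] := andP Ab01.
have p1 : 0 < 1 + Ab by rewrite ltr_pwDl.
rewrite -subr_ge0.
have -> : 2 / (1 + Ab) * x ^+ 2 + 2 / (1 - Ab) * y ^+ 2 - (x - y) ^+ 2 =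
    ((1 - Ab) * x + (1 + Ab) * y) ^+ 2 / ((1 + Ab) * (1 - Ab)).
  by field; rewrite !gt_eqF.
by nonneg.
Qed.

Lemma moment_W2 t : (\int[P]_x (W t x ^+ 2)%:E <= W2_bound%:E)%E.
Proof.
have [Ab0 Ab1''] := andP Ab01.
have p1 : 0 < 1 + Ab by rewrite ltr_pwDl.
apply: (affine_recursion_le (u := fun t => \int[P]_x (W t x ^+ 2)%:E)%E) => //.
- by move=> {}t; apply: integral_ge0 => x _; rewrite lee_fin sqr_ge0.
- by nonneg.
- rewrite (@D0_law (fun y => (cc2 j * y) ^+ 2)); [|by measurability|by move=> y; exact: sqr_ge0].
  under eq_integral do rewrite mulrA.
  by rewrite integral_normal_sq exprMn lee_fin.
move=> {}t.
rewrite (@innovation_poly t (fun u v _ y => (cA j * v - 2 * f * cB1 j * u + cB2 j * y) ^+ 2)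
  (fun u v _ => (cA j * v - 2 * f * cB1 j * u) ^+ 2 + cB2 j ^+ 2 * cP j)).
- apply: (@le_trans _ _ (\int[P]_x (eb + contraction * W t x ^+ 2 + 2 / (1 - Ab) * gb * D t x ^+ 2)%:E)%E).
    apply: le_integral_EFin.
    + by measurability; [exact: mW|exact: mD].
    + by measurability; [exact: mW|exact: mD].
    + by move=> x; nonneg.
    + move=> x; rewrite addrC -addrA; apply: lerD => //.
      apply: le_trans (young _ _) _; rewrite !exprMn.
      apply: lerD.
        rewrite /contraction [leLHS]mulrA; apply: ler_wpM2r; first exact: sqr_ge0.
        by apply: ler_wpM2l => //; nonneg.
      rewrite [leLHS]mulrA; apply: ler_wpM2r; first exact: sqr_ge0.
      apply: ler_wpM2l; first by nonneg.
      by apply: le_trans gbE; rewrite le_eqVlt; apply/orP; left; apply/eqP; ring.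
  have [c0 _] := andP contraction01.
  rewrite integral_lin2.
  + rewrite moment_D2 [X in (X + _ <= _)%E]addeC -addeA; apply: leeD2l.
    by rewrite -EFinM -EFinD lee_fin lerD2l ler_wpM2l//; nonneg.
  + by nonneg.
  + by nonneg.
  + by nonneg.
  + by apply: measurable_fun_pow.
  + by apply: measurable_fun_pow.
  + by move=> x; nonneg.
  + by move=> x; nonneg.
- by measurability.
- by move=> *; nonneg.
- move=> u v _; move: (q) q2 => Q <-.
  exists ((cA j * v - 2 * f * cB1 j * u) ^+ 2),
    (2 * (cA j * v - 2 * f * cB1 j * u) * (cB2 j * Q)), (cB2 j ^+ 2 * Q ^+ 2), 0, 0, 0, 0.
  by split=> [z|]; ring.
Qed.

(** Here bb / (1 - Ab) bounds the stationary sensitivity, so the factor of t bounds the information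
    per observation; the last term pays for the initial sensitivity. *)
Definition S2_bound t : R := t%:R * (Cb * (bb / (1 - Ab)) + 2 * kb) + Cb * db / (1 - Ab).

(** Score increments are centered given the past, so E S^2 is additive: z^2 - 1 has variance 2,
    giving 2 k, and the term linear in z gives C E D^2. *)
Lemma moment_S2 t : (\int[P]_x (S t x ^+ 2)%:E <= (S2_bound t)%:E)%E.
Proof.
have [Ab0 Ab1''] := andP Ab01.
(* The induction needs the exact geometric sum, in which Ab^t is still present; it is bounded only
   at the end. *)
apply: (@le_trans _ _ (t%:R * (Cb * (bb / (1 - Ab)) + 2 * kb) + Cb * db * (1 - Ab ^+ t) / (1 - Ab))%:E).
  elim: t => [|t IH].
    under eq_integral do rewrite /= expr0n.
    by rewrite integral_prob_cst expr0 subrr !mulr0 !mul0r addr0.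
  rewrite (@innovation_poly t (fun u _ s y =>
      (s + cP1 j / (2 * cP j) * (y ^+ 2 / cP j - 1) + f / cP j * u * y) ^+ 2)
    (fun u _ s => 2 * (cP1 j / (2 * cP j)) ^+ 2 + f ^+ 2 / cP j * u ^+ 2 + 1 * s ^+ 2)).
  - rewrite integral_lin2.
    + rewrite moment_D2 mul1e -EFinM -EFinD; apply: le_trans (leeD2l _ IH) _.
      rewrite -EFinD lee_fin -[t.+1]addn1 natrD addn1.
      have : f ^+ 2 / cP j * sensitivity t <= Cb * (Ab ^+ t * db + bb / (1 - Ab)).
        apply: ler_pM => //; [by nonneg|exact: sensitivity_ge0|exact: sensitivity_le].
      have -> : Cb * db * (1 - Ab ^+ t.+1) / (1 - Ab) =
        Cb * db * (1 - Ab ^+ t) / (1 - Ab) + Cb * (Ab ^+ t * db).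
        by rewrite exprS; field; rewrite gt_eqF.
      move: kbE; set K := _ ^+ 2; set V := _ * sensitivity t; set x := Cb * db * _ / _.
      set y := bb / _; set z := Ab ^+ t * db.
      by move: (t%:R) => n; lra.
    + by nonneg.
    + by nonneg.
    + exact: ler01.
    + by apply: measurable_fun_pow.
    + by apply: measurable_fun_pow.
    + by move=> x; nonneg.
    + by move=> x; nonneg.
  - by measurability.
  - by move=> *; nonneg.
  - move=> u _ s; move: (q) q2 q0 => Q <- Q0.
    exists ((s - cP1 j / (2 * Q ^+ 2)) ^+ 2), (2 * (s - cP1 j / (2 * Q ^+ 2)) * (f / Q * u)),
      ((f / Q * u) ^+ 2 + 2 * (cP1 j / (2 * Q ^+ 2)) * (s - cP1 j / (2 * Q ^+ 2))),
      (2 * (cP1 j / (2 * Q ^+ 2)) * (f / Q * u)), ((cP1 j / (2 * Q ^+ 2)) ^+ 2), 0, 0.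
    have Qn : Q != 0 by rewrite gt_eqF.
    by split=> [z|]; field.
rewrite lee_fin lerD2l ler_wpM2r//; first by nonneg.
by rewrite ler_piMr// ?gerBl ?exprn_ge0//; nonneg.
Qed.

(** The total coefficient of 1 + u^4 in [D2S2_pointwise]; the term in 1 / delta is the price of
    absorbing the cross term linear in the score. *)
Definition D2S2_cst (delta : R) : R :=
  8 / delta * (bb * Cb + kb * bb ^+ 2) + Cb + 2 * kb + 4 * (bb * Cb + kb) + 3 * (bb * Cb)
  + 10 * (bb * kb).

(** The fixed point of the one-step bound with t frozen in the source terms. Its leading part, (bb +
    delta) [S2_bound] t / (1 - Ab), is close to t V I. *)
Definition D2S2_bound (delta : R) t : R :=
  ((bb + delta) * S2_bound t + D2S2_cst delta * (1 + D4_bound)) / (1 - Ab).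

(** The expression is the mean of (c0 + c1 z + c2 z^2 + c3 z^3)^2 for the cubic of [moment_D2S2];
    Hermite expansion writes it as (c0 + c2)^2 + 2 c2^2 + (c1 + 3 c3)^2 + 6 c3^2. *)
Let D2S2_ge0 (A b C k u s : R) :
  0 <= A ^+ 2 * u ^+ 2 * s ^+ 2 + b ^+ 2 * s ^+ 2 + 4 * s * (A * b * C * u ^+ 2 + k * b ^+ 2)
  + A ^+ 2 * u ^+ 2 * (C ^+ 2 * u ^+ 2 + 2 * k ^+ 2) + 8 * (A * b * C * k) * u ^+ 2
  + b ^+ 2 * (3 * C ^+ 2 * u ^+ 2 + 10 * k ^+ 2).
Proof.
rewrite (_ : _ + _ = (A * u * (s - k) + (A * u * k + b * C * u)) ^+ 2
  + 2 * (A * u * k + b * C * u) ^+ 2 + (A * u * C * u + b * (s - k) + 3 * b * k) ^+ 2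
  + 6 * (b * k) ^+ 2); [by nonneg|ring].
Qed.

(** Only (u s)^2 and s^2 can grow with time, so their coefficients must stay sharp: Ab, and bb up to
    delta. Everything else may be bounded crudely by a multiple of 1 + u^4. *)
Let D2S2_pointwise (delta A b C k u s : R) : 0 < delta -> A ^+ 2 <= Ab -> b ^+ 2 <= bb ->
  C ^+ 2 <= Cb -> k ^+ 2 <= kb ->
  A ^+ 2 * u ^+ 2 * s ^+ 2 + b ^+ 2 * s ^+ 2 + 4 * s * (A * b * C * u ^+ 2 + k * b ^+ 2)
  + A ^+ 2 * u ^+ 2 * (C ^+ 2 * u ^+ 2 + 2 * k ^+ 2) + 8 * (A * b * C * k) * u ^+ 2
  + b ^+ 2 * (3 * C ^+ 2 * u ^+ 2 + 10 * k ^+ 2)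
  <= D2S2_cst delta + Ab * (u * s) ^+ 2 + (bb + delta) * s ^+ 2 + D2S2_cst delta * u ^+ 4.
Proof.
move=> d0 AA bB CC kk.
have [Ab0 Ab1''] := andP Ab01.
have A1 : A ^+ 2 <= 1 by apply: le_trans AA (ltW _).
have bC : b ^+ 2 * C ^+ 2 <= bb * Cb by apply: ler_pM => //; nonneg.
have bk : b ^+ 2 * k ^+ 2 <= bb * kb by apply: ler_pM => //; nonneg.
have AbC : A ^+ 2 * (b ^+ 2 * C ^+ 2) <= bb * Cb.
  by rewrite -[leRHS]mul1r; apply: ler_pM => //; nonneg.
have kb2 : k ^+ 2 * (b ^+ 2) ^+ 2 <= kb * bb ^+ 2.
  by apply: ler_pM => //; [nonneg|nonneg|rewrite lerXn2r// nnegrE; nonneg].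
have Ak : A ^+ 2 * k ^+ 2 <= kb by rewrite -[leRHS]mul1r; apply: ler_pM => //; nonneg.
have AC : A ^+ 2 * C ^+ 2 <= Cb by rewrite -[leRHS]mul1r; apply: ler_pM => //; nonneg.
have U0 : 0 <= u ^+ 2 by nonneg.
have UE : u ^+ 4 = u ^+ 2 * u ^+ 2 by ring.
have UU : u ^+ 2 <= 1 + u ^+ 4 by rewrite UE; nra.
have U4 : 0 <= u ^+ 4 by nonneg.
pose y := A * b * C * u ^+ 2 + k * b ^+ 2.
(* AM-GM absorbs the term linear in the score. *)
have sy : 4 * s * y <= delta * s ^+ 2 + 4 / delta * y ^+ 2.
  rewrite -subr_ge0 (_ : _ - _ = (delta * s - 2 * y) ^+ 2 / delta); first by nonneg.
  by field; rewrite gt_eqF.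
have y2 : y ^+ 2 <= 2 * (bb * Cb + kb * bb ^+ 2) * (1 + u ^+ 4).
  apply: (@le_trans _ _ (2 * (A ^+ 2 * (b ^+ 2 * C ^+ 2) * u ^+ 4 + k ^+ 2 * (b ^+ 2) ^+ 2))).
    rewrite -subr_ge0 (_ : _ - _ = (A * b * C * u ^+ 2 - k * b ^+ 2) ^+ 2); first by nonneg.
    by rewrite /y; ring.
  have H1 : A ^+ 2 * (b ^+ 2 * C ^+ 2) * u ^+ 4 <= bb * Cb * u ^+ 4 by exact: ler_wpM2r.
  have H2 : 0 <= kb * bb ^+ 2 * u ^+ 4 by nonneg.
  have H3 : 0 <= bb * Cb by nonneg.
  lra.
have T1 : A ^+ 2 * u ^+ 2 * s ^+ 2 <= Ab * (u * s) ^+ 2.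
  by rewrite exprMn -mulrA ler_wpM2r//; nonneg.
have T2 : b ^+ 2 * s ^+ 2 <= bb * s ^+ 2 by rewrite ler_wpM2r//; nonneg.
have T3 : 4 / delta * y ^+ 2 <= 8 / delta * (bb * Cb + kb * bb ^+ 2) * (1 + u ^+ 4).
  rewrite (_ : 8 / delta * _ * _ = 4 / delta * (2 * (bb * Cb + kb * bb ^+ 2) * (1 + u ^+ 4))).
    by apply: ler_wpM2l => //; nonneg.
  by field; rewrite gt_eqF.
have T4 : A ^+ 2 * u ^+ 2 * (C ^+ 2 * u ^+ 2 + 2 * k ^+ 2) <= (Cb + 2 * kb) * (1 + u ^+ 4).
  rewrite (_ : A ^+ 2 * u ^+ 2 * _ = (A ^+ 2 * C ^+ 2) * u ^+ 4 + 2 * (A ^+ 2 * k ^+ 2) * u ^+ 2).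
    have H1 : A ^+ 2 * C ^+ 2 * u ^+ 4 <= Cb * u ^+ 4 by exact: ler_wpM2r.
    have H2 : A ^+ 2 * k ^+ 2 * u ^+ 2 <= kb * (1 + u ^+ 4) by apply: ler_pM => //; nonneg.
    by move: Cb0 H1 H2; lra.
  ring.
have T5 : 8 * (A * b * C * k) * u ^+ 2 <= 4 * (bb * Cb + kb) * (1 + u ^+ 4).
  have H : 8 * (A * b * C * k) <= 4 * (bb * Cb + kb).
    have : 2 * ((b * C) * (A * k)) <= (b * C) ^+ 2 + (A * k) ^+ 2.
      rewrite -subr_ge0 (_ : _ - _ = (b * C - A * k) ^+ 2); first by nonneg.
      ring.
    rewrite !exprMn (_ : A * b * C * k = b * C * (A * k)); last ring.
    move: (b * C * (A * k)) => ?; lra.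
  apply: (@le_trans _ _ (4 * (bb * Cb + kb) * u ^+ 2)); first exact: ler_wpM2r.
  by apply: ler_wpM2l => //; nonneg.
have T6 : b ^+ 2 * (3 * C ^+ 2 * u ^+ 2 + 10 * k ^+ 2) <= (3 * (bb * Cb) + 10 * (bb * kb)) * (1 + u ^+ 4).
  rewrite (_ : b ^+ 2 * _ = 3 * ((b ^+ 2 * C ^+ 2) * u ^+ 2) + 10 * (b ^+ 2 * k ^+ 2)); last ring.
  have H1 : b ^+ 2 * C ^+ 2 * u ^+ 2 <= bb * Cb * (1 + u ^+ 4) by apply: ler_pM => //; nonneg.
  have H2 : b ^+ 2 * k ^+ 2 <= bb * kb * (1 + u ^+ 4).
    apply: le_trans bk _; rewrite ler_peMr ?lerDl//; nonneg.
  by move: H1 H2; lra.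
rewrite (_ : D2S2_cst delta + Ab * (u * s) ^+ 2 + (bb + delta) * s ^+ 2 + D2S2_cst delta * u ^+ 4 =
  Ab * (u * s) ^+ 2 + bb * s ^+ 2 + (delta * s ^+ 2 + (8 / delta * (bb * Cb + kb * bb ^+ 2) * (1 + u ^+ 4)))
  + (Cb + 2 * kb) * (1 + u ^+ 4) + 4 * (bb * Cb + kb) * (1 + u ^+ 4)
  + (3 * (bb * Cb) + 10 * (bb * kb)) * (1 + u ^+ 4)); last first.
  by rewrite /D2S2_cst; ring.
do !apply: lerD => //.
apply: le_trans sy _; exact: lerD.
Qed.

(** D is contracted at each step while S accumulates, so E (D S)^2 follows b E S^2 / (1 - A^2) up to
    bounded terms. This replaces any ergodic or mixing argument. *)
Lemma moment_D2S2 delta t : 0 < delta ->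
  (\int[P]_x ((D t x * S t x) ^+ 2)%:E <= (D2S2_bound delta t)%:E)%E.
Proof.
move=> d0; have [Ab0 Ab1''] := andP Ab01.
have K0 : 0 <= D2S2_cst delta by rewrite /D2S2_cst; nonneg.
have D40 : 0 <= D4_bound by rewrite /D4_bound; nonneg.
have S20 n : 0 <= S2_bound n by rewrite /S2_bound; nonneg.
elim: t => [|t IH].
  under eq_integral do rewrite /= mulr0 expr0n.
  by rewrite integral_prob_cst lee_fin /D2S2_bound; have := S20 0%N => ?; nonneg.
pose kap := cP1 j / (2 * cP j).
rewrite (@innovation_poly t (fun u _ s y => ((cA j * u + cB1 j * y) *
      (s + cP1 j / (2 * cP j) * (y ^+ 2 / cP j - 1) + f / cP j * u * y)) ^+ 2)
    (fun u _ s => let A := cA j in let b := cB1 j * q in let C := f / q in let k := kap in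
  A ^+ 2 * u ^+ 2 * s ^+ 2 + b ^+ 2 * s ^+ 2 + 4 * s * (A * b * C * u ^+ 2 + k * b ^+ 2)
  + A ^+ 2 * u ^+ 2 * (C ^+ 2 * u ^+ 2 + 2 * k ^+ 2) + 8 * (A * b * C * k) * u ^+ 2
  + b ^+ 2 * (3 * C ^+ 2 * u ^+ 2 + 10 * k ^+ 2))).
- apply: (@le_trans _ _ (\int[P]_x (D2S2_cst delta + Ab * (D t x * S t x) ^+ 2
     + (bb + delta) * S t x ^+ 2 + D2S2_cst delta * D t x ^+ 4)%:E)%E).
    apply: ge0_le_integral => //.
    + by move=> x _; rewrite lee_fin; exact: D2S2_ge0.
    + by have := @mD t; have := @mS t => ? ?; apply/measurable_EFinP; measurability.
    + by have := @mD t; have := @mS t => ? ?; apply/measurable_EFinP; measurability.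
    + move=> x _; rewrite lee_fin; apply: D2S2_pointwise => //.
      * by rewrite exprMn q2.
      * by rewrite expr_div_n q2.
  rewrite integral_lin3.
  + have := moment_S2 t; have := moment_D4 t.
    have := IH; rewrite /D2S2_bound.
    set B := (_ / (1 - Ab)); set K := D2S2_cst delta; set D4 := D4_bound => hD hD4 hS.
    apply: (@le_trans _ _ (K%:E + Ab%:E * B%:E + (bb + delta)%:E * (S2_bound t)%:E + K%:E * D4%:E)%E).
      have bd : 0 <= bb + delta by nonneg.
      by repeat apply: leeD => //; apply: lee_wpmul2l => //; rewrite lee_fin.
    rewrite -!EFinM -!EFinD lee_fin.
    have -> : K + Ab * B + (bb + delta) * S2_bound t + K * D4 = B.
      by rewrite /B -/K -/D4; field; rewrite gt_eqF.
    rewrite /B ler_wpM2r ?invr_ge0 ?(ltW Ab1)// lerD2r.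
    apply: ler_wpM2l; first by nonneg.
    rewrite /S2_bound lerD2r ler_wpM2r//; first by nonneg.
    by rewrite ler_nat.
  + by nonneg.
  + by nonneg.
  + by nonneg.
  + by nonneg.
  + by apply: measurable_fun_pow; apply: measurable_funM.
  + by apply: measurable_fun_pow.
  + by apply: measurable_fun_pow.
  + by move=> x; nonneg.
  + by move=> x; nonneg.
  + by move=> x; nonneg.
- by measurability.
- by move=> *; nonneg.
- move=> u _ s; rewrite /= /kap; move: (q) q2 q0 => Q <- Q0.
  have Qn : Q != 0 by rewrite gt_eqF.
  pose al := cA j * u; pose b := cB1 j * Q; pose k := cP1 j / (2 * Q ^+ 2).
  pose sg := s - k; pose e := f / Q * u.
  pose c0 := al * sg; pose c1 := al * e + b * sg; pose c2 := al * k + b * e; pose c3 := b * k.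
  exists (c0 ^+ 2), (2 * c0 * c1), (c1 ^+ 2 + 2 * c0 * c2), (2 * c0 * c3 + 2 * c1 * c2),
    (c2 ^+ 2 + 2 * c1 * c3), (2 * c2 * c3), (c3 ^+ 2).
  by split=> [z|]; rewrite /c0 /c1 /c2 /c3 /al /b /k /sg /e /k; field.
Qed.

End moments.

(** * The van Trees inequality *)

Section change_of_measure.
Context {R : realType} d (T : measurableType d) (P P' : probability T R).
Variables (X : nat -> T -> R) (f dx : R) (j j' : coefs R).
Local Notation G := (std_normal R).
Local Notation leb := (@lebesgue_measure R).

Definition obs_recursion (P : probability T R) (j : coefs R) :=
  forall t (F : t.+2.-tuple R -> \bar R),
  measurable_fun setT F -> (forall z, 0 <= F z)%E ->
  (\int[P]_x F (obs X t.+1 x) =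
   \int[P]_x \int[G]_y F (extend (obs X t x)
     (f * filter0 j t (nth 0 (obs X t x)) + Num.sqrt (cP j) * y)%R))%E.

Definition obs_init (P : probability T R) :=
  forall F : 1.-tuple R -> \bar R, measurable_fun setT F -> (forall z, 0 <= F z)%E ->
  (\int[P]_x F (obs X 0 x) = \int[G]_z F [tuple (dx * z)%R])%E.

Hypotheses (P0 : 0 < cP j) (P'0 : 0 < cP j').
Hypotheses (law0 : obs_init P) (law0' : obs_init P').
Hypotheses (lawS : obs_recursion P j) (lawS' : obs_recursion P' j').

(** It equals 1 at t = 0: by [obs_init] the law of X_0 is the same under both parameters. *)
Definition likelihood_ratio t (x : nat -> R) : R := expR (loglik f j t x - loglik f j' t x).

Lemma measurable_likelihood_ratio t n :
  measurable_fun setT (fun o : n.-tuple R => likelihood_ratio t (nth 0 o)).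
Proof.
have mn i : measurable_fun setT (fun o : n.-tuple R => nth 0 o i) by exact: measurable_nth_tuple.
apply: measurable_fun_expR; apply: measurable_funB.
  by apply: (@measurable_loglik _ _ _ f (fun=> j) (fun i (o : n.-tuple R) => nth 0 o i)).
by apply: (@measurable_loglik _ _ _ f (fun=> j') (fun i (o : n.-tuple R) => nth 0 o i)).
Qed.

Let pdfE (k : coefs R) t n (o : n.-tuple R) x : (n = t.+1)%N -> 0 < cP k ->
  normal_pdf (f * filter0 k t (nth 0 o)) (Num.sqrt (cP k)) x =
  (Num.sqrt (pi * 2))^-1 * expR (loglik f k t.+1 (nth 0 (extend o x)) - loglik f k t (nth 0 o)).
Proof.
move=> nt k0.
have oE i : (i <= t)%N -> nth 0 (extend o x) i = nth 0 o i.
  by move=> it; rewrite nth_extend_lt// nt ltnS.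
rewrite /= (eq_loglik f k oE) (eq_filter0 k oE) (_ : nth 0 (rcons o x) t.+1 = x); last first.
  by rewrite -nt -[LHS]/(nth 0 (extend o x) n) nth_extend_eq.
have sq0 : Num.sqrt (cP k) != 0 by rewrite gt_eqF// sqrtr_gt0.
have lnE : expR (- (ln (cP k) / 2)) = (Num.sqrt (cP k))^-1.
  rewrite expRN; congr (_^-1).
  apply/eqP; rewrite -(@eqrXn2 _ 2)// ?expR_ge0 ?sqrtr_ge0//.
  rewrite sqr_sqrtr ?ltW// -expRM_natl mulrC divfK//.
  by rewrite lnK.
rewrite /normal_pdf (negbTE sq0) /normal_peak /normal_fun sqr_sqrtr ?(ltW k0)//.
rewrite (_ : _ - loglik f k t (nth 0 o) =
  - (ln (cP k) / 2) + - (x - f * filter0 k t (nth 0 o)) ^+ 2 / (cP k *+ 2)); last first.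
  by field; rewrite gt_eqF.
rewrite expRD lnE mulrA; congr (_ * _).
rewrite -invfM; congr (_^-1).
by rewrite -mulrnAr sqrtrM ?(ltW k0)// mulrC -[_ *+ 2]mulr_natr.
Qed.

(** The induction hypothesis moves the integral of the one-step kernel from [P] to [P']. The normal
    density of the next observation is then exp of an increment of [loglik], up to a factor (2
    pi)^(-1/2) common to both parameters. *)
Lemma change_of_measure t (F : t.+1.-tuple R -> \bar R) :
  measurable_fun setT F -> (forall z, 0 <= F z)%E ->
  (\int[P]_x F (obs X t x) =
   \int[P']_x (F (obs X t x) * (likelihood_ratio t (X^~ x))%:E))%E.
Proof.
have lrE s x : likelihood_ratio s (X^~ x) = likelihood_ratio s (nth 0 (obs X s x)).
  by congr expR; congr (_ - _); apply: eq_loglik => i it; rewrite nth_obs.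
elim: t F => [|t IH] F mF F0.
  rewrite (law0 mF F0) -(law0' mF F0); apply: eq_integral => x _.
  by rewrite /likelihood_ratio /= subrr expR0 mule1.
rewrite (lawS mF F0).
have mfil n k : measurable_fun setT (fun o : n.-tuple R => filter0 k t (nth 0 o)).
  apply: (@measurable_filter0 _ _ _ (fun=> k) (fun i (o : n.-tuple R) => nth 0 o i)) => //.
  by move=> i; exact: measurable_nth_tuple.
pose H (k : coefs R) (F : t.+2.-tuple R -> \bar R) (o : t.+1.-tuple R) :=
  (\int[G]_y F (extend o (f * filter0 k t (nth 0 o) + Num.sqrt (cP k) * y)%R))%E.
have HE k (K : t.+2.-tuple R -> \bar R) o : 0 < cP k -> measurable_fun setT K ->
    (forall z, 0 <= K z)%E -> H k K o = (\int[leb]_x (K (extend o x) *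
    ((Num.sqrt (pi * 2))^-1 *
     expR (loglik f k t.+1 (nth 0 (extend o x)) - loglik f k t (nth 0 o)))%:E))%E.
  move=> k0 mK K0.
  have mK' : measurable_fun setT (fun x => K (extend o x)).
    by apply: measurableT_comp => //; apply: measurable_extend.
  rewrite /H -(@ge0_integral_normal_pdf _ _ _ (fun x => K (extend o x))) ?sqrtr_gt0//.
  by apply: eq_integral => x _; rewrite (pdfE _ _ erefl).
have mH k (K : t.+2.-tuple R -> \bar R) : measurable_fun setT K -> (forall z, 0 <= K z)%E ->
    measurable_fun setT (H k K).
  move=> mK K0.
  have mK2 : measurable_fun setT (fun y : t.+1.-tuple R * R =>
      K (extend y.1 (f * filter0 k t (nth 0 y.1) + Num.sqrt (cP k) * y.2))).
    apply: measurableT_comp => //; apply: measurable_extend; first exact: measurable_fst.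
    apply: measurable_funD; last exact: measurable_funM.
    apply: measurable_funM => //.
    exact: (measurableT_comp (mfil t.+1 k) measurable_fst).
  exact: (@measurable_fun_fubini_tonelli_F _ _ _ _ _ G _ mK2 (fun y => K0 _)).
have H0 k (K : t.+2.-tuple R -> \bar R) o : (forall z, 0 <= K z)%E -> (0 <= H k K o)%E.
  by move=> K0; exact: integral_ge0.
rewrite -[LHS]/(\int[P]_x H j F (obs X t x))%E.
rewrite (IH _ (mH j F mF F0) (fun o => H0 j F o F0)).
pose F' (o : t.+2.-tuple R) := (F o * (likelihood_ratio t.+1 (nth 0 o))%:E)%E.
have mF' : measurable_fun setT F'.
  apply: emeasurable_funM => //; apply/measurable_EFinP; exact: measurable_likelihood_ratio.
have F'0 o : (0 <= F' o)%E by rewrite mule_ge0// lee_fin expR_ge0.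
transitivity (\int[P']_x F' (obs X t.+1 x))%E; last first.
  by apply: eq_integral => x _; rewrite /F' -lrE.
rewrite (lawS' mF' F'0) -[RHS]/(\int[P']_x H j' F' (obs X t x))%E.
apply: eq_integral => x _; rewrite lrE (HE j F) // (HE j' F')//.
set o := obs X t x.
rewrite muleC -ge0_integralZl//; last 3 first.
- apply: emeasurable_funM; first by apply: measurableT_comp => //; exact: measurable_extend.
  have mext : measurable_fun setT (fun y => extend o y) by exact: measurable_extend.
  have mi i : measurable_fun setT (fun y => nth 0 (extend o y) i).
    exact: (measurableT_comp (@measurable_nth_tuple R t.+2 i) mext).
  apply/measurable_EFinP; apply: measurable_funM => //.
  apply: measurable_fun_expR; apply: measurable_funB => //.
  by apply: (@measurable_loglik _ _ _ f (fun=> j) (fun i y => nth 0 (extend o y) i)).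
- by move=> x' _; rewrite mule_ge0// lee_fin mulr_ge0 ?expR_ge0.
- by rewrite lee_fin expR_ge0.
apply: eq_integral => y _; rewrite /F' /likelihood_ratio.
rewrite muleCA -!muleA; congr (_ * _)%E.
rewrite -!EFinM; congr EFin; rewrite mulrCA [RHS]mulrCA; congr (_ * _).
by rewrite -!expRD; congr expR; ring.
Qed.

End change_of_measure.

(** * Rules for derivatives and continuity *)

Section derivation_rules.
Context {R : realType}.
Implicit Types (g h : R -> R) (s : R).

Lemma is_derive_val g s dg dg' : is_derive s (1 : R) g dg -> dg = dg' ->
  is_derive s (1 : R) g dg'.
Proof. by move=> + <-. Qed.

Lemma is_derive_const (k s : R) : is_derive s (1 : R) (fun=> k) 0.
Proof. exact: is_derive_cst. Qed.

Lemma is_derive_addr g h s dg dh : is_derive s (1 : R) g dg -> is_derive s (1 : R) h dh ->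
  is_derive s (1 : R) (fun y => g y + h y) (dg + dh).
Proof. by move=> ? ?; exact: is_deriveD. Qed.

Lemma is_derive_subr g h s dg dh : is_derive s (1 : R) g dg -> is_derive s (1 : R) h dh ->
  is_derive s (1 : R) (fun y => g y - h y) (dg - dh).
Proof. by move=> ? ?; exact: is_deriveB. Qed.

Lemma is_derive_oppr g s dg : is_derive s (1 : R) g dg ->
  is_derive s (1 : R) (fun y => - g y) (- dg).
Proof. by move=> ?; exact: is_deriveN. Qed.

Lemma is_derive_mulr g h s dg dh : is_derive s (1 : R) g dg -> is_derive s (1 : R) h dh ->
  is_derive s (1 : R) (fun y => g y * h y) (dg * h s + g s * dh).
Proof.
move=> dgs dhs; have -> : dg * h s + g s * dh = g s *: dh + h s *: dg.
  by rewrite addrC [dg * _]mulrC.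
exact: (is_deriveM dgs dhs).
Qed.

Lemma is_derive_scale g s (k : R) dg : is_derive s (1 : R) g dg ->
  is_derive s (1 : R) (fun y => k * g y) (k * dg).
Proof. by move=> dgs; exact: is_deriveZ. Qed.

Lemma is_derive_sq g s dg : is_derive s (1 : R) g dg ->
  is_derive s (1 : R) (fun y => g y ^+ 2) (2 * g s * dg).
Proof.
move=> dgs; have := is_derive_mulr dgs dgs.
have -> : (fun y => g y * g y) = (fun y => g y ^+ 2) by apply/funext => y; rewrite expr2.
by have -> : dg * g s + g s * dg = 2 * g s * dg by ring.
Qed.

Lemma is_derive_inv g s dg : g s != 0 -> is_derive s (1 : R) g dg ->
  is_derive s (1 : R) (fun y => (g y)^-1) (- dg / g s ^+ 2).
Proof.
move=> gs dgs; have -> : - dg / g s ^+ 2 = - g s ^- 2 *: dg.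
  by rewrite scaleNr -[_ *: dg]/(_ * dg) mulNr mulrC.
exact: is_deriveV.
Qed.

Lemma is_derive_lnr g s dg : 0 < g s -> is_derive s (1 : R) g dg ->
  is_derive s (1 : R) (fun y => ln (g y)) (dg / g s).
Proof.
move=> gs dgs; have dl := is_derive1_ln gs.
have := @is_derive1_comp _ (@ln R) g s _ _ dl dgs.
by rewrite mulrC.
Qed.

Lemma is_derive_expRr g s dg : is_derive s (1 : R) g dg ->
  is_derive s (1 : R) (fun y => expR (g y)) (dg * expR (g s)).
Proof.
move=> dgs; have dl := is_derive_expR (g s).
have := @is_derive1_comp _ (@expR R) g s _ _ dl dgs.
by rewrite mulrC.
Qed.

Lemma is_derive_continuous g s dg : is_derive s (1 : R) g dg -> {for s, continuous g}.
Proof.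
by case=> dgs _; apply: differentiable_continuous; apply/derivable1_diffP.
Qed.

Lemma for_continuous_cst (k s : R) : {for s, continuous (fun _ : R => k)}.
Proof. exact: cvg_cst. Qed.

Lemma for_continuousD g h s : {for s, continuous g} -> {for s, continuous h} ->
  {for s, continuous (fun y => g y + h y)}.
Proof. by move=> gs hs; exact: cvgD. Qed.

Lemma for_continuousB g h s : {for s, continuous g} -> {for s, continuous h} ->
  {for s, continuous (fun y => g y - h y)}.
Proof. by move=> gs hs; exact: cvgB. Qed.

Lemma for_continuousN g s : {for s, continuous g} -> {for s, continuous (fun y => - g y)}.
Proof. by move=> gs; exact: cvgN. Qed.

Lemma for_continuousM g h s : {for s, continuous g} -> {for s, continuous h} ->
  {for s, continuous (fun y => g y * h y)}.
Proof. by move=> gs hs; exact: cvgM. Qed.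

Lemma for_continuous_scale (k s : R) : {for s, continuous ( *%R k)}.
Proof.
by apply: (@for_continuousM (fun=> k) (fun y => y)); [exact: for_continuous_cst|exact: cvg_id].
Qed.

Lemma for_continuousV g s : g s != 0 -> {for s, continuous g} ->
  {for s, continuous (fun y => (g y)^-1)}.
Proof. by move=> gs0 gs; exact: cvgV. Qed.

Lemma for_continuous_sq g s : {for s, continuous g} -> {for s, continuous (fun y => g y ^+ 2)}.
Proof. by move=> gs; exact: (cvgM gs gs). Qed.

End derivation_rules.

(* Syntactic dispatch, as for measurability. *)
Ltac continuity := repeat first [ eassumption |
  lazymatch goal with
  | |- prop_for _ (inPhantom (continuous (fun _ => ?k))) => exact: for_continuous_cst
  | |- prop_for _ (inPhantom (continuous ( *%R _))) => exact: for_continuous_scale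
  | |- prop_for _ (inPhantom (continuous (fun y => _ + - _))) => apply: for_continuousB
  | |- prop_for _ (inPhantom (continuous (fun y => _ + _))) => apply: for_continuousD
  | |- prop_for _ (inPhantom (continuous (fun y => - _))) => apply: for_continuousN
  | |- prop_for _ (inPhantom (continuous (fun y => _ * _))) => apply: for_continuousM
  | |- prop_for _ (inPhantom (continuous (fun y => _ ^+ 2))) => apply: for_continuous_sq
  | |- prop_for _ (inPhantom (continuous (fun y => (_)^-1))) => apply: for_continuousV
  end ].

Section filter_derivatives.
Context {R : realType} (f : R) (j : R -> coefs R) (s : R) (x : nat -> R).
Hypotheses (dA : is_derive s (1 : R) (fun y => cA (j y)) (- (f * cB1 (j s))))
  (dB : is_derive s (1 : R) (fun y => cB (j y)) (cB1 (j s)))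
  (dB1 : is_derive s (1 : R) (fun y => cB1 (j y)) (cB2 (j s)))
  (dc : is_derive s (1 : R) (fun y => cc (j y)) (cc1 (j s)))
  (dc1 : is_derive s (1 : R) (fun y => cc1 (j y)) (cc2 (j s)))
  (dP : is_derive s (1 : R) (fun y => cP (j y)) (cP1 (j s)))
  (P0 : 0 < cP (j s)).

Lemma is_derive_filter0 t :
  is_derive s (1 : R) (fun y => filter0 (j y) t x) (filter1 f (j s) t x).
Proof.
elim: t => [|t IH] /=.
  apply: (is_derive_val (is_derive_mulr dc (is_derive_const (x 0%N) s))).
  by rewrite mulr0 addr0.
apply: (is_derive_val (is_derive_addr (is_derive_mulr dA IH)
  (is_derive_mulr dB (is_derive_const (x t.+1) s)))).
by rewrite /=; ring.
Qed.

Let is_derive_innovation t :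
  is_derive s (1 : R) (fun y => x t.+1 - f * filter0 (j y) t x) (- (f * filter1 f (j s) t x)).
Proof.
apply: (is_derive_val (is_derive_subr (is_derive_const (x t.+1) s)
  (is_derive_scale f (is_derive_filter0 t)))).
by rewrite sub0r.
Qed.

Lemma is_derive_filter1 t :
  is_derive s (1 : R) (fun y => filter1 f (j y) t x) (filter2 f (j s) t x).
Proof.
elim: t => [|t IH] /=.
  apply: (is_derive_val (is_derive_mulr dc1 (is_derive_const (x 0%N) s))).
  by rewrite mulr0 addr0.
apply: (is_derive_val (is_derive_addr (is_derive_mulr dA IH) (is_derive_mulr dB1 (is_derive_innovation t)))).
by rewrite /=; ring.
Qed.

Lemma is_derive_loglik t :
  is_derive s (1 : R) (fun y => loglik f (j y) t x) (score f (j s) t x).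
Proof.
elim: t => [|t IH] /=; first exact: is_derive_const.
have P1 : 2 * cP (j s) != 0 by rewrite mulf_neq0 ?gt_eqF.
have dV := @is_derive_inv _ (fun y => 2 * cP (j y)) _ _ P1 (is_derive_scale 2 dP).
apply: (is_derive_val (is_derive_subr
  (is_derive_subr IH (is_derive_mulr (is_derive_lnr P0 dP) (is_derive_const 2^-1 s)))
  (is_derive_mulr (is_derive_sq (is_derive_innovation t)) dV))).
by rewrite /=; field; rewrite gt_eqF.
Qed.

Hypotheses (kB2 : {for s, continuous (fun y => cB2 (j y))})
  (kc2 : {for s, continuous (fun y => cc2 (j y))})
  (kP1 : {for s, continuous (fun y => cP1 (j y))}).

Let kA := is_derive_continuous dA.
Let kB1 := is_derive_continuous dB1.
Let k0 t := is_derive_continuous (is_derive_filter0 t).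
Let k1 t := is_derive_continuous (is_derive_filter1 t).

Let kI t : {for s, continuous (fun y => x t.+1 - f * filter0 (j y) t x)}.
Proof. exact: is_derive_continuous (is_derive_innovation t). Qed.

Lemma continuous_filter2 t : {for s, continuous (fun y => filter2 f (j y) t x)}.
Proof.
by elim: t => [|t IH] /=; continuity; first [exact: k0 | exact: k1].
Qed.

Lemma continuous_score t : {for s, continuous (fun y => score f (j y) t x)}.
Proof.
have kP := is_derive_continuous dP; have P1 : cP (j s) != 0 by rewrite gt_eqF.
have P2 : 2 * cP (j s) != 0 by rewrite mulf_neq0.
by elim: t => [|t IH] /=; continuity; first [exact: k0 | exact: k1].
Qed.

End filter_derivatives.

(** * Van Trees' inequality along a fixed path *)

Section van_trees.
Context {R : realType}.
Local Notation leb := (@lebesgue_measure R).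
Variables (u v : R).
Hypothesis uv : u < v.
Local Notation J := (`[u, v]%classic : set R).

Lemma continuous_segment_integrable (g : R -> R) :
  (forall s, u <= s <= v -> {for s, continuous g}) -> leb.-integrable J (EFin \o g).
Proof.
move=> kg; apply: continuous_compact_integrable; first exact: segment_compact.
by apply: continuous_in_subspaceT => s; rewrite inE /= in_itv /=; exact: kg.
Qed.

Lemma integral_derivative (F g : R -> R) :
  (forall s, u <= s <= v -> is_derive s (1 : R) F (g s)) ->
  (forall s, u <= s <= v -> {for s, continuous g}) ->
  (\int[leb]_(s in J) (g s)%:E = (F v - F u)%:E)%E.
Proof.
move=> dF kg; rewrite EFinB; apply: (continuous_FTC2 uv).
- by apply: continuous_in_subspaceT => s; rewrite inE /= in_itv /=; exact: kg.
- split.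
  + by move=> s /[!in_itv] /= /andP[us sv]; case: (dF s _) => //; rewrite !ltW.
  + apply: cvg_at_right_filter; apply: is_derive_continuous (dF u _).
    by rewrite lexx ltW.
  + apply: cvg_at_left_filter; apply: is_derive_continuous (dF v _).
    by rewrite lexx ltW.
- move=> s /[!in_itv] /= /andP[us sv]; rewrite derive1E.
  by case: (dF s _) => // ; rewrite !ltW.
Qed.

Variables (m D W l S r r' : R -> R) (M lam : R).
Hypotheses (dm : forall s, u <= s <= v -> is_derive s (1 : R) m (D s))
  (dD : forall s, u <= s <= v -> is_derive s (1 : R) D (W s))
  (dl : forall s, u <= s <= v -> is_derive s (1 : R) l (S s))
  (dr : forall s, u <= s <= v -> is_derive s (1 : R) r (r' s))
  (kW : forall s, u <= s <= v -> {for s, continuous W})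
  (kS : forall s, u <= s <= v -> {for s, continuous S})
  (kr' : forall s, u <= s <= v -> {for s, continuous r'}).
Hypotheses (ru : r u = 0) (rv : r v = 0) (lam0 : 0 <= lam).

Let G s := r s * (D s * S s + W s) + 2 * r' s * D s.
Let L s := expR (l s).

(* The pointwise Cauchy-Schwarz bound 0 <= ((M - m) r - lam G)^2 L is
   integrated; (M - m) r G L - r^2 D^2 L is the derivative of
   (M - m) D r^2 L, which vanishes at both ends. *)
Lemma van_trees_pathwise :
  ((2 * lam)%:E * \int[leb]_(s in J) (r s ^+ 2 * D s ^+ 2 * L s)%:E <=
   \int[leb]_(s in J) ((M - m s) ^+ 2 * r s ^+ 2 * L s)%:E +
   (lam ^+ 2)%:E * \int[leb]_(s in J) (G s ^+ 2 * L s)%:E)%E.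
Proof.
have km s : u <= s <= v -> {for s, continuous m} by move=> /dm /is_derive_continuous.
have kD s : u <= s <= v -> {for s, continuous D} by move=> /dD /is_derive_continuous.
have kr s : u <= s <= v -> {for s, continuous r} by move=> /dr /is_derive_continuous.
have kL s : u <= s <= v -> {for s, continuous L}.
  by move=> /dl /is_derive_expRr /is_derive_continuous.
have kG s : u <= s <= v -> {for s, continuous G}.
  move=> sJ; have := km s sJ; have := kD s sJ; have := kr s sJ; have := kW sJ.
  by have := kS sJ; have := kr' sJ => ? ? ? ? ? ?; rewrite /G; continuity.
pose psi s := (M - m s) * r s * G s * L s - r s ^+ 2 * D s ^+ 2 * L s.
have kpsi s : u <= s <= v -> {for s, continuous psi}.
  move=> sJ; have := km s sJ; have := kD s sJ; have := kr s sJ; have := kG s sJ.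
  by have := kL s sJ => ? ? ? ? ?; rewrite /psi; continuity.
have psi0 : (\int[leb]_(s in J) (psi s)%:E = 0)%E.
  have dF s : u <= s <= v ->
      is_derive s (1 : R) (fun s => (M - m s) * D s * (r s ^+ 2) * L s) (psi s).
    move=> sJ; have hm := is_derive_subr (is_derive_const M s) (dm sJ).
    apply: (is_derive_val (is_derive_mulr (is_derive_mulr (is_derive_mulr hm (dD sJ))
      (is_derive_sq (dr sJ))) (is_derive_expRr (dl sJ)))).
    by rewrite /psi /G /L; ring.
  apply: etrans (integral_derivative dF kpsi) _.
  by rewrite ru rv expr0n !mulr0 !mul0r subrr.
pose q1 s := r s ^+ 2 * D s ^+ 2 * L s.
pose q2 s := (M - m s) ^+ 2 * r s ^+ 2 * L s.
pose q3 s := G s ^+ 2 * L s.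
have i1 : leb.-integrable J (EFin \o q1).
  apply: continuous_segment_integrable => s sJ; have := kD s sJ; have := kr s sJ.
  by have := kL s sJ => ? ? ?; rewrite /q1; continuity.
have i2 : leb.-integrable J (EFin \o q2).
  apply: continuous_segment_integrable => s sJ; have := km s sJ; have := kr s sJ.
  by have := kL s sJ => ? ? ?; rewrite /q2; continuity.
have i3 : leb.-integrable J (EFin \o q3).
  apply: continuous_segment_integrable => s sJ; have := kG s sJ.
  by have := kL s sJ => ? ?; rewrite /q3; continuity.
have ipsi : leb.-integrable J (EFin \o psi) by exact: continuous_segment_integrable.
have mJ : measurable (J : set (measurableTypeR R)) by exact: measurable_itv.
have iK1 := integrableZl mJ (2 * lam) i1.
have iKp := integrableZl mJ (2 * lam) ipsi.
have iK3 := integrableZl mJ (lam ^+ 2) i3.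
rewrite -!integralZl// -integralD//.
rewrite -[leLHS]adde0 -[X in (_ + X <= _)%E](mule0 (2 * lam)%:E) -psi0 -integralZl// -integralD//.
apply: le_integral => //; [exact: integrableD|exact: integrableD|].
move=> s _; rewrite -!EFinM -!EFinD lee_fin -subr_ge0.
rewrite (_ : _ - _ = ((M - m s) * r s - lam * G s) ^+ 2 * L s).
  by apply: mulr_ge0; rewrite ?sqr_ge0 ?expR_ge0.
by rewrite /psi /q1 /q2 /q3; ring.
Qed.

End van_trees.

(** The derivative of [cA] is tied to [cB1] because cA = a - f cB. The last derivatives are only
    continuous, which is what the fundamental theorem of calculus asks for. *)
Record smooth_coefs {R : realType} (f : R) (j : R -> coefs R) (s : R) : Prop := SmoothCoefs {
  deriveA : is_derive s (1 : R) (fun y => cA (j y)) (- (f * cB1 (j s)));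
  deriveB : is_derive s (1 : R) (fun y => cB (j y)) (cB1 (j s));
  deriveB1 : is_derive s (1 : R) (fun y => cB1 (j y)) (cB2 (j s));
  derivec : is_derive s (1 : R) (fun y => cc (j y)) (cc1 (j s));
  derivec1 : is_derive s (1 : R) (fun y => cc1 (j y)) (cc2 (j s));
  deriveP : is_derive s (1 : R) (fun y => cP (j y)) (cP1 (j s));
  posP : 0 < cP (j s);
  contB2 : {for s, continuous (fun y => cB2 (j y))};
  contc2 : {for s, continuous (fun y => cc2 (j y))};
  contP1 : {for s, continuous (fun y => cP1 (j y))} }.

(** * Averaging van Trees' inequality over paths *)

Section averaged_van_trees.
Context {R : realType} d (T : measurableType d).
Variables (P : R -> probability T R) (X : nat -> T -> R) (f dx : R) (j : R -> coefs R).
Variables (u v th0 : R).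
Hypotheses (uv : u < v) (th0J : u <= th0 <= v).
Hypothesis mX : forall t, measurable_fun setT (X t).
Hypothesis smooth : forall s, u <= s <= v -> smooth_coefs f j s.
Hypothesis law0 : forall s, u <= s <= v -> obs_init X dx (P s).
Hypothesis lawS : forall s, u <= s <= v -> obs_recursion X f (P s) (j s).
Variables (r r' : R -> R).
Hypotheses (dr : forall s, u <= s <= v -> is_derive s (1 : R) r (r' s))
  (kr' : forall s, u <= s <= v -> {for s, continuous r'}) (ru : r u = 0) (rv : r v = 0).

Local Notation leb := (@lebesgue_measure R).
Local Notation J := (`[u, v]%classic : set (measurableTypeR R)).

(* Clamping to J extends the integrands to jointly measurable functions on
   the whole line. *)
Let K (s : measurableTypeR R) : measurableTypeR R := Num.max u (Num.min s v).

Let KJ s : u <= K s <= v.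
Proof.
by rewrite /K le_max lexx /= ge_max (ltW uv) ge_min lexx orbT.
Qed.

Let KE s : u <= s <= v -> K s = s.
Proof. by case/andP=> us sv; rewrite /K min_l// max_r. Qed.

Let measurableK : measurable_fun setT K.
Proof.
apply: measurable_maxr; first exact: measurable_cst.
by apply: measurable_minr => //; exact: measurable_cst.
Qed.

Let measurable_on_segment (g : R -> R) : (forall s, u <= s <= v -> {for s, continuous g}) ->
  measurable_fun setT (fun y : measurableTypeR R * T => g (K y.1)).
Proof.
move=> kg; have mJ : measurable J by exact: measurable_itv.
have mg : measurable_fun J (g : measurableTypeR R -> R).
  apply: subspace_continuous_measurable_fun => //.
  by apply: continuous_in_subspaceT => s; rewrite inE /= in_itv /=; exact: kg.
apply: (@measurable_comp _ _ _ _ _ _ J g setT (fun y : measurableTypeR R * T => K y.1)) => //.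
- by move=> _ [y _ <-] /=; rewrite in_itv; exact: KJ.
- exact: (measurableT_comp measurableK measurable_fst).
Qed.

Let KjX (F : coefs R -> (nat -> R) -> R) (y : measurableTypeR R * T) : R :=
  F (j (K y.1)) (X^~ y.2).

Let mXs i : measurable_fun setT (fun y : measurableTypeR R * T => X i y.2).
Proof. exact: (measurableT_comp (mX i) measurable_snd). Qed.

Let kA s : u <= s <= v -> {for s, continuous (fun y => cA (j y))}.
Proof. by move=> /smooth /deriveA /is_derive_continuous. Qed.
Let kB s : u <= s <= v -> {for s, continuous (fun y => cB (j y))}.
Proof. by move=> /smooth /deriveB /is_derive_continuous. Qed.
Let kB1 s : u <= s <= v -> {for s, continuous (fun y => cB1 (j y))}.
Proof. by move=> /smooth /deriveB1 /is_derive_continuous. Qed.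
Let kc s : u <= s <= v -> {for s, continuous (fun y => cc (j y))}.
Proof. by move=> /smooth /derivec /is_derive_continuous. Qed.
Let kc1 s : u <= s <= v -> {for s, continuous (fun y => cc1 (j y))}.
Proof. by move=> /smooth /derivec1 /is_derive_continuous. Qed.
Let kP s : u <= s <= v -> {for s, continuous (fun y => cP (j y))}.
Proof. by move=> /smooth /deriveP /is_derive_continuous. Qed.
Let klnP s : u <= s <= v -> {for s, continuous (fun y => ln (cP (j y)))}.
Proof.
by move=> /smooth sm; exact: is_derive_continuous (is_derive_lnr (posP sm) (deriveP sm)).
Qed.
Let kPV s : u <= s <= v -> {for s, continuous (fun y => (cP (j y))^-1)}.
Proof.
move=> sJ; apply: for_continuousV; last exact: kP.
by rewrite gt_eqF// (posP (smooth sJ)).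
Qed.

Let mA := measurable_on_segment kA.
Let mB := measurable_on_segment kB.
Let mB1 := measurable_on_segment kB1.
Let mB2 := measurable_on_segment (fun s sJ => contB2 (smooth sJ)).
Let mc := measurable_on_segment kc.
Let mc1 := measurable_on_segment kc1.
Let mc2 := measurable_on_segment (fun s sJ => contc2 (smooth sJ)).
Let mlnP := measurable_on_segment klnP.
Let mPV := measurable_on_segment kPV.
Let mP1 := measurable_on_segment (fun s sJ => contP1 (smooth sJ)).

Let m0 t : measurable_fun setT (KjX (fun j x => filter0 j t x)).
Proof. exact: (measurable_filter0 mA mB mc mXs). Qed.
Let m1 t : measurable_fun setT (KjX (fun j x => filter1 f j t x)).
Proof. exact: (measurable_filter1 f mA mB mB1 mc mc1 mXs). Qed.
Let m2 t : measurable_fun setT (KjX (fun j x => filter2 f j t x)).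
Proof. exact: (measurable_filter2 f mA mB mB1 mB2 mc mc1 mc2 mXs). Qed.
Let mll t : measurable_fun setT (KjX (fun j x => loglik f j t x)).
Proof. exact: (measurable_loglik f mA mB mc mlnP mPV mXs). Qed.
Let msc t : measurable_fun setT (KjX (fun j x => score f j t x)).
Proof. exact: (measurable_score f mA mB mB1 mc mc1 mPV mP1 mXs). Qed.

Let tonelli_segment (Q : probability T R) (h : R -> T -> R) :
  measurable_fun setT (fun y : measurableTypeR R * T => h (K y.1) y.2) ->
  (forall s x, 0 <= h s x) ->
  [/\ measurable_fun setT (fun x => \int[leb]_(s in J) (h s x)%:E)%E,
      measurable_fun J (fun s => \int[Q]_x (h s x)%:E)%E
    & (\int[Q]_x \int[leb]_(s in J) (h s x)%:E = \int[leb]_(s in J) \int[Q]_x (h s x)%:E)%E].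
Proof.
move=> mh h0; have mJ : measurable J by exact: measurable_itv.
pose F (y : measurableTypeR R * T) := (\1_J y.1 * h (K y.1) y.2)%:E.
have mF : measurable_fun setT F.
  apply/measurable_EFinP; apply: measurable_funM => //.
  by apply: (measurableT_comp _ measurable_fst); exact: measurable_indic.
have F0 y : (0 <= F y)%E by rewrite lee_fin mulr_ge0.
have E1 x : (\int[leb]_(s in J) (h s x)%:E = \int[leb]_s F (s, x))%E.
  rewrite integral_mkcond; apply: eq_integral => s _; rewrite patchE /F indicE /=.
  case: ifPn => [|_]; last by rewrite mul0r.
  by rewrite inE /= in_itv /= => sJ; rewrite mul1r KE.
have mQ : measurable_fun setT (fun s => \int[Q]_x F (s, x))%E.
  exact: (@measurable_fun_fubini_tonelli_F _ _ _ _ _ Q F mF F0).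
have E2 s : s \in J -> (\int[Q]_x F (s, x) = \int[Q]_x (h s x)%:E)%E.
  rewrite inE /= in_itv /= => sJ; apply: eq_integral => x _.
  by rewrite /F indicE mem_set /= ?in_itv//= mul1r KE.
split.
- under eq_fun do rewrite E1.
  exact: (@measurable_fun_fubini_tonelli_G _ _ _ _ _ leb F mF F0).
- apply: (eq_measurable_fun (fun s => \int[Q]_x F (s, x))%E) => //.
  exact: measurable_funTS.
under eq_integral do rewrite E1.
rewrite -(@fubini_tonelli _ _ _ _ _ leb Q F mF F0).
rewrite [RHS]integral_mkcond; apply: eq_integral => s _; rewrite patchE.
case: ifPn => [|sJ]; first exact: E2.
rewrite -[RHS](integral0 Q setT); apply: eq_integral => x _.
by rewrite /F indicE (negbTE sJ) mul0r.
Qed.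

Variables (t : nat) (M : t.+1.-tuple R -> R) (lam : R).
Hypotheses (mM : measurable_fun setT M) (lam0 : 0 <= lam).

(** This is (D r^2 L)' / (r L), where L is the likelihood ratio and the derivative is in the
    parameter. *)
Definition van_trees_weight (s : R) (x : T) : R :=
  r s * (filter1 f (j s) t (X^~ x) * score f (j s) t (X^~ x) + filter2 f (j s) t (X^~ x))
  + 2 * r' s * filter1 f (j s) t (X^~ x).

Variables (Vlo risk A1 A2 rho : R).
Hypotheses (Vlo0 : 0 <= Vlo) (risk0 : 0 <= risk) (A10 : 0 <= A1) (A20 : 0 <= A2).
Hypothesis rhoE : (\int[leb]_(s in J) (r s ^+ 2)%:E = rho%:E)%E.
Hypothesis VloE : forall s, u <= s <= v ->
  (Vlo%:E <= \int[P s]_x (filter1 f (j s) t (X^~ x) ^+ 2)%:E)%E.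
Hypothesis riskE : forall s, u <= s <= v ->
  (\int[P s]_x ((M (obs X t x) - filter0 (j s) t (X^~ x)) ^+ 2)%:E <= risk%:E)%E.
Hypothesis AE : forall s, u <= s <= v ->
  (\int[P s]_x (van_trees_weight s x ^+ 2)%:E <= (A1 * r s ^+ 2 + A2)%:E)%E.

Let L s x := likelihood_ratio f (j s) (j th0) t (X^~ x).

Let mL : measurable_fun setT (fun y : measurableTypeR R * T => L (K y.1) y.2).
Proof.
apply: measurable_fun_expR; apply: measurable_funB; first exact: mll.
have mlx : measurable_fun setT (fun x => loglik f (j th0) t (X^~ x)).
  by apply: (@measurable_loglik _ _ _ f (fun=> j th0) X).
exact: (measurableT_comp mlx measurable_snd).
Qed.

Let mr : measurable_fun setT (fun y : measurableTypeR R * T => r (K y.1)).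
Proof. by apply: measurable_on_segment => s sJ; exact: is_derive_continuous (dr sJ). Qed.
Let mr' : measurable_fun setT (fun y : measurableTypeR R * T => r' (K y.1)).
Proof. exact: measurable_on_segment. Qed.

Let q1 s x := r s ^+ 2 * filter1 f (j s) t (X^~ x) ^+ 2 * L s x.
Let q2 s x := (M (obs X t x) - filter0 (j s) t (X^~ x)) ^+ 2 * r s ^+ 2 * L s x.
Let q3 s x := van_trees_weight s x ^+ 2 * L s x.

Let q1_ge0 s x : 0 <= q1 s x. Proof. by rewrite /q1; apply: mulr_ge0; [nonneg|exact: expR_ge0]. Qed.
Let q2_ge0 s x : 0 <= q2 s x. Proof. by rewrite /q2; apply: mulr_ge0; [nonneg|exact: expR_ge0]. Qed.
Let q3_ge0 s x : 0 <= q3 s x. Proof. by rewrite /q3; apply: mulr_ge0; [nonneg|exact: expR_ge0]. Qed.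

Let mMobs : measurable_fun setT (fun x => M (obs X t x)).
Proof. by apply: measurableT_comp => //; exact: measurable_obs. Qed.

Let mq1 : measurable_fun setT (fun y : measurableTypeR R * T => q1 (K y.1) y.2).
Proof.
apply: measurable_funM; last exact: mL.
by apply: measurable_funM; apply: measurable_fun_pow; [exact: mr|exact: m1].
Qed.

Let mq2 : measurable_fun setT (fun y : measurableTypeR R * T => q2 (K y.1) y.2).
Proof.
apply: measurable_funM; last exact: mL.
apply: measurable_funM; last by apply: measurable_fun_pow; exact: mr.
apply: measurable_fun_pow; apply: measurable_funB; last exact: m0.
exact: (measurableT_comp mMobs measurable_snd).
Qed.

Let mq3 : measurable_fun setT (fun y : measurableTypeR R * T => q3 (K y.1) y.2).
Proof.
apply: measurable_funM; last exact: mL.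
apply: measurable_fun_pow; apply: measurable_funD.
  apply: measurable_funM; first exact: mr.
  apply: measurable_funD; last exact: m2.
  by apply: measurable_funM; [exact: m1|exact: msc].
by apply: measurable_funM; [exact: measurable_funM|exact: m1].
Qed.

Let pathwise x :
  ((2 * lam)%:E * \int[leb]_(s in J) (q1 s x)%:E <=
   \int[leb]_(s in J) (q2 s x)%:E + (lam ^+ 2)%:E * \int[leb]_(s in J) (q3 s x)%:E)%E.
Proof.
have dll s : u <= s <= v -> is_derive s (1 : R)
    (fun s => loglik f (j s) t (X^~ x) - loglik f (j th0) t (X^~ x)) (score f (j s) t (X^~ x)).
  move=> /smooth [*]; apply: (is_derive_val (is_derive_subr _ (is_derive_const _ s))).
    exact: is_derive_loglik.
  by rewrite subr0.
have dm s : u <= s <= v ->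
  is_derive s (1 : R) (fun s => filter0 (j s) t (X^~ x)) (filter1 f (j s) t (X^~ x)).
  by move=> /smooth [*]; exact: is_derive_filter0.
have dD s : u <= s <= v ->
  is_derive s (1 : R) (fun s => filter1 f (j s) t (X^~ x)) (filter2 f (j s) t (X^~ x)).
  by move=> /smooth [*]; exact: is_derive_filter1.
have kW s : u <= s <= v -> {for s, continuous (fun s => filter2 f (j s) t (X^~ x))}.
  by move=> /smooth [*]; exact: continuous_filter2.
have kS s : u <= s <= v -> {for s, continuous (fun s => score f (j s) t (X^~ x))}.
  by move=> /smooth [*]; exact: continuous_score.
exact: (van_trees_pathwise uv (M (obs X t x)) lam dm dD dll dr kW kS kr' ru rv).
Qed.

(** Returns each expectation to its own parameter s. Only functions of the observations qualify,
    since the change of measure compares the laws of X^t alone. *)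
Let reweight (s : R) (g : T -> R) (g' : t.+1.-tuple R -> R) : u <= s <= v ->
  measurable_fun setT g' -> (forall x, g x = g' (obs X t x)) -> (forall o, 0 <= g' o) ->
  (\int[P th0]_x (g x * L s x)%:E = \int[P s]_x (g x)%:E)%E.
Proof.
move=> sJ mg' gE g0.
have mF : measurable_fun setT (fun o => (g' o)%:E) by exact/measurable_EFinP.
have F0 o : (0 <= (g' o)%:E)%E by rewrite lee_fin.
have := change_of_measure (posP (smooth sJ)) (posP (smooth th0J)) (law0 sJ) (law0 th0J)
  (lawS sJ) (lawS th0J) mF F0.
under eq_integral do rewrite -gE.
by move=> ->; apply: eq_integral => x _; rewrite gE EFinM.
Qed.

Let xE x i : (i <= t)%N -> X i x = nth 0 (obs X t x) i.
Proof. by move=> it; rewrite nth_obs. Qed.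

Let mn i : measurable_fun setT (fun o : t.+1.-tuple R => nth 0 o i).
Proof. exact: measurable_nth_tuple. Qed.

Let mf0 s : measurable_fun setT (fun o : t.+1.-tuple R => filter0 (j s) t (nth 0 o)).
Proof. by apply: (@measurable_filter0 _ _ _ (fun=> j s) (fun i (o : t.+1.-tuple R) => nth 0 o i)). Qed.
Let mf1 s : measurable_fun setT (fun o : t.+1.-tuple R => filter1 f (j s) t (nth 0 o)).
Proof. by apply: (@measurable_filter1 _ _ _ f (fun=> j s) (fun i (o : t.+1.-tuple R) => nth 0 o i)). Qed.
Let mf2 s : measurable_fun setT (fun o : t.+1.-tuple R => filter2 f (j s) t (nth 0 o)).
Proof. by apply: (@measurable_filter2 _ _ _ f (fun=> j s) (fun i (o : t.+1.-tuple R) => nth 0 o i)). Qed.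
Let mfs s : measurable_fun setT (fun o : t.+1.-tuple R => score f (j s) t (nth 0 o)).
Proof. by apply: (@measurable_score _ _ _ f (fun=> j s) (fun i (o : t.+1.-tuple R) => nth 0 o i)). Qed.

Let q1E s : u <= s <= v -> ((Vlo * r s ^+ 2)%:E <= \int[P th0]_x (q1 s x)%:E)%E.
Proof.
move=> sJ; rewrite (@reweight s _ (fun o => r s ^+ 2 * filter1 f (j s) t (nth 0 o) ^+ 2))//.
- under eq_integral do rewrite EFinM.
  rewrite ge0_integralZl//.
  + by rewrite mulrC EFinM; apply: lee_wpmul2l; [rewrite lee_fin sqr_ge0|exact: VloE].
  + apply/measurable_EFinP; apply: measurable_fun_pow.
    by apply: (@measurable_filter1 _ _ _ f (fun=> j s) X).
  + by move=> x _; rewrite lee_fin sqr_ge0.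
  + by rewrite lee_fin sqr_ge0.
- by apply: measurable_funM => //; apply: measurable_fun_pow.
- by move=> x; rewrite (eq_filter1 f (j s) (@xE x)).
- by move=> o; nonneg.
Qed.

Let q2E s : u <= s <= v -> (\int[P th0]_x (q2 s x)%:E <= (risk * r s ^+ 2)%:E)%E.
Proof.
move=> sJ; rewrite (@reweight s _ (fun o => (M o - filter0 (j s) t (nth 0 o)) ^+ 2 * r s ^+ 2))//.
- under eq_integral do rewrite mulrC EFinM.
  rewrite ge0_integralZl//.
  + by rewrite [risk * _]mulrC [X in (_ <= X)%E]EFinM; apply: lee_wpmul2l;
      [rewrite lee_fin sqr_ge0|exact: riskE].
  + apply/measurable_EFinP; apply: measurable_fun_pow; apply: measurable_funB => //.
    by apply: (@measurable_filter0 _ _ _ (fun=> j s) X).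
  + by move=> x _; rewrite lee_fin sqr_ge0.
  + by rewrite lee_fin sqr_ge0.
- by apply: measurable_funM => //; apply: measurable_fun_pow; exact: measurable_funB.
- by move=> x; rewrite (eq_filter0 (j s) (@xE x)).
- by move=> o; nonneg.
Qed.

Let q3E s : u <= s <= v -> (\int[P th0]_x (q3 s x)%:E <= (A1 * r s ^+ 2 + A2)%:E)%E.
Proof.
move=> sJ; rewrite (@reweight s _ (fun o => (r s * (filter1 f (j s) t (nth 0 o) *
  score f (j s) t (nth 0 o) + filter2 f (j s) t (nth 0 o))
  + 2 * r' s * filter1 f (j s) t (nth 0 o)) ^+ 2))//.
- exact: AE.
- have := mf1 s; have := mf2 s; have := mfs s => ? ? ?.
  by measurability.
- move=> x; rewrite /van_trees_weight (eq_filter1 f (j s) (@xE x)).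
  by rewrite (eq_filter2 f (j s) (@xE x)) (eq_score f (j s) (@xE x)).
- by move=> o; nonneg.
Qed.

(** The pathwise inequality is integrated under [P th0]; Tonelli brings the parameter outside, and
    reweighting replaces each inner integral by an expectation under [P s], where the uniform bounds
    apply. *)
Lemma averaged_van_trees :
  2 * lam * Vlo * rho <= risk * rho + lam ^+ 2 * (A1 * rho + A2 * (v - u)).
Proof.
have mJ : measurable J by exact: measurable_itv.
have [m11 m12 T1] := tonelli_segment (P th0) mq1 q1_ge0.
have [m21 m22 T2] := tonelli_segment (P th0) mq2 q2_ge0.
have [m31 m32 T3] := tonelli_segment (P th0) mq3 q3_ge0.
have lam20 : 0 <= lam ^+ 2 by exact: sqr_ge0.
have lam2 : 0 <= 2 * lam by exact: mulr_ge0.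
have ge0 (h : R -> T -> R) x : (forall s x, 0 <= h s x) -> (0 <= \int[leb]_(s in J) (h s x)%:E)%E.
  by move=> h0; apply: integral_ge0 => s _; rewrite lee_fin.
have avg : ((2 * lam)%:E * \int[leb]_(s in J) \int[P th0]_x (q1 s x)%:E <=
    \int[leb]_(s in J) \int[P th0]_x (q2 s x)%:E +
    (lam ^+ 2)%:E * \int[leb]_(s in J) \int[P th0]_x (q3 s x)%:E)%E.
  rewrite -T1 -T2 -T3 -!ge0_integralZl//; last 2 first.
  - by move=> x _; exact: ge0.
  - by move=> x _; exact: ge0.
  rewrite -ge0_integralD//; last 3 first.
  - by move=> x _; exact: ge0.
  - by move=> x _; rewrite mule_ge0//; exact: ge0.
  - exact: measurable_funeM.
  apply: ge0_le_integral => //.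
  - by move=> x _; rewrite mule_ge0//; exact: ge0.
  - exact: measurable_funeM.
  - by apply: emeasurable_funD => //; exact: measurable_funeM.
have sJE s : J s -> u <= s <= v by rewrite /= in_itv.
have mrJ : measurable_fun J (fun s => (r s ^+ 2)%:E).
  apply/measurable_EFinP; apply: subspace_continuous_measurable_fun => //.
  apply: continuous_in_subspaceT => s; rewrite inE /= in_itv /= => sJ.
  by apply: for_continuous_sq; exact: is_derive_continuous (dr sJ).
have mkr2 (k : R) : measurable_fun J (fun s => (k * r s ^+ 2)%:E).
  have -> : (fun s => (k * r s ^+ 2)%:E) = (fun s => k%:E * (r s ^+ 2)%:E)%E.
    by apply/funext => s; rewrite EFinM.
  exact: measurable_funeM.
have int_r2 (k : R) : 0 <= k -> (\int[leb]_(s in J) (k * r s ^+ 2)%:E = (k * rho)%:E)%E.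
  move=> k0; under eq_integral do rewrite EFinM.
  by rewrite ge0_integralZl// ?rhoE// => s _; rewrite lee_fin sqr_ge0.
have low : ((Vlo * rho)%:E <= \int[leb]_(s in J) \int[P th0]_x (q1 s x)%:E)%E.
  rewrite -int_r2//; apply: ge0_le_integral => //.
  - by move=> s _; rewrite lee_fin; nonneg.
have up2 : (\int[leb]_(s in J) \int[P th0]_x (q2 s x)%:E <= (risk * rho)%:E)%E.
  rewrite -int_r2//; apply: ge0_le_integral => //.
  - by move=> s _; apply: integral_ge0 => x _; rewrite lee_fin.
have up3 : (\int[leb]_(s in J) \int[P th0]_x (q3 s x)%:E <= (A1 * rho + A2 * (v - u))%:E)%E.
  have -> : ((A1 * rho + A2 * (v - u))%:E = \int[leb]_(s in J) (A1 * r s ^+ 2 + A2)%:E)%E.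
    under eq_integral do rewrite EFinD.
    rewrite ge0_integralD//; last by move=> s _; rewrite lee_fin; nonneg.
    rewrite int_r2// integral_cst//= lebesgue_measure_itv/= lte_fin uv.
    by rewrite -EFinB -EFinM -EFinD.
  apply: ge0_le_integral => //.
  - by move=> s _; apply: integral_ge0 => x _; rewrite lee_fin.
  - exact: (@emeasurable_funD _ _ _ J (fun s => (A1 * r s ^+ 2)%:E) (fun=> A2%:E)).
rewrite -lee_fin; apply: (@le_trans _ _ ((2 * lam)%:E * (Vlo * rho)%:E)%E).
  by rewrite -EFinM lee_fin mulrA.
apply: le_trans (lee_wpmul2l _ low) _; first by rewrite lee_fin.
apply: le_trans avg _; rewrite EFinD [(lam ^+ 2 * _)%:E]EFinM; apply: leeD => //.
by apply: lee_wpmul2l => //; rewrite lee_fin.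
Qed.

End averaged_van_trees.

(** * Calculus of the Riccati solution *)

(** By continuity c keeps its sign near s, so there it equals that sign times the square root of
    c^2. *)
Lemma is_derive_continuous_root {R : realType} (c : R -> R) (s dc : R) :
  {for s, continuous c} -> c s != 0 -> is_derive s (1 : R) (fun y => c y ^+ 2) dc ->
  is_derive s (1 : R) c (dc / (2 * c s)).
Proof.
move=> kc c0 dc2; pose k := Num.sg (c s).
have c2 : 0 < c s ^+ 2 by rewrite exprn_even_gt0.
have ds := is_derive1_sqrt c2.
have dcs := is_derive_scale k (@is_derive1_comp _ Num.sqrt (fun y => c y ^+ 2) s _ _ ds dc2).
have near_c : \near s, k * Num.sqrt (c s ^+ 2) = c s.
  have : \forall y \near s, 0 < c s * c y.
    have kcc : {for s, continuous (fun y => c s * c y)}.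
      by apply: for_continuousM => //; exact: for_continuous_cst.
    by apply: (cvgr_gt _ kcc); rewrite -expr2.
  apply: filterS => y cy; rewrite sqrtr_sqr /k.
  have [cs|cs] := ltP 0 (c s).
    by rewrite gtr0_sg// mul1r gtr0_norm//; move: cy; rewrite pmulr_rgt0.
  have cs' : c s < 0 by rewrite lt_neqAle c0.
  by rewrite ltr0_sg// mulN1r ltr0_norm ?opprK//; move: cy; rewrite nmulr_rgt0.
apply: (near_eq_is_derive near_c); apply: (is_derive_val dcs).
rewrite /k sqrtr_sqr; have := numEsg (c s); set e := Num.sg _ => cE.
have e2 : e ^+ 2 = 1 by rewrite /e sqr_sg c0.
have nc0 : `|c s| != 0 by rewrite normr_eq0.
have e0 : e != 0 by rewrite -sqrf_eq0 e2 oner_eq0.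
rewrite {2}cE; move: (`|c s|) nc0 => n n0.
rewrite (_ : dc / (2 * (e * n)) = e ^+ 2 * (dc / (2 * (e * n)))); last by rewrite e2 mul1r.
by field; rewrite n0 e0.
Qed.

(** * The Riccati solution, its derivatives and the constant *)

Section coefficient_calculus.
Context {R : realType}.
Variables (f a sigma : R).
Hypotheses (f0 : f != 0) (a01 : 0 <= a ^+ 2 < 1) (sigma20 : 0 < sigma ^+ 2).

Local Notation gam := (gamma_star f a sigma).
Local Notation PP := (P_coef f a sigma).

Definition riccati_discr (th : R) : R :=
  (sigma ^+ 2 * (1 - a ^+ 2) / f ^+ 2 - th ^+ 2) ^+ 2 + 4 * th ^+ 2 * sigma ^+ 2 / f ^+ 2.

Local Notation Q := riccati_discr.
Local Notation sQ := (fun th : R => Num.sqrt (Q th)).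

Definition discr1 (th : R) : R :=
  4 * th * (th ^+ 2 - sigma ^+ 2 * (1 - a ^+ 2) / f ^+ 2) + 8 * th * (sigma ^+ 2 / f ^+ 2).

Definition discr2 (th : R) : R :=
  12 * th ^+ 2 - 4 * (sigma ^+ 2 * (1 - a ^+ 2) / f ^+ 2) + 8 * (sigma ^+ 2 / f ^+ 2).

Definition gamma1 (th : R) : R := th + discr1 th / (4 * Num.sqrt (Q th)).

Definition gamma2 (th : R) : R :=
  1 + (discr2 th * Num.sqrt (Q th) - discr1 th * (discr1 th / (2 * Num.sqrt (Q th))))
      / (4 * Q th).

Section at_parameter.
Variable th : R.
Hypothesis th0 : 0 < th.

Let f20 : 0 < f ^+ 2. Proof. by rewrite exprn_even_gt0. Qed.

Lemma discr_gt0 : 0 < Q th.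
Proof.
by rewrite /Q ltr_wpDl ?sqr_ge0// mulr_gt0 ?invr_gt0// mulr_gt0// mulr_gt0// exprn_gt0.
Qed.

Let sq2 : Num.sqrt (Q th) ^+ 2 = Q th. Proof. by rewrite sqr_sqrtr// ltW// discr_gt0. Qed.
Let sq0 : 0 < Num.sqrt (Q th). Proof. by rewrite sqrtr_gt0 discr_gt0. Qed.

Lemma gamma_starE : gam th = (th ^+ 2 - sigma ^+ 2 * (1 - a ^+ 2) / f ^+ 2 + Num.sqrt (Q th)) / 2.
Proof. by rewrite /gam /Q; field. Qed.

Lemma gamma_star_gt0 : 0 < gam th.
Proof.
rewrite gamma_starE divr_gt0//.
have := sq2; rewrite {2}/Q; move: sq0; set s := Num.sqrt _; set k := _ / f ^+ 2.
have : 0 < 4 * th ^+ 2 * sigma ^+ 2 / f ^+ 2.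
  by rewrite mulr_gt0 ?invr_gt0// mulr_gt0// mulr_gt0// exprn_gt0.
set e := _ / _; clearbody s k e => e0 s0 s2.
have [ks|ks] := ltP (k - th ^+ 2) 0; first by lra.
suff : k - th ^+ 2 < s by lra.
by rewrite -ltr_sqr ?nnegrE ?(ltW s0)// s2 ltrDl.
Qed.

Lemma P_coef_gt0 : 0 < PP th.
Proof. by rewrite ltr_pwDl// mulr_ge0 ?sqr_ge0// ltW// gamma_star_gt0. Qed.

(** The Riccati equation cleared of denominators; [gamma_star] is its positive root. *)
Lemma gamma_star_quadratic :
  th ^+ 2 * PP th = gam th * (sigma ^+ 2 * (1 - a ^+ 2) + f ^+ 2 * gam th).
Proof.
rewrite /PP gamma_starE; have := sq2; rewrite {2}/Q; set s := Num.sqrt _; clearbody s.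
move=> s2; apply/eqP; rewrite -subr_eq0; apply/eqP.
transitivity (f ^+ 2 / 4 * ((sigma ^+ 2 * (1 - a ^+ 2) / f ^+ 2 - th ^+ 2) ^+ 2
   + 4 * th ^+ 2 * sigma ^+ 2 / f ^+ 2 - s ^+ 2)); first by field.
by rewrite s2 subrr mulr0.
Qed.

Lemma riccati_equation :
  gam th = th ^+ 2 + a ^+ 2 * sigma ^+ 2 * gam th / PP th.
Proof.
have P0 := P_coef_gt0; have := gamma_star_quadratic; rewrite /PP in P0 *.
set g := gam th in P0 *; clearbody g => E.
have -> : th ^+ 2 = g * (sigma ^+ 2 * (1 - a ^+ 2) + f ^+ 2 * g) / (sigma ^+ 2 + f ^+ 2 * g).
  by rewrite -E mulfK// gt_eqF.
by field; rewrite gt_eqF.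
Qed.

Let is_derive_sQ : is_derive th (1 : R) sQ (discr1 th / (2 * Num.sqrt (Q th))).
Proof.
have dth : is_derive th (1 : R) (fun y => y) 1 by exact: is_derive_id.
have dQ : is_derive th (1 : R) Q (discr1 th).
  apply: (is_derive_val (is_derive_addr
    (is_derive_sq (is_derive_subr (is_derive_const _ th) (is_derive_sq dth)))
    (is_derive_mulr (is_derive_mulr (is_derive_scale 4 (is_derive_sq dth))
      (is_derive_const (sigma ^+ 2) th)) (is_derive_const (f ^+ 2)^-1 th)))).
  by rewrite /discr1; field.
have := @is_derive1_comp _ Num.sqrt Q th _ _ (is_derive1_sqrt discr_gt0) dQ.
by rewrite mulrC.
Qed.

Lemma is_derive_gamma_star : is_derive th (1 : R) gam (gamma1 th).
Proof.
have dth : is_derive th (1 : R) (fun y => y) 1 by exact: is_derive_id.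
apply: (is_derive_val (is_derive_addr (is_derive_mulr (is_derive_subr
  (is_derive_scale (f ^+ 2) (is_derive_sq dth)) (is_derive_const _ th)) (is_derive_const (2 * f ^+ 2)^-1 th))
  (is_derive_scale 2^-1 is_derive_sQ))).
by rewrite /gamma1; move: sq0; set s := Num.sqrt _; clearbody s => s0; field; rewrite f0 gt_eqF.
Qed.

Lemma is_derive_gamma1 : is_derive th (1 : R) gamma1 (gamma2 th).
Proof.
have dth : is_derive th (1 : R) (fun y => y) 1 by exact: is_derive_id.
have dd1 : is_derive th (1 : R) discr1 (discr2 th).
  apply: (is_derive_val (is_derive_addr
    (is_derive_mulr (is_derive_scale 4 dth) (is_derive_subr (is_derive_sq dth) (is_derive_const _ th)))
    (is_derive_mulr (is_derive_scale 8 dth) (is_derive_const _ th)))).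
  by rewrite /discr2; field.
have s4 : 4 * Num.sqrt (Q th) != 0 by rewrite mulf_neq0// gt_eqF.
apply: (is_derive_val (is_derive_addr dth (is_derive_mulr dd1
  (@is_derive_inv _ (fun y => 4 * Num.sqrt (Q y)) _ _ s4 (is_derive_scale 4 is_derive_sQ))))).
rewrite /gamma2 -{6}sq2; move: sq0; set s := Num.sqrt _; clearbody s => s0; field; rewrite gt_eqF//.
Qed.

Lemma continuous_gamma2 : {for th, continuous gamma2}.
Proof.
have kth : {for th, continuous (fun y : R => y)} by exact: cvg_id.
have ks := is_derive_continuous is_derive_sQ.
have s2 : 2 * Num.sqrt (Q th) != 0 by rewrite mulf_neq0// gt_eqF.
have Q4 : 4 * Q th != 0 by rewrite mulf_neq0// gt_eqF// discr_gt0.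
have kd1 : {for th, continuous discr1} by rewrite /discr1; continuity.
have kQ : {for th, continuous Q} by rewrite /Q; continuity.
have kd2 : {for th, continuous discr2} by rewrite /discr2; continuity.
by rewrite /gamma2; continuity.
Qed.

Lemma is_derive_P_coef : is_derive th (1 : R) PP (f ^+ 2 * gamma1 th).
Proof.
apply: (is_derive_val (is_derive_addr (is_derive_const (sigma ^+ 2) th)
  (is_derive_scale (f ^+ 2) is_derive_gamma_star))).
by rewrite add0r.
Qed.

End at_parameter.

(** The quadratic equation gives th^2 as an increasing function of gamma; after clearing
    denominators the difference of two values factors through g - g' with a nonnegative cofactor.
    Strictness is what later keeps the regression coefficient nonzero. *)
Lemma gamma_star_lt (th th' : R) : 0 < th -> th < th' -> gam th < gam th'.
Proof.
move=> th0 tt; have th'0 := lt_trans th0 tt.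
have E := gamma_star_quadratic th0; have E' := gamma_star_quadratic th'0.
have P0 := P_coef_gt0 th0; have P'0 := P_coef_gt0 th'0.
have g0 := gamma_star_gt0 th0; have g'0 := gamma_star_gt0 th'0.
rewrite ltNge; apply/negP => gg.
have t2 : th ^+ 2 < th' ^+ 2 by rewrite ltrXn2r// ?nnegrE// ltW.
have : th ^+ 2 * (PP th * PP th') < th' ^+ 2 * (PP th * PP th') by rewrite ltr_pM2r// mulr_gt0.
apply/negP; rewrite -leNgt.
rewrite [leRHS]mulrA E [PP th * _]mulrC [leLHS]mulrA E' /PP -subr_ge0.
set g := gam th in g0 gg *; set g' := gam th' in g'0 gg *.
rewrite (_ : _ - _ = (g - g') * (f ^+ 4 * g * g' + f ^+ 2 * sigma ^+ 2 * (g + g')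
  + (sigma ^+ 2) ^+ 2 * (1 - a ^+ 2))); last by ring.
apply: mulr_ge0; first by rewrite subr_ge0.
have a1 : 0 <= 1 - a ^+ 2 by case/andP: a01 => _ a1; rewrite subr_ge0 ltW.
by nonneg.
Qed.

Section coefficient_family.
Variables (c : R -> R) (dx : R).

(** The entries [cc1] and [cc2] come from differentiating dy^2 - gamma = c^2 dx^2 twice; dividing by
    c is why c must not vanish. *)
Definition model_coefs (th : R) : coefs R :=
  let B1 := a * f * sigma ^+ 2 * gamma1 th / PP th ^+ 2 in
  let c1 := - gamma1 th / (2 * c th * dx ^+ 2) in
  {| cA := a - f * (a * f * gam th / PP th);
     cB := a * f * gam th / PP th;
     cB1 := B1;
     cB2 := a * f * sigma ^+ 2 * (gamma2 th / PP th ^+ 2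
              - 2 * gamma1 th * (f ^+ 2 * gamma1 th) / PP th ^+ 3);
     cc := c th;
     cc1 := c1;
     cc2 := - (gamma2 th * c th - gamma1 th * c1) / (2 * c th ^+ 2 * dx ^+ 2);
     cP := PP th;
     cP1 := f ^+ 2 * gamma1 th |}.

Variable (dy2 th : R).
Hypotheses (th0 : 0 < th) (dx0 : dx != 0) (c0 : c th != 0).
Hypothesis kc : {for th, continuous c}.
Hypothesis c2 : \forall s \near th, dy2 - gam s = c s ^+ 2 * dx ^+ 2.

Let dgam := is_derive_gamma_star th0.
Let dP := is_derive_P_coef th0.
Let dgam1 := is_derive_gamma1 th0.
Let P0 := P_coef_gt0 th0.
Let Pn : PP th != 0. Proof. by rewrite gt_eqF. Qed.
Let PV := is_derive_inv Pn dP.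

Let P2n : PP th ^+ 2 != 0. Proof. by rewrite expf_neq0. Qed.

Let dB : is_derive th (1 : R) (fun y => a * f * gam y / PP y) (cB1 (model_coefs th)).
Proof.
apply: (is_derive_val (is_derive_mulr (is_derive_scale (a * f) dgam) PV)).
by move: Pn; rewrite /= /PP => ?; field.
Qed.

Let dB1 : is_derive th (1 : R) (fun y => cB1 (model_coefs y)) (cB2 (model_coefs th)).
Proof.
apply: (is_derive_val (is_derive_mulr (is_derive_scale (a * f * sigma ^+ 2) dgam1)
  (@is_derive_inv _ (fun y => PP y ^+ 2) _ _ P2n (is_derive_sq dP)))).
by rewrite /=; field.
Qed.

Let dc : is_derive th (1 : R) c (cc1 (model_coefs th)).
Proof.
have dxn : dx ^+ 2 != 0 by rewrite expf_neq0.
have dc2 : is_derive th (1 : R) (fun y => c y ^+ 2) (- gamma1 th / dx ^+ 2).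
  apply: (near_eq_is_derive (f := fun y => (dy2 - gam y) / dx ^+ 2)).
    by apply: filterS c2 => y ->; rewrite mulfK.
  apply: (is_derive_val (is_derive_mulr (is_derive_subr (is_derive_const dy2 th) dgam)
    (is_derive_const (dx ^+ 2)^-1 th))).
  by rewrite mulr0 addr0 sub0r.
apply: (is_derive_val (is_derive_continuous_root kc c0 dc2)).
by rewrite /=; field; rewrite c0 dx0.
Qed.

Let dc1 : is_derive th (1 : R) (fun y => cc1 (model_coefs y)) (cc2 (model_coefs th)).
Proof.
have n2 : 2 * c th * dx ^+ 2 != 0 by rewrite !mulf_neq0 ?expf_neq0.
apply: (is_derive_val (is_derive_mulr (is_derive_oppr dgam1)
  (@is_derive_inv _ (fun y => 2 * c y * dx ^+ 2) _ _ n2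
     (is_derive_mulr (is_derive_scale 2 dc) (is_derive_const (dx ^+ 2) th))))).
by rewrite /=; field; rewrite c0 dx0.
Qed.

Lemma model_coefs_smooth : smooth_coefs f model_coefs th.
Proof.
have kg := is_derive_continuous dgam; have kg1 := is_derive_continuous dgam1.
have kg2 := continuous_gamma2 th0; have kP := is_derive_continuous dP.
have P3 : PP th ^+ 3 != 0 by rewrite expf_neq0.
have n2 : 2 * c th * dx ^+ 2 != 0 by rewrite !mulf_neq0 ?expf_neq0.
have n3 : 2 * c th ^+ 2 * dx ^+ 2 != 0 by rewrite !mulf_neq0 ?expf_neq0.
split.
- apply: (is_derive_val (is_derive_subr (is_derive_const a th) (is_derive_scale f dB))).
  by rewrite sub0r.
- exact: dB.
- exact: dB1.
- exact: dc.
- exact: dc1.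
- exact: dP.
- exact: P0.
- have kP3 : {for th, continuous (fun y => PP y ^+ 3)}.
    exact: (for_continuousM kP (for_continuous_sq kP)).
  by rewrite /=; continuity.
- by rewrite /=; continuity.
- by rewrite /=; continuity.
Qed.

End coefficient_family.

(* V and the Fisher information do not involve c and dx, here set to 1. *)
Lemma S_b_star_sqE (th : R) : 0 < th ->
  let j := model_coefs (fun=> 1) 1 th in
  let V := cB1 j ^+ 2 * cP j / (1 - cA j ^+ 2) in
  S_b_star_sq f a sigma th = V / (2 * (cP1 j / (2 * cP j)) ^+ 2 + f ^+ 2 / cP j * V).
Proof.
move=> th0 j V.
have P0 := P_coef_gt0 th0.
have g1 : derive1 gam th = gamma1 th.
  by rewrite derive1E; case: (is_derive_gamma_star th0).
have P1 : derive1 PP th = f ^+ 2 * gamma1 th.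
  by rewrite derive1E; case: (is_derive_P_coef th0).
have AE : cA j = a * sigma ^+ 2 / PP th.
  by move: P0; rewrite /= /PP => p0; field; rewrite gt_eqF.
have P32 : (PP th `^ (3 / 2)) ^+ 2 = PP th ^+ 3.
  by rewrite -powR_mulrn ?powR_ge0// -powRrM divfK// powR_mulrn// ltW.
have Ps : sigma ^+ 2 < PP th by rewrite /PP ltrDl mulr_gt0 ?gamma_star_gt0// exprn_even_gt0.
have A2 : PP th ^+ 2 - a ^+ 2 * sigma ^+ 4 != 0.
  rewrite gt_eqF// subr_gt0 (_ : sigma ^+ 4 = (sigma ^+ 2) ^+ 2); last by ring.
  have [a20 a21] := andP a01.
  apply: (@le_lt_trans _ _ ((sigma ^+ 2) ^+ 2)); last by rewrite ltrXn2r// ?nnegrE ltW.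
  by rewrite ler_piMl ?sqr_ge0// ltW.
have Pn : PP th != 0 by rewrite gt_eqF.
have A1 : 1 - A_coef f a sigma th ^+ 2 != 0.
  rewrite (_ : _ - _ = (PP th ^+ 2 - a ^+ 2 * sigma ^+ 4) / PP th ^+ 2).
    by rewrite mulf_neq0// invr_eq0 expf_neq0.
  by rewrite /A_coef; field.
(* [dotB_star] is [cB1] times the square root of P, the deviation of the noise that drives D;
   dividing its square by 1 - A^2 gives the stationary variance V. *)
have BV : dotB_star f a sigma th ^+ 2 = V * (1 - A_coef f a sigma th ^+ 2).
  rewrite /V AE divfK// /dotB_star g1 expr_div_n P32 /=; move: (PP th) Pn => p pn.
  by field.
have IE : I_b f a sigma th = 2 * (cP1 j / (2 * cP j)) ^+ 2 + f ^+ 2 / cP j * V.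
  rewrite /I_b P1 /V AE /=; move: (PP th) Pn A2 => p pn A2.
  have A2' : p ^+ 2 - (a * sigma ^+ 2) ^+ 2 != 0.
    by rewrite (_ : _ - _ = p ^+ 2 - a ^+ 2 * sigma ^+ 4)//; ring.
  by field; rewrite pn A2'.
by rewrite /S_b_star_sq BV IE -mulf_div divff// mulr1.
Qed.

End coefficient_calculus.

(** * The local lower bound *)

Section weight_moment.
Context {R : realType} d (T : measurableType d) (P : probability T R).
Variables (X : nat -> T -> R) (f dx : R) (j : coefs R).
Hypothesis mX : forall t, measurable_fun setT (X t).
Hypothesis P0 : 0 < cP j.
Hypotheses (law0 : obs_init X dx P) (lawS : obs_recursion X f P j).
Variables (Ab bb Cb kb db gb eb wb : R).
Hypotheses (Ab01 : 0 <= Ab < 1) (AbE : cA j ^+ 2 <= Ab) (bbE : cB1 j ^+ 2 * cP j <= bb)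
  (CbE : f ^+ 2 / cP j <= Cb) (kbE : (cP1 j / (2 * cP j)) ^+ 2 <= kb)
  (dbE : cc1 j ^+ 2 * dx ^+ 2 <= db) (gbE : 4 * f ^+ 2 * cB1 j ^+ 2 <= gb)
  (ebE : cB2 j ^+ 2 * cP j <= eb) (wbE : cc2 j ^+ 2 * dx ^+ 2 <= wb).

(** Bounds the part of the weight that stays bounded in t: (r W + 2 r' D)^2 <= 2 W^2 + 8 p D^2,
    where p bounds r'^2, at the price 1 + 1/delta of splitting it off. *)
Definition weight_remainder (delta p : R) : R :=
  (1 + delta^-1) * (2 * W2_bound Ab bb db gb eb wb + 8 * p * (db + bb / (1 - Ab))).

(** Only r D S grows with t, so (x + y)^2 <= (1 + delta) x^2 + (1 + 1/delta) y^2 is used with the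
    factor close to 1 on that term. *)
Lemma weight_moment (delta p r r' : R) t : 0 < delta -> r ^+ 2 <= 1 -> r' ^+ 2 <= p ->
  (\int[P]_x ((r * (filter1 f j t (X^~ x) * score f j t (X^~ x) + filter2 f j t (X^~ x))
     + 2 * r' * filter1 f j t (X^~ x)) ^+ 2)%:E <=
   ((1 + delta) * D2S2_bound Ab bb Cb kb db delta t * r ^+ 2 + weight_remainder delta p)%:E)%E.
Proof.
move=> d0 r1 rp; have p0 : 0 <= p by apply: le_trans rp; exact: sqr_ge0.
have mD : measurable_fun setT (fun x => filter1 f j t (X^~ x)).
  by apply: (@measurable_filter1 _ _ _ f (fun=> j) X).
have mW : measurable_fun setT (fun x => filter2 f j t (X^~ x)).
  by apply: (@measurable_filter2 _ _ _ f (fun=> j) X).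
have mS : measurable_fun setT (fun x => score f j t (X^~ x)).
  by apply: (@measurable_score _ _ _ f (fun=> j) X).
have d1 : 0 <= 1 + delta^-1 by nonneg.
apply: (@le_trans _ _ (\int[P]_x (0 + (1 + delta) * r ^+ 2 *
    (filter1 f j t (X^~ x) * score f j t (X^~ x)) ^+ 2
  + (1 + delta^-1) * 2 * filter2 f j t (X^~ x) ^+ 2
  + (1 + delta^-1) * 8 * p * filter1 f j t (X^~ x) ^+ 2)%:E)%E).
  apply: le_integral_EFin.
  - by measurability.
  - by measurability.
  - by move=> x; exact: sqr_ge0.
  - move=> x; move: (filter1 _ _ _ _) (filter2 _ _ _ _) (score _ _ _ _) => D W S.
    have y2 : (r * W + 2 * r' * D) ^+ 2 <= 2 * W ^+ 2 + 8 * p * D ^+ 2.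
      apply: (@le_trans _ _ (2 * (r ^+ 2 * W ^+ 2) + 8 * (r' ^+ 2 * D ^+ 2))).
        rewrite -subr_ge0 (_ : _ - _ = (r * W - 2 * r' * D) ^+ 2); first exact: sqr_ge0.
        by ring.
      apply: lerD.
        by rewrite ler_pM2l// ler_piMl// sqr_ge0.
      by rewrite -mulrA ler_pM2l// ler_wpM2r// sqr_ge0.
    rewrite (_ : r * (D * S + W) + 2 * r' * D = r * (D * S) + (r * W + 2 * r' * D)); last by ring.
    move: (D * S) (r * W + 2 * r' * D) y2 => z y y2.
    apply: (@le_trans _ _ ((1 + delta) * (r * z) ^+ 2 + (1 + delta^-1) * y ^+ 2)).
      rewrite -subr_ge0 (_ : _ - _ = (delta * (r * z) - y) ^+ 2 / delta); first by nonneg.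
      by field; rewrite gt_eqF.
    rewrite add0r -addrA; apply: lerD; first by rewrite exprMn mulrA.
    apply: le_trans (ler_wpM2l d1 y2) _.
    by rewrite le_eqVlt; apply/orP; left; apply/eqP; ring.
rewrite integral_lin3.
- rewrite (moment_D2 mX P0 law0 lawS) add0e.
  have hW := moment_W2 mX P0 law0 lawS Ab01 AbE bbE dbE gbE ebE wbE t.
  have hDS := moment_D2S2 mX P0 law0 lawS Ab01 AbE bbE CbE kbE dbE t d0.
  have hD : sensitivity dx j t <= db + bb / (1 - Ab).
    apply: le_trans (sensitivity_le P0 Ab01 AbE bbE dbE t) _.
    have [Ab0 Ab1] := andP Ab01.
    rewrite lerD2r ler_piMl ?exprn_ile1 ?(ltW Ab1)//.
    by apply: le_trans dbE; nonneg.
  apply: (@le_trans _ _ (((1 + delta) * r ^+ 2)%:E * (D2S2_bound Ab bb Cb kb db delta t)%:E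
    + ((1 + delta^-1) * 2)%:E * (W2_bound Ab bb db gb eb wb)%:E
    + ((1 + delta^-1) * 8 * p)%:E * (db + bb / (1 - Ab))%:E)%E).
    apply: leeD; first apply: leeD.
    + by apply: lee_wpmul2l => //; rewrite lee_fin; nonneg.
    + by apply: lee_wpmul2l => //; rewrite lee_fin; nonneg.
    + by apply: lee_wpmul2l => //; rewrite lee_fin; nonneg.
  rewrite -!EFinM -!EFinD lee_fin /weight_remainder.
  by rewrite le_eqVlt; apply/orP; left; apply/eqP; ring.
- by [].
- by nonneg.
- by nonneg.
- by nonneg.
- by apply: measurable_fun_pow; exact: measurable_funM.
- exact: measurable_fun_pow.
- exact: measurable_fun_pow.
- by move=> x; exact: sqr_ge0.
- by move=> x; exact: sqr_ge0.
- by move=> x; exact: sqr_ge0.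
Qed.

End weight_moment.

Section eventual_bound.
Context {R : realType}.
Variables (Al bl Ab bb Cb kb db delta mu K : R).

(** The limit of t times the van Trees bound for lam = mu / t. With delta = 0, unperturbed
    coefficients and mu = 1 / I it is 2 V / I - V I / I^2 = V / I. *)
Definition limit_bound : R :=
  2 * mu * (bl / (1 - Al))
  - mu ^+ 2 * ((1 + delta) * ((bb + delta) * (Cb * (bb / (1 - Ab)) + 2 * kb) / (1 - Ab))).

Lemma eventual_bound (eps : R) : 0 <= Al < 1 -> 0 < eps ->
  \forall t \near \oo, (0 < t)%N /\ limit_bound - eps <=
    2 * mu * (bl * (1 - Al ^+ t) / (1 - Al))
    - mu ^+ 2 * (((1 + delta) * D2S2_bound Ab bb Cb kb db delta t + K) / t%:R).
Proof.
move=> /andP[Al0 Al1] e0.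
pose c1 := 2 * mu * (bl / (1 - Al)).
(* Everything in the subtracted term that does not grow with t, hence is lost after division by
   t. *)
pose c2 := mu ^+ 2 * ((1 + delta) * (((bb + delta) * (Cb * db / (1 - Ab))
   + D2S2_cst bb Cb kb delta * (1 + D4_bound Ab bb db)) / (1 - Ab)) + K).
have pow0 : (c1 * Al ^+ t @[t --> \oo] --> 0)%classic.
  rewrite -(mulr0 c1); apply: cvgM; first exact: cvg_cst.
  by apply: cvg_expr; rewrite ger0_norm.
have e2 : 0 < eps / 2 by rewrite divr_gt0.
have nearA : \forall t \near \oo, c1 * Al ^+ t < eps / 2 by exact: cvgr_lt pow0 _ e2.
have nearB : \forall t \near \oo, c2 / (eps / 2) <= t%:R :> R by exact: nbhs_infty_ger.
near=> t.
have t0 : (0 < t)%N by near: t; exact: nbhs_infty_gt.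
split=> //.
have hA : c1 * Al ^+ t < eps / 2 by near: t.
have hB : c2 / (eps / 2) <= t%:R by near: t.
have tR : (0 : R) < t%:R by rewrite ltr0n.
have hB' : c2 / t%:R <= eps / 2.
  by rewrite ler_pdivrMr// mulrC -ler_pdivrMr.
rewrite (_ : 2 * mu * (bl * (1 - Al ^+ t) / (1 - Al))
    - mu ^+ 2 * (((1 + delta) * D2S2_bound Ab bb Cb kb db delta t + K) / t%:R) =
  limit_bound - c1 * Al ^+ t - c2 / t%:R).
  by move: hA hB'; set x := c1 * _; set y := c2 / _; lra.
rewrite /limit_bound /c1 /c2 /D2S2_bound /S2_bound.
move: (D2S2_cst bb Cb kb delta * (1 + D4_bound Ab bb db)) (Al ^+ t) (t%:R) tR => x y z z0.
(* At Ab = 1 every division by 1 - Ab takes its default value 0, and the identity persists. *)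
have [->|Ab1] := eqVneq (1 - Ab) 0.
  rewrite invr0 !mulr0; field; rewrite gt_eqF//= gt_eqF//.
  by rewrite subr_gt0.
field; rewrite Ab1 gt_eqF//= gt_eqF//.
by rewrite subr_gt0.
Unshelve. all: by end_near.
Qed.

End eventual_bound.

(** * The prior *)

Section prior.
Context {R : realType}.
Variables (c nu : R).
Hypothesis nu0 : 0 < nu.
Local Notation J := (`[c - nu, c + nu]%classic : set (measurableTypeR R)).

(** The prior density is the square of this function, left unnormalised; its mass 16 nu / 15 is
    carried along as [rho]. *)
Definition bump (s : R) : R := 1 - ((s - c) / nu) ^+ 2.
Definition bump1 (s : R) : R := - (2 * (s - c) / nu ^+ 2).

Let dshift (s : R) : is_derive s (1 : R) (fun y => y - c) 1.
Proof.
apply: (is_derive_val (is_derive_subr (is_derive_id s (1 : R)) (is_derive_const c s))).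
by rewrite subr0.
Qed.

Lemma is_derive_bump s : is_derive s (1 : R) bump (bump1 s).
Proof.
apply: (is_derive_val (is_derive_subr (is_derive_const 1 s)
  (is_derive_sq (is_derive_mulr (dshift s) (is_derive_const nu^-1 s))))).
by rewrite /bump1; field; rewrite gt_eqF.
Qed.

Lemma continuous_bump1 s : {for s, continuous bump1}.
Proof.
have k := is_derive_continuous (dshift s).
by rewrite /bump1; continuity.
Qed.

Lemma bump_left : bump (c - nu) = 0.
Proof. by rewrite /bump; field; rewrite gt_eqF. Qed.

Lemma bump_right : bump (c + nu) = 0.
Proof. by rewrite /bump; field; rewrite gt_eqF. Qed.

Let shift_sq_le s : c - nu <= s <= c + nu -> (s - c) ^+ 2 <= nu ^+ 2.
Proof.
move=> sJ; rewrite -[leLHS]real_normK ?num_real// lerXn2r ?nnegrE ?(ltW nu0)//.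
by rewrite ler_distl.
Qed.

Lemma bump_sq_le1 s : c - nu <= s <= c + nu -> bump s ^+ 2 <= 1.
Proof.
move=> sJ; rewrite expr_le1// /bump.
  by rewrite gerBl sqr_ge0.
by rewrite subr_ge0 expr_div_n ler_pdivrMr ?exprn_gt0// mul1r; exact: shift_sq_le.
Qed.

Lemma bump1_sq_le s : c - nu <= s <= c + nu -> bump1 s ^+ 2 <= 4 / nu ^+ 2.
Proof.
move=> sJ; have h := shift_sq_le sJ.
rewrite /bump1 (_ : _ ^+ 2 = 4 / nu ^+ 4 * (s - c) ^+ 2); last by field; rewrite gt_eqF.
rewrite (_ : 4 / nu ^+ 2 = 4 / nu ^+ 4 * nu ^+ 2); last by field; rewrite gt_eqF.
by apply: ler_wpM2l => //; nonneg.
Qed.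

Lemma integral_bump_sq :
  (\int[@lebesgue_measure R]_(s in J) (bump s ^+ 2)%:E = (16 / 15 * nu)%:E)%E.
Proof.
pose F s := (s - c) - 2 / (3 * nu ^+ 2) * ((s - c) * (s - c) ^+ 2)
  + (5 * nu ^+ 4)^-1 * ((s - c) * ((s - c) ^+ 2) ^+ 2).
have dF s : is_derive s (1 : R) F (bump s ^+ 2).
  have ds := dshift s.
  apply: (is_derive_val (is_derive_addr (is_derive_subr ds
    (is_derive_scale (2 / (3 * nu ^+ 2)) (is_derive_mulr ds (is_derive_sq ds))))
    (is_derive_scale (5 * nu ^+ 4)^-1 (is_derive_mulr ds (is_derive_sq (is_derive_sq ds)))))).
  by rewrite /bump; field; rewrite gt_eqF.
have cc : c - nu < c + nu by rewrite ltrBlDr -addrA ltrDl addr_gt0.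
have kg s : {for s, continuous (fun s => bump s ^+ 2)}.
  by apply: for_continuous_sq; exact: is_derive_continuous (is_derive_bump s).
apply: etrans (integral_derivative cc (fun s _ => dF s) (fun s _ => kg s)) _.
by congr EFin; rewrite /F; field; rewrite gt_eqF.
Qed.

End prior.

(** * The bound near a fixed parameter *)

Section local_lower_bound.
Context {R : realType} d (T : measurableType d).
Variables (P : R -> probability T R) (X : nat -> T -> R) (f dx : R) (j : R -> coefs R).
Variables (alpha beta th0 : R).
Hypotheses (f0 : f != 0) (th0I : alpha < th0 < beta).
Hypothesis mX : forall t, measurable_fun setT (X t).
Hypothesis smooth : forall s, alpha < s < beta -> smooth_coefs f j s.
Hypothesis law0 : forall s, alpha < s < beta -> obs_init X dx (P s).
Hypothesis lawS : forall s, alpha < s < beta -> obs_recursion X f (P s) (j s).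
Hypothesis A01 : cA (j th0) ^+ 2 < 1.

Let A2 s := cA (j s) ^+ 2.
Let b s := cB1 (j s) ^+ 2 * cP (j s).
Let C s := f ^+ 2 / cP (j s).
Let k s := (cP1 (j s) / (2 * cP (j s))) ^+ 2.
Let V := b th0 / (1 - A2 th0).
Let I := 2 * k th0 + C th0 * V.

Let P0 : 0 < cP (j th0). Proof. exact: posP (smooth th0I). Qed.
Let A1n : 1 - A2 th0 != 0. Proof. by rewrite gt_eqF// subr_gt0. Qed.
Let b0 : 0 <= b th0. Proof. by rewrite /b; nonneg. Qed.

(** The four coefficients entering the limit are controlled to within eta. Those that only affect
    bounded remainders are allowed the slack 1. *)
Let coefs_near (eta nu : R) : 0 < eta -> 0 < nu -> exists2 nu', 0 < nu' &
  forall s, th0 - nu' <= s <= th0 + nu' -> [/\ alpha < s < beta, `|s - th0| <= nu,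
    A2 th0 - eta <= A2 s <= A2 th0 + eta, b th0 - eta <= b s <= b th0 + eta &
    [/\ C s <= C th0 + eta, k s <= k th0 + eta,
       cc1 (j s) ^+ 2 * dx ^+ 2 <= cc1 (j th0) ^+ 2 * dx ^+ 2 + 1,
       4 * f ^+ 2 * cB1 (j s) ^+ 2 <= 4 * f ^+ 2 * cB1 (j th0) ^+ 2 + 1 &
       cB2 (j s) ^+ 2 * cP (j s) <= cB2 (j th0) ^+ 2 * cP (j th0) + 1 /\
       cc2 (j s) ^+ 2 * dx ^+ 2 <= cc2 (j th0) ^+ 2 * dx ^+ 2 + 1]].
Proof.
move=> eta0 nu0.
have [/is_derive_continuous kA _ /is_derive_continuous kB1 _ /is_derive_continuous kc1
  /is_derive_continuous kP _ kB2 kc2 kP1] := smooth th0I.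
have Pn : cP (j th0) != 0 by rewrite gt_eqF.
have P2n : 2 * cP (j th0) != 0 by rewrite mulf_neq0.
have up (g : R -> R) e : {for th0, continuous g} -> 0 < e -> \forall s \near th0, g s <= g th0 + e.
  by move=> kg e0; apply: (cvgr_le _ kg); rewrite ltrDl.
have low (g : R -> R) e : {for th0, continuous g} -> 0 < e -> \forall s \near th0, g th0 - e <= g s.
  by move=> kg e0; apply: (cvgr_ge _ kg); rewrite ltrBlDr ltrDl.
have kA2 : {for th0, continuous A2} by rewrite /A2; continuity.
have kb : {for th0, continuous b} by rewrite /b; continuity.
have kC : {for th0, continuous C} by rewrite /C; continuity.
have kk : {for th0, continuous k} by rewrite /k; continuity.
have kd : {for th0, continuous (fun s => cc1 (j s) ^+ 2 * dx ^+ 2)} by continuity.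
have kg : {for th0, continuous (fun s => 4 * f ^+ 2 * cB1 (j s) ^+ 2)} by continuity.
have ke : {for th0, continuous (fun s => cB2 (j s) ^+ 2 * cP (j s))} by continuity.
have kw : {for th0, continuous (fun s => cc2 (j s) ^+ 2 * dx ^+ 2)} by continuity.
have inI : \forall s \near th0, alpha < s < beta.
  have [a0 b0'] := andP th0I.
  near=> s; apply/andP; split; near: s; [exact: lt_nbhsr|exact: lt_nbhsl].
have innu : \forall s \near th0, `|s - th0| <= nu.
  near=> s; rewrite distrC; near: s; exact: cvgr_dist_le (@cvg_id _ _) _ nu0.
have : \forall s \near th0, [/\ alpha < s < beta, `|s - th0| <= nu,
    A2 th0 - eta <= A2 s <= A2 th0 + eta, b th0 - eta <= b s <= b th0 + eta &
    [/\ C s <= C th0 + eta, k s <= k th0 + eta,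
       cc1 (j s) ^+ 2 * dx ^+ 2 <= cc1 (j th0) ^+ 2 * dx ^+ 2 + 1,
       4 * f ^+ 2 * cB1 (j s) ^+ 2 <= 4 * f ^+ 2 * cB1 (j th0) ^+ 2 + 1 &
       cB2 (j s) ^+ 2 * cP (j s) <= cB2 (j th0) ^+ 2 * cP (j th0) + 1 /\
       cc2 (j s) ^+ 2 * dx ^+ 2 <= cc2 (j th0) ^+ 2 * dx ^+ 2 + 1]].
  near=> s; split; [by near: s|by near: s| | |split; last split].
  - by apply/andP; split; near: s; [exact: low|exact: up].
  - by apply/andP; split; near: s; [exact: low|exact: up].
  - by near: s; exact: up.
  - by near: s; exact: up.
  - by near: s; exact: (up (fun s => cc1 (j s) ^+ 2 * dx ^+ 2)).
  - by near: s; exact: (up (fun s => 4 * f ^+ 2 * cB1 (j s) ^+ 2)).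
  - by near: s; exact: (up (fun s => cB2 (j s) ^+ 2 * cP (j s))).
  - by near: s; exact: (up (fun s => cc2 (j s) ^+ 2 * dx ^+ 2)).
move=> /nbhs_ballP[e /= e0 he]; exists (e / 2); first by rewrite divr_gt0.
move=> s sJ; apply: he; rewrite /ball /= distrC.
apply: (@le_lt_trans _ _ (e / 2)); first by rewrite ler_distl.
by rewrite ltr_pdivrMr// ltr_pMr// ltr1n.
Unshelve. all: by end_near.
Qed.

Lemma local_lower_bound (nu eps : R) : 0 < nu -> 0 < eps ->
  \forall t \near \oo, forall (M : t.+1.-tuple R -> R) (risk : R),
    measurable_fun setT M -> 0 <= risk ->
    (forall s, alpha < s < beta -> `|s - th0| <= nu ->
      (\int[P s]_x ((M (obs X t x) - filter0 (j s) t (X^~ x)) ^+ 2)%:E <= risk%:E)%E) ->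
    V / I - eps <= t%:R * risk.
Proof.
move=> nu0 eps0; set S := V / I.
(* When b = 0, for instance when a = 0, V = 0 and the bound is trivial; otherwise I > 0. *)
have [b00|bn0] := eqVneq (b th0) 0.
  near=> t => M risk _ risk0 _.
  rewrite /S /V b00 !mul0r sub0r; apply: (@le_trans _ _ 0); first by rewrite oppr_le0 ltW.
  by rewrite mulr_ge0.
have b0' : 0 < b th0 by rewrite lt_neqAle eq_sym bn0 b0.
have A1p : 0 < 1 - A2 th0 by rewrite subr_gt0.
have V0 : 0 < V by rewrite divr_gt0.
have C0 : 0 < C th0 by rewrite divr_gt0// exprn_even_gt0.
have I0 : 0 < I.
  rewrite /I; apply: ltr_wpDl; last exact: mulr_gt0.
  by apply: mulr_ge0 => //; exact: sqr_ge0.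
pose mu := I^-1.
have mu0 : 0 < mu by rewrite invr_gt0.
(* All coefficients, and delta as well, are perturbed by the same eta in the unfavourable direction;
   continuity at 0, where the value is V / I, yields an eta that costs at most eps / 2. *)
pose phi eta := limit_bound (A2 th0 - eta) (b th0 - eta) (A2 th0 + eta) (b th0 + eta)
  (C th0 + eta) (k th0 + eta) eta mu.
have phi0 : phi 0 = S.
  rewrite /phi /limit_bound !subr0 !addr0 mul1r -/V -mulrA -/V.
  rewrite (_ : b th0 * _ / _ = V * I); last first.
    by rewrite /I /V; field.
  by rewrite /S /mu; field; rewrite gt_eqF.
have [eta [eta0 phieta etab etaA]] : exists eta, [/\ 0 < eta, S - eps / 2 < phi eta,
    eta < b th0 & A2 th0 + eta < 1].
  have kphi : {for 0, continuous phi}.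
    have ka : {for (0 : R), continuous (fun e : R => e)} by exact: cvg_id.
    have n1 : 1 - (A2 th0 - 0) != 0 by rewrite subr0.
    have n2 : 1 - (A2 th0 + 0) != 0 by rewrite addr0.
    by rewrite /phi /limit_bound; continuity;
      apply: (@for_continuousD _ (fun=> _) (fun y => y)) => //; exact: for_continuous_cst.
  have n1 : \forall e \near (0 : R), S - eps / 2 < phi e.
    by apply: (cvgr_gt _ kphi); rewrite phi0 ltrBlDr ltrDl divr_gt0.
  have n2 : \forall e \near (0 : R), e < b th0 by exact: lt_nbhsl.
  have n3 : \forall e \near (0 : R), e < 1 - A2 th0 by exact: lt_nbhsl.
  have : \forall e \near (0 : R)^'+, [/\ 0 < e, S - eps / 2 < phi e,
    e < b th0 & A2 th0 + e < 1].
    near=> e; split; first by near: e; exact: nbhs_right_gt.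
    - by near: e; exact: cvg_at_right_filter (@cvg_id _ _) _ n1.
    - by near: e; exact: cvg_at_right_filter (@cvg_id _ _) _ n2.
    - rewrite addrC -ltrBrDr; near: e.
      exact: cvg_at_right_filter (@cvg_id _ _) _ n3.
  by move=> /filter_ex.
have [nu' nu'0 hJ] := coefs_near eta0 nu0.
set u := th0 - nu'; set v := th0 + nu'.
have uv : u < v by rewrite /u /v ltrBlDr -addrA ltrDl addr_gt0.
have th0J : u <= th0 <= v by rewrite /u /v gerBl lerDl ltW.
pose Ab := A2 th0 + eta; pose bb := b th0 + eta; pose Cb := C th0 + eta; pose kb := k th0 + eta.
(* The lower bound on A^2 is clipped at 0 so that its powers stay in [0, 1]. *)
pose bl := b th0 - eta; pose Al := Num.max 0 (A2 th0 - eta).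
pose db := cc1 (j th0) ^+ 2 * dx ^+ 2 + 1; pose gb := 4 * f ^+ 2 * cB1 (j th0) ^+ 2 + 1.
pose eb := cB2 (j th0) ^+ 2 * cP (j th0) + 1; pose wb := cc2 (j th0) ^+ 2 * dx ^+ 2 + 1.
have A20 : 0 <= A2 th0 by exact: sqr_ge0.
have Ab01 : 0 <= Ab < 1 by rewrite etaA andbT addr_ge0// ltW.
have Al1 : Al < 1 by rewrite /Al gt_max ltr01 /= (le_lt_trans _ A01)// gerBl ltW.
have Al01 : 0 <= Al < 1 by rewrite Al1 andbT /Al le_max lexx.
have bl0 : 0 <= bl by rewrite subr_ge0 ltW.
(* Clipping can only increase 1 / (1 - Al), hence the bound. *)
have lim_ge : phi eta <= limit_bound Al bl Ab bb Cb kb eta mu.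
  rewrite /phi /limit_bound lerD2r ler_pM2l ?mulr_gt0//; apply: ler_wpM2l => //.
  have h : A2 th0 - eta <= Al by rewrite /Al le_max lexx orbT.
  by rewrite lef_pV2 ?posrE ?lerB// subr_gt0// (le_lt_trans h).
pose p := 4 / nu' ^+ 2; pose rho := 16 / 15 * nu'.
have rho0 : 0 < rho by rewrite mulr_gt0.
pose A2r := weight_remainder Ab bb db gb eb wb eta p.
have e2 : 0 < eps / 2 by rewrite divr_gt0.
have := @eventual_bound R Al bl Ab bb Cb kb db eta mu (A2r * (v - u) / rho) _ Al01 e2.
apply: filterS => t [t0 ht] M risk mM risk0 hrisk.
have tR : (0 : R) < t%:R by rewrite ltr0n.
have sm s : u <= s <= v -> smooth_coefs f j s by move=> /hJ[+ _ _ _ _]; exact: smooth.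
have l0 s : u <= s <= v -> obs_init X dx (P s) by move=> /hJ[+ _ _ _ _]; exact: law0.
have lS s : u <= s <= v -> obs_recursion X f (P s) (j s) by move=> /hJ[+ _ _ _ _]; exact: lawS.
set A1 := (1 + eta) * D2S2_bound Ab bb Cb kb db eta t in ht *.
have A1A2 : 0 <= A1 /\ 0 <= A2r.
  have [_ _ /andP[_ ha] /andP[_ hb] [hC hk hd hg [he hw]]] := hJ _ th0J.
  have hD := moment_D2S2 mX P0 (l0 _ th0J) (lS _ th0J) Ab01 ha hb hC hk hd t eta0.
  have hW := moment_W2 mX P0 (l0 _ th0J) (lS _ th0J) Ab01 ha hb hd hg he hw t.
  have D0 : 0 <= D2S2_bound Ab bb Cb kb db eta t.
    by rewrite -lee_fin; apply: le_trans hD; apply: integral_ge0 => x _; rewrite lee_fin sqr_ge0.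
  have W0 : 0 <= W2_bound Ab bb db gb eb wb.
    by rewrite -lee_fin; apply: le_trans hW; apply: integral_ge0 => x _; rewrite lee_fin sqr_ge0.
  have p0 : 0 <= p by rewrite /p; nonneg.
  have vb0 : 0 <= db + bb / (1 - Ab).
    have Ab1' : 0 < 1 - Ab by case/andP: Ab01 => _; rewrite subr_gt0.
    by rewrite /db /bb; nonneg.
  by split; [rewrite /A1; nonneg|rewrite /A2r /weight_remainder; nonneg].
have [A10 A2r0] := A1A2.
have pw : 0 <= 1 - Al ^+ t.
  by have [Al0 _] := andP Al01; rewrite subr_ge0 exprn_ile1// ltW.
have Al1p : 0 < 1 - Al by rewrite subr_gt0.
pose Vlo := bl * (1 - Al ^+ t) / (1 - Al).
have Vlo0 : 0 <= Vlo by rewrite /Vlo; nonneg.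
have VloE s : u <= s <= v ->
    (Vlo%:E <= \int[P s]_x (filter1 f (j s) t (X^~ x) ^+ 2)%:E)%E.
  move=> sJ; have [_ _ /andP[ha _] /andP[hb _] _] := hJ _ sJ.
  rewrite (moment_D2 mX (posP (sm _ sJ)) (l0 _ sJ) (lS _ sJ)) lee_fin.
  by apply: sensitivity_ge => //; rewrite /Al ge_max sqr_ge0.
have riskE s : u <= s <= v ->
    (\int[P s]_x ((M (obs X t x) - filter0 (j s) t (X^~ x)) ^+ 2)%:E <= risk%:E)%E.
  by move=> /hJ[sI snu _ _ _]; exact: hrisk.
have wE s : u <= s <= v ->
    (\int[P s]_x (van_trees_weight X f j (bump th0 nu') (bump1 th0 nu') t s x ^+ 2)%:E <=
     (A1 * bump th0 nu' s ^+ 2 + A2r)%:E)%E.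
  move=> sJ; have [_ _ /andP[_ ha] /andP[_ hb] [hC hk hd hg [he hw]]] := hJ _ sJ.
  apply: (weight_moment mX (posP (sm _ sJ)) (l0 _ sJ) (lS _ sJ) Ab01 ha hb hC hk hd hg he hw) => //.
    exact: bump_sq_le1.
  exact: bump1_sq_le.
have lam0 : 0 <= mu / t%:R by rewrite divr_ge0// ltW.
have := averaged_van_trees uv th0J mX sm l0 lS (fun s _ => is_derive_bump th0 nu'0 s)
  (fun s _ => @continuous_bump1 _ th0 nu' s) (bump_left th0 nu'0) (bump_right th0 nu'0) mM lam0
  Vlo0 risk0 A10 A2r0 (integral_bump_sq th0 nu'0) VloE riskE wE.
rewrite -/rho => vt.
(* The averaged inequality with lam = mu / t, multiplied by t and divided by the mass [rho] of the
   prior. *)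
have key : 2 * mu * Vlo - mu ^+ 2 * ((A1 + A2r * (v - u) / rho) / t%:R) <= t%:R * risk.
  rewrite -(ler_pM2r rho0) -(ler_pM2r (_ : 0 < t%:R^-1)) ?invr_gt0//.
  rewrite (_ : t%:R * risk * rho / t%:R = risk * rho); last by field; rewrite gt_eqF.
  rewrite (_ : _ / t%:R = 2 * (mu / t%:R) * Vlo * rho - (mu / t%:R) ^+ 2 * (A1 * rho + A2r * (v - u))).
    by rewrite lerBlDr.
  by field; rewrite !gt_eqF.
apply: le_trans key; apply: le_trans ht.
by move: phieta lim_ge; rewrite -/S; move: (phi eta) (limit_bound _ _ _ _ _ _ _ _) => x y; lra.
Unshelve. all: by end_near.
Qed.

End local_lower_bound.

(** * Lower limits and one-sided limits *)

Section limits.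
Context {R : realType}.

Lemma limn_einfE (u : (\bar R)^nat) : limn_einf u = ereal_sup (range (einfs u)).
Proof. by rewrite limn_einf_lim; apply/cvg_lim => //; exact: cvg_einfs_sup. Qed.

Lemma limn_einf_ge (u : (\bar R)^nat) l : (\forall n \near \oo, (l <= u n)%E) ->
  (l <= limn_einf u)%E.
Proof.
move=> [N _ lu]; rewrite limn_einfE; apply: le_ereal_sup_tmp.
exists (einfs u N); first by exists N.
by apply: le_ereal_inf_tmp => _ [n /= Nn <-]; exact: lu.
Qed.

Lemma le_limn_einf (u v : (\bar R)^nat) : (forall n, (u n <= v n)%E) ->
  (limn_einf u <= limn_einf v)%E.
Proof.
move=> uv; rewrite !limn_einfE; apply: ge_ereal_sup => _ [n _ <-].
apply: le_ereal_sup_tmp; exists (einfs v n); first by exists n.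
apply: le_ereal_inf_tmp => _ [k /= nk <-].
by apply: le_trans (uv k); apply: ereal_inf_lbound; exists k.
Qed.

(** [lim] is meaningful only if the limit exists; here monotonicity in nu provides it, as an infimum
    over nu > 0. *)
Lemma lim_at_right_ge (F : R -> \bar R) l :
  (forall x y, 0 < x -> x <= y -> (F x <= F y)%E) -> (forall x, 0 < x -> (l <= F x)%E) ->
  (l <= lim (F @ 0^'+))%E.
Proof.
move=> ndF lF.
have nd : {in Interval (BRight 0) +oo%O &, {homo F : x y / x <= y >-> (x <= y)%E}}.
  by move=> x y; rewrite !in_itv /= !andbT => x0 _; exact: ndF.
have b0 : (BRight (0 : R) < BInfty R false)%O by [].
have := nondecreasing_at_right_cvge _ b0 nd.
move=> /cvg_lim -> //; apply: le_ereal_inf_tmp => _ [x /= + <-].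
by rewrite in_itv /= andbT; exact: lF.
Qed.

Lemma near_truncn (tau : R) (Q : nat -> Prop) : 0 < tau -> (\forall t \near \oo, Q t) ->
  \forall N \near \oo, Q (Num.truncn (tau * N%:R)).
Proof.
move=> tau0 [t0 _ Qt]; near=> N; apply: Qt => /=.
rewrite Num.Theory.truncn_ge_nat ?mulr_ge0 ?(ltW tau0)// mulrC -ler_pdivrMr//.
by near: N; exact: nbhs_infty_ger.
Unshelve. all: by end_near.
Qed.

End limits.

(** * The whole parametric family *)

Section parametric_model.
Context {R : realType} d (Omega : measurableType d).
Variables (f a sigma dx dy alpha beta : R).
Hypotheses (f0 : f != 0) (a01 : 0 <= a ^+ 2 < 1) (sigma20 : 0 < sigma ^+ 2) (alpha0 : 0 < alpha).
Variables (P : R -> probability Omega R) (rho : R -> R).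
Variables (X Y : nat -> {mfun Omega >-> R}) (w v : R -> nat -> {mfun Omega >-> R}).
Hypothesis model : forall th, alpha < th < beta ->
  hidden_ar_model f a sigma dx dy (rho th) th (P th) X Y (w th) (v th).
Hypothesis krho : forall th, alpha < th < beta -> {for th, continuous rho}.
Variable m : R -> nat -> Omega -> R.
Hypothesis hm : forall th, alpha < th < beta -> forall t : nat,
  is_cond_exp (P th) (g_sigma_algebra_preimage (obs X t)) (Y t) (m th t).
Hypothesis hgamma : forall th, alpha < th < beta ->
  ('E_(P th)[(fun x => (Y 0%N x - m th 0%N x) ^+ 2)%R] = (gamma_star f a sigma th)%:E)%E.

Local Notation gam := (gamma_star f a sigma).
Definition regression (th : R) : R := rho th / dx ^+ 2.
Local Notation c := regression.
Definition family_coefs := model_coefs f a sigma c dx.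
Local Notation j := family_coefs.

Let mX t : measurable_fun setT (X t). Proof. exact: measurable_funPT. Qed.

Let pos th : alpha < th < beta -> 0 < th.
Proof. by case/andP=> h _; exact: lt_trans h. Qed.

Let gammaE th : alpha < th < beta -> dy ^+ 2 - gam th = c th ^+ 2 * dx ^+ 2.
Proof.
move=> thI; rewrite (initial_error_var (model thI) (hm thI) (hgamma thI)).
have [_ _ _ _ [XY0 VX VY EXY]] := model thI.
have := regression_coefE (mX 0) (measurable_funPT (Y 0%N)) XY0 VX VY EXY.
rewrite -/(c th); move: (c th) (rho th) => k r <-; ring.
Qed.

(** At a larger parameter of the open interval dy^2 - gamma is still nonnegative, and gamma
    increases strictly, so dy^2 - gamma is positive here. Both dx and the regression coefficient are
    therefore nonzero. *)
Let regression_gt0 th : alpha < th < beta -> 0 < c th ^+ 2 * dx ^+ 2.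
Proof.
move=> thI; have /andP[ath thb] := thI.
pose th' := (th + beta) / 2.
have tt : th < th' by rewrite /th' midf_lt.
have th'I : alpha < th' < beta by rewrite (lt_trans ath tt)/= /th' midf_lt.
have := gammaE th'I; have := gammaE thI.
have := gamma_star_lt f0 a01 sigma20 (pos thI) tt.
have : 0 <= c th' ^+ 2 * dx ^+ 2 by rewrite mulr_ge0 ?sqr_ge0.
move: (c th' ^+ 2 * dx ^+ 2) (c th ^+ 2 * dx ^+ 2) (gam th) (gam th') => x y g g'.
lra.
Qed.

Let dx0 th : alpha < th < beta -> dx != 0.
Proof.
by move=> /regression_gt0; apply: contraTneq => ->; rewrite expr0n mulr0 ltxx.
Qed.

Let c0 th : alpha < th < beta -> c th != 0.
Proof.
by move=> /regression_gt0; apply: contraTneq => ->; rewrite expr0n mul0r ltxx.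
Qed.

Lemma family_coefs_smooth th : alpha < th < beta -> smooth_coefs f j th.
Proof.
move=> thI; apply: (model_coefs_smooth f0 sigma20 (pos thI) (dx0 thI) (c0 thI) (dy2 := dy ^+ 2)).
  by apply: (for_continuousM (krho thI)); exact: for_continuous_cst.
have /andP[ath thb] := thI.
near=> s; apply: gammaE; apply/andP; split; near: s; [exact: lt_nbhsr|exact: lt_nbhsl].
Unshelve. all: by end_near.
Qed.

Let sigma0 : sigma != 0.
Proof. by apply: contraTneq sigma20 => ->; rewrite expr0n ltxx. Qed.

Let th0n th : alpha < th < beta -> th != 0.
Proof. by move=> /pos th0; rewrite gt_eqF. Qed.

Let gam0 th : alpha < th < beta -> 0 < gam th.
Proof. by move=> /pos; exact: gamma_star_gt0. Qed.

Let riccati th : alpha < th < beta ->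
  gam th = th ^+ 2 + a ^+ 2 * sigma ^+ 2 * gam th / (sigma ^+ 2 + f ^+ 2 * gam th).
Proof. by move=> /pos th0; exact: riccati_equation. Qed.

Let cAE th : alpha < th < beta -> cA (j th) = a * sigma ^+ 2 / (sigma ^+ 2 + f ^+ 2 * gam th).
Proof.
move=> thI; have := filter_gainE a f sigma0 (gam0 thI).
rewrite /= /P_coef; set x := _ / _; set y := a * f * _ / _ => E.
by rewrite -{1}E addrK.
Qed.

Lemma family_cA_sq_lt1 th : alpha < th < beta -> cA (j th) ^+ 2 < 1.
Proof.
move=> thI; rewrite cAE//; have Pg := innovation_var_gt0 f sigma0 (gam0 thI).
have g0 := gam0 thI; have [_] := andP a01; apply: le_lt_trans.
rewrite -mulrA exprMn ler_piMr ?sqr_ge0// expr_le1//.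
  by rewrite ler_pdivrMr// mul1r lerDl mulr_ge0 ?sqr_ge0// ltW.
by apply: divr_ge0; exact: ltW.
Qed.

Let filterE th t x : alpha < th < beta ->
  filter0 (j th) t x = linear_filter (rho th / dx ^+ 2)
    (a * sigma ^+ 2 / (sigma ^+ 2 + f ^+ 2 * gam th))
    (a * f * gam th / (sigma ^+ 2 + f ^+ 2 * gam th)) t x.
Proof. by move=> thI; rewrite filter0E cAE. Qed.

Lemma family_obs_init th : alpha < th < beta -> obs_init X dx (P th).
Proof. by move=> thI F mF F0; exact: (obs0_law (model thI)). Qed.

Lemma family_obs_recursion th : alpha < th < beta -> obs_recursion X f (P th) (j th).
Proof.
move=> thI t F mF F0.
have := model_obs_law (model thI) (hm thI) (hgamma thI) sigma0 (th0n thI) (gam0 thI)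
  (riccati thI) mF F0.
move=> ->; apply: eq_integral => x _; apply: eq_integral => z _.
by rewrite filterE.
Qed.

Lemma family_risk th t (M : t.+1.-tuple R -> R) : alpha < th < beta -> measurable_fun setT M ->
  ('E_(P th)[(fun x => (`| M (obs X t x) - m th t x | ^+ 2)%R)] =
   \int[P th]_x ((M (obs X t x) - filter0 (j th) t ((fun i x => X i x)^~ x)) ^+ 2)%:E)%E.
Proof.
move=> thI mM; rewrite unlock.
have mMo : measurable_fun setT (fun x => M (obs X t x)).
  by apply: measurableT_comp => //; exact: measurable_obs.
have mmt : measurable_fun setT (m th t).
  by case: (hm thI t) => _ /integrableP[/measurable_EFinP].
apply: ae_eq_integral => //.
- apply/measurable_EFinP; apply: measurable_fun_pow.
  by apply: measurableT_comp => //; exact: measurable_funB.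
- apply/measurable_EFinP; apply: measurable_fun_pow; apply: measurable_funB => //.
  by apply: (@measurable_filter0 _ _ _ (fun=> j th) (fun i x => X i x)).
- have := cond_exp_filter (model thI) (hm thI) (hgamma thI) sigma0 (th0n thI) (gam0 thI)
    (riccati thI) t.
  apply: filterS => x E _ /=; rewrite E real_normK ?num_real//; congr ((_ - _) ^+ 2)%:E.
  by rewrite filterE//; apply: eq_linear_filter => i it; rewrite nth_obs.
Qed.

End parametric_model.

Theorem theorem4 (R : realType) (d : measure_display) (Omega : measurableType d)
  (f a sigma dx dy alpha beta : R)
  (hf : f != 0) (ha : 0 <= a ^+ 2 < 1) (hsigma : 0 < sigma ^+ 2)
  (halpha : 0 < alpha) (hbeta : alpha < beta)
  (* dx, dy being known and fixed, hgamma forces the covariance rho of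
     (X_0, Y_0) to vary with theta; it determines rho only up to sign, and
     hrho excludes sign jumps. *)
  (P : R -> probability Omega R) (rho : R -> R)
  (X Y : nat -> {mfun Omega >-> R}) (w v : R -> nat -> {mfun Omega >-> R})
  (hmodel : forall th, alpha < th < beta ->
     hidden_ar_model f a sigma dx dy (rho th) th (P th) X Y (w th) (v th))
  (hrho : forall th, alpha < th < beta -> {for th, continuous rho})
  (m : R -> nat -> Omega -> R)
  (hm : forall th, alpha < th < beta -> forall t : nat,
     is_cond_exp (P th) (g_sigma_algebra_preimage (obs X t)) (Y t) (m th t))
  (hgamma : forall th, alpha < th < beta ->
     ('E_(P th)[(fun x => (Y 0%N x - m th 0%N x) ^+ 2)%R]
       = (gamma_star f a sigma th)%:E)%E)
  (tau : R) (htau : 0 < tau <= 1)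
  (th0 : R) (hth0 : alpha < th0 < beta)
  (mbar : forall N : nat, (Num.truncn (tau * N%:R)).+1.-tuple R -> R)
  (hmbar : forall N, measurable_fun setT (mbar N)) :
  ((S_b_star_sq f a sigma th0)%:E <=
   lim ((fun nu : R =>
     limn_einf (fun N : nat =>
       ereal_sup
         [set ((Num.truncn (tau * N%:R))%:R)%:E *
              'E_(P th)[(fun x =>
                 (`| mbar N (obs X (Num.truncn (tau * N%:R)) x)
                     - m th (Num.truncn (tau * N%:R)) x | ^+ 2)%R)]
         | th in [set th : R | (alpha < th < beta)%R /\
                               (`|th - th0| <= nu)%R]]))
     @ 0^'+))%E.
Proof.
have [tau0 _] := andP htau.
pose j := family_coefs f a sigma dx rho.
have mX t : measurable_fun setT (X t) by exact: measurable_funPT.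
have sm := family_coefs_smooth hf ha hsigma halpha hmodel hrho hm hgamma.
have l0 := family_obs_init hmodel.
have lS := family_obs_recursion hf hsigma halpha hmodel hm hgamma.
have risk := family_risk hf hsigma halpha hmodel hm hgamma.
have th00 : 0 < th0 by case/andP: hth0 => h _; exact: lt_trans h.
have A01 := family_cA_sq_lt1 dx hf ha hsigma halpha rho hth0.
apply: lim_at_right_ge => [nu nu' nu0 nunu'|nu nu0].
  apply: le_limn_einf => N; apply: ereal_sup_le => _ [th [thI hth] <-].
  by exists th => //; split => //; exact: le_trans hth nunu'.
apply/lee_subgt0Pr => eps eps0.
apply: limn_einf_ge.
have loc := local_lower_bound hf hth0 mX sm l0 lS A01 nu0 eps0.
have pos : \forall t \near \oo, (0 < t)%N by exact: nbhs_infty_gt.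
have := near_truncn tau0 pos; have := near_truncn tau0 loc.
apply: filterS2 => N hN t0; set t := Num.truncn _ in hN t0 *.
set E := [set _ | _ in _]; set u := ereal_sup E.
have uE th : alpha < th < beta -> `|th - th0| <= nu ->
    (t%:R%:E * 'E_(P th)[(fun x => (`| mbar N (obs X t x) - m th t x | ^+ 2)%R)] <= u)%E.
  by move=> thI hth; apply: ereal_sup_ubound; exists th.
have tR : (0 : R) < t%:R by rewrite ltr0n.
have u0 : (0 <= u)%E.
  apply: le_trans (uE th0 hth0 _); last by rewrite subrr normr0 ltW.
  by rewrite mule_ge0 ?lee_fin//; apply: expectation_ge0 => x; exact: sqr_ge0.
(* An infinite supremum exceeds any bound. A finite one, r, bounds every risk by r / t, the uniform
   bound that [local_lower_bound] takes. *)
case: u uE u0 => [r||] uE u0; [|exact: leey|by []].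
rewrite -EFinB lee_fin (S_b_star_sqE hf ha hsigma th00).
have -> : r = t%:R * (r / t%:R) by rewrite mulrC divfK// gt_eqF.
apply: hN; first exact: hmbar.
  by rewrite divr_ge0// ltW.
move=> s sI hs; rewrite -(risk s t (mbar N) sI (hmbar N)).
have ti : (0 <= (t%:R^-1 : R)%:E)%E by rewrite lee_fin invr_ge0 ltW.
have := lee_wpmul2l ti (uE s sI hs).
by rewrite muleA -!EFinM mulVf ?gt_eqF// mul1e mulrC.
Qed.
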